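(* Let $\theta\in\mathbb{R}$ be irrational and let $\alpha:\mathbb{Z}\to\mathrm{Aut}(C(\mathbb{T}))$ be given by $\alpha_n(f)(z)=f(e^{2\pi in\theta}z)$, $f\in C(\mathbb{T})$, $z\in\mathbb{T}$, $n\in\mathbb{Z}$. For $f\in L^1(\mathbb{T})$ let $T_f:C(\mathbb{T})\to C(\mathbb{T})$ be the convolution map $T_f(g)=f\ast g$, and for $u\in A(\mathbb{Z})$ let $F_{T_f,u}:\mathbb{Z}\to\mathrm{CB}(C(\mathbb{T}))$ be given by $F_{T_f,u}(n)=u(n)T_f$. Then the functions $F_{T_f,u}$, where $f\in L^1(\mathbb{T})$ and $u\in A(\mathbb{Z})$, have a dense linear span (with respect to $\|\cdot\|_{\rm m}$) in $\mathfrak{S}^{\rm inv}_{\rm cc}(C(\mathbb{T}),\mathbb{Z},\alpha)$.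
   Context: For a discrete group $G$, a non-degenerate C*-algebra $A\subseteq\mathcal{B}(H)$ and a homomorphism $\alpha:G\to\mathrm{Aut}(A)$, on $\mathcal{H}=\ell^2(G,H)$ put $(\lambda_t\xi)(s)=\xi(t^{-1}s)$ and $(\pi(a)\xi)(s)=\alpha_{s^{-1}}(a)(\xi(s))$. For $f\in\ell^1(G,A)$ let $\tilde\pi(f)=\sum_{s\in G}\pi(f(s))\lambda_s$; the reduced crossed product $A\rtimes_{\alpha,r}G$ is the norm closure of $\tilde\pi(\ell^1(G,A))$ (up to canonical isomorphism independent of the faithful representation of $A$). A bounded map $F:G\to\mathrm{CB}(A)$ is a Herz-Schur $(A,G,\alpha)$-multiplier if the map $S_F:\tilde\pi(f)\mapsto\tilde\pi(F\cdot f)$, where $(F\cdot f)(t)=F(t)(f(t))$, is completely bounded; $S_F$ also denotes its completely bounded extension to $A\rtimes_{\alpha,r}G$, and $\|F\|_{\rm m}=\|S_F\|_{\rm cb}$. $\mathfrak{S}^{\rm inv}_{\rm cc}(A,G,\alpha)$ is the set of Herz-Schur $(A,G,\alpha)$-multipliers $F$ such that $S_F$ is completely compact and $\alpha_t\circ F(s)=F(s)\circ\alpha_t$ for all $s,t\in G$. A completely bounded map $\Psi:\mathcal{X}\to\mathcal{Z}$ between operator spaces is completely compact if for every $\epsilon>0$ there is a finite dimensional subspace $\mathcal{Y}\subseteq\mathcal{Z}$ such that $\mathrm{dist}(\Psi^{(m)}(x),M_m(\mathcal{Y}))<\epsilon$ for all $m\in\mathbb{N}$ and all $x\in M_m(\mathcal{X})$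 with $\|x\|\le1$. $A(\mathbb{Z})$ is the Fourier algebra of $\mathbb{Z}$, i.e. the set of functions $n\mapsto(\lambda^0_n\xi,\eta)$ with $\lambda^0$ the left regular representation and $\xi,\eta\in\ell^2(\mathbb{Z})$ (equivalently, the Fourier coefficient sequences of functions in $L^1(\mathbb{T})$). *)

(* Defs.v *)
From HB Require Import structures.
From mathcomp Require Import all_boot all_order all_algebra complex.
From mathcomp Require Import all_classical all_reals all_analysis.

Set Implicit Arguments.
Unset Strict Implicit.
Unset Printing Implicit Defensive.

Import Order.TTheory GRing.Theory Num.Theory numFieldNormedType.Exports.

Local Open Scope classical_set_scope.
Local Open Scope ring_scope.

HB.instance Definition _ (R : realType) :=
  NormedModule.copy R[i] (R[i] : numClosedFieldType).

(* A Hilbert space is a [completeNormedModType R[i]] whose norm comes from an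
   inner product; the inner product is linear in its first argument. *)
Definition hilbert_dot (R : realType) (H : completeNormedModType R[i])
    (dot : {dot H for Num.conj}) : Prop :=
  forall v : H, `|v| ^+ 2 = dot v v.

(* An operator space is a subset [os_set] of an ambient vector space together
   with its matrix norms. The ambient space may be larger than the operator
   space: only the values on [os_set] are ever used. The matrix norms are
   [+oo] on matrices of unbounded operators. *)
Record opspace (R : realType) := OpSpace {
  os_ambient :> lmodType R[i];
  os_set : set os_ambient;
  os_norm : forall m : nat, 'M[os_ambient]_m -> \bar R }.

Section OperatorSpaces.
Variable R : realType.

(* The norm of a matrix of operators as an operator on the m-fold direct sum
   of the Hilbert space {x : E | q x < +oo}, where [q] is the square of the
   norm. *)
Definition opmx_norm (E : lmodType R[i]) (q : E -> \bar R) (m : nat)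
    (X : 'M[E -> E]_m) : \bar R :=
  ereal_inf [set c%:E | c in [set c : R | 0 <= c /\
    forall xi : 'I_m -> E, (\sum_(j < m) q (xi j) < +oo)%E ->
      (\sum_(i < m) q (\sum_(j < m) X i j (xi j))%R
         <= (c ^+ 2)%:E * \sum_(j < m) q (xi j))%E]].

Definition os_norm1 (X : opspace R) (x : X) : \bar R :=
  os_norm (const_mx x : 'M[X]_1).

Definition cb_norm (X Z : opspace R) (Psi : X -> Z) : \bar R :=
  ereal_sup [set r | exists m (x : 'M[X]_m),
    [/\ forall i j, os_set (x i j), (os_norm x <= 1)%E &
        r = os_norm (map_mx Psi x)]].

Definition completely_bounded (X Z : opspace R) (Psi : X -> Z) : Prop :=
  [/\ forall x, os_set x -> os_set (Psi x),
      forall (c : R[i]) x y, os_set x -> os_set y ->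
        Psi (c *: x + y) = c *: Psi x + Psi y &
      (cb_norm Psi < +oo)%E].

Definition in_span (V : lmodType R[i]) (k : nat) (y : 'I_k -> V) (v : V) :=
  exists c : 'I_k -> R[i], v = \sum_(l < k) c l *: y l.

Definition completely_compact (X Z : opspace R) (Psi : X -> Z) : Prop :=
  forall e : R, 0 < e -> exists k (y : 'I_k -> Z),
    (forall l, os_set (y l)) /\
    forall m (x : 'M[X]_m), (forall i j, os_set (x i j)) ->
      (os_norm x <= 1)%E ->
      exists w : 'M[Z]_m, (forall i j, in_span y (w i j)) /\
        (os_norm (map_mx Psi x - w) < e%:E)%E.

End OperatorSpaces.

Section SquareSummable.
Variables (R : realType) (V : normedModType R[i]).

Definition norm_sq (v : V) : \bar R := (complex.Re `|v| ^+ 2)%:E.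

Definition l2_sq (xi : int -> V) : \bar R :=
  (\esum_(s in [set: int]) norm_sq (xi s))%E.

Definition l2 : set (int -> V) := [set xi | (l2_sq xi < +oo)%E].

Definition zsum (u : int -> V) : V :=
  limn (fun n : nat => \sum_(k < n.*2.+1) u (k%:Z - n%:Z)).

End SquareSummable.

Section CrossedProduct.
Variables (R : realType) (H : completeNormedModType R[i]).
(* The algebra is [inA], a subset of [A], represented on [H] by [rho]. *)
Variables (A : lmodType R[i]) (inA : set A) (rho : A -> H -> H).
Variable alpha : int -> A -> A.

Definition alg_space : opspace R :=
  @OpSpace R A inA (fun m x => opmx_norm (@norm_sq R H) (map_mx rho x)).

(* Operators on l2(Z, H) are given by maps on all families; two of them are
   the same operator when they agree on [l2], i.e. when their difference has
   norm 0. *)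
Definition l2op : lmodType R[i] := (int -> H) -> (int -> H).

Definition regular (t : int) : l2op := fun xi s => xi (s - t).

Definition pi_rep (a : A) : l2op := fun xi s => rho (alpha (- s) a) (xi s).

Definition l1 : set (int -> A) := [set f |
  (forall s, inA (f s)) /\
  (\esum_(s in [set: int]) @os_norm1 R alg_space (f s) < +oo)%E].

Definition pi_tilde (f : int -> A) : l2op :=
  fun xi t => zsum (fun s => pi_rep (f s) (regular s xi) t).

Definition l2op_norm (m : nat) (X : 'M[l2op]_m) : \bar R :=
  opmx_norm (@l2_sq R H) X.

Definition l2op_norm1 (X : l2op) : \bar R := l2op_norm (const_mx X : 'M[l2op]_1).

Definition bounded_l2op : set l2op := [set X |
  (forall (c : R[i]) xi eta, l2 xi -> l2 eta ->
     forall s, X (c *: xi + eta) s = c *: X xi s + X eta s) /\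
  (l2op_norm1 X < +oo)%E].

Definition crossed_product : opspace R :=
  @OpSpace R l2op [set X | bounded_l2op X /\
    forall e : R, 0 < e ->
      exists f, l1 f /\ (l2op_norm1 (X - pi_tilde f) < e%:E)%E] l2op_norm.

Definition multiply (F : int -> A -> A) (f : int -> A) : int -> A :=
  fun t => F t (f t).

Definition herz_schur (F : int -> A -> A) : Prop :=
  [/\ forall n, @completely_bounded R alg_space alg_space (F n),
      exists M : R, forall n, (@cb_norm R alg_space alg_space (F n) <= M%:E)%E &
      exists M : R, forall m (f : 'M[int -> A]_m), (forall i j, l1 (f i j)) ->
        (l2op_norm (map_mx (fun g => pi_tilde (multiply F g)) f)
           <= M%:E * l2op_norm (map_mx pi_tilde f))%E].

(* For a Herz-Schur multiplier [F], the continuous extension to the crossed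
   product of the map sending [pi_tilde f] to [pi_tilde (multiply F f)]: the
   closure of the graph of that map. The value is unique as an operator on
   l2(Z, H). *)
Definition S_map (F : int -> A -> A) : crossed_product -> crossed_product :=
  fun X => xget 0 [set Y : crossed_product | os_set Y /\
    forall e : R, 0 < e -> exists f, [/\ l1 f,
      (l2op_norm1 (X - pi_tilde f) < e%:E)%E &
      (l2op_norm1 (Y - pi_tilde (multiply F f)) < e%:E)%E]].

Definition hs_norm (F : int -> A -> A) : \bar R := cb_norm (S_map F).

Definition hs_inv_cc (F : int -> A -> A) : Prop :=
  [/\ herz_schur F, completely_compact (S_map F) &
      forall s t a, inA a -> alpha t (F s a) = F s (alpha t a)].

End CrossedProduct.

Section Circle.
Variable R : realType.

Definition circle : Type := set_type [set z : R[i] | `|z| = 1].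

Lemma circle_mul_subproof (z w : circle) :
  (set_val z * set_val w : R[i]) \in [set z : R[i] | `|z| = 1].
Proof.
have := set_valP z; have := set_valP w => /= w1 z1.
by apply/mem_set => /=; rewrite normrM z1 w1 mulr1.
Qed.

Definition circle_mul (z w : circle) : circle :=
  SigSub (circle_mul_subproof z w).

Lemma circle_exp_subproof (t : R) :
  (cos (2 * pi * t) +i* sin (2 * pi * t))%C \in [set z : R[i] | `|z| = 1].
Proof. by apply/mem_set; rewrite /= normc_def /= cos2Dsin2 sqrtr1. Qed.

Definition circle_exp (t : R) : circle := SigSub (circle_exp_subproof t).

Definition C_circle : set (circle -> R[i]) := [set g | continuous g].

Definition rotation (theta : R) (n : int) (g : circle -> R[i]) :
    circle -> R[i] :=
  fun z => g (circle_mul (circle_exp (n%:~R * theta)) z).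

(* Integration for the normalised arc length is integration over [0, 1] along
   [circle_exp]. *)
Definition L1_circle : set (circle -> R[i]) := [set f |
  lebesgue_measure.-integrable `[0, 1]
    (fun t : R => (complex.Re (f (circle_exp t)))%:E) /\
  lebesgue_measure.-integrable `[0, 1]
    (fun t : R => (complex.Im (f (circle_exp t)))%:E)].

Definition cintegral (h : R -> R[i]) : R[i] :=
  (Rintegral lebesgue_measure `[0, 1] (fun t => complex.Re (h t)) +i*
   Rintegral lebesgue_measure `[0, 1] (fun t => complex.Im (h t)))%C.

(* (f * g)(z) is the integral of f(w) g(w^-1 z) over w in the circle. *)
Definition convolution (f g : circle -> R[i]) : circle -> R[i] :=
  fun z => cintegral (fun t =>
    f (circle_exp t) * g (circle_mul (circle_exp (- t)) z)).

(* A faithful non-degenerate *-representation of the algebra of continuous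
   functions on the circle, i.e. a realisation of it as a non-degenerate
   C*-algebra of bounded operators on [H]. *)
Record faithful_rep (H : completeNormedModType R[i]) (dot : {dot H for Num.conj})
    (rho : (circle -> R[i]) -> H -> H) : Prop := FaithfulRep {
  rep_bounded : forall a, C_circle a -> linear (rho a) /\ continuous (rho a);
  rep_linear : forall (c : R[i]) a b, C_circle a -> C_circle b ->
    rho (c *: a + b) = c *: rho a + rho b;
  rep_mul : forall a b, C_circle a -> C_circle b ->
    rho (fun z => a z * b z) = rho a \o rho b;
  rep_adjoint : forall a v w, C_circle a ->
    dot (rho (fun z => (a z)^*) v) w = dot v (rho a w);
  rep_injective : forall a b, C_circle a -> C_circle b ->
    rho a = rho b -> a = b;
  rep_nondegenerate : forall (v : H) (e : R[i]), 0 < e ->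
    exists k (a : 'I_k -> circle -> R[i]) (w : 'I_k -> H),
      (forall l, C_circle (a l)) /\ `|v - \sum_(l < k) rho (a l) (w l)| < e }.

(* The Fourier algebra of Z: coefficients of the left regular representation
   on l2(Z). *)
Definition fourier_algebra : set (int -> R[i]) := [set u |
  exists xi eta : int -> R[i], [/\ l2 xi, l2 eta &
    forall n, u n = zsum (fun k => xi (k - n) * (eta k)^*)]].

Definition conv_multiplier (f : circle -> R[i]) (u : int -> R[i]) :
    int -> (circle -> R[i]) -> (circle -> R[i]) :=
  fun n g => u n *: convolution f g.

End Circle.

(* Main.v *)
(** Rotating the coefficients amounts to conjugating by the shift, so rotations
are multipliers of norm 1. By Weyl equidistribution, convolution by a
trigonometric polynomial p is a limit of averages of rotations with weights
p(t theta), hence a multiplier of norm at most the L1 norm of p; and a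
coefficient of vectors x, y of l2 is a multiplier of norm at most |x| |y|.
Approximating f by trigonometric polynomials and truncating x and y exhibits
F_{T_f,u} as a limit of multipliers of finite rank, so it is completely compact.

Conversely, an invariant F commutes with rotations, so by Weyl again with
convolution by every character: each F(s) is diagonal in the characters. The
Fejer multipliers Phi_n, acting on both variables, are contractions converging
pointwise to the identity, and Phi_n F is a finite combination of maps
F_{T_chi,delta}. As S_F is completely compact, its values lie, uniformly in the
matrix size, near a finite dimensional space, on which id - S_{Phi_n} tends to 0
completely; hence Phi_n F tends to F. *)
Require Import Defs.
From mathcomp Require Import all_boot all_order all_algebra complex.
From mathcomp Require Import all_classical all_reals all_analysis.
From mathcomp Require Import measurable_realfun ring lra zify.

Set Implicit Arguments.
Unset Strict Implicit.
Unset Printing Implicit Defensive.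

Import Order.TTheory GRing.Theory Num.Theory numFieldNormedType.Exports.

Local Open Scope classical_set_scope.
Local Open Scope ring_scope.

(** * Real-valued norms: norm values in [R[i]] are nonnegative reals, carried here by their real
    parts *)

Section Norm.
Variables (R : realType) (V : normedModType R[i]).
Implicit Types v w : V.

(** The representation [rho] is arbitrary, so rotations need not be implemented on H. Boundedness of
    [pi_rep], and the passage from multiplier bounds to matrix norms over C(T), therefore rest on
    describing the norm of a matrix of functions as the supremum of its scalar norms over the
    circle; this is proved from square roots in the algebra and a partition of unity. Weyl means
    sample at the points t theta, while a class in L1 has no values there: multiplier bounds are
    obtained for trigonometric polynomials and reach L1 by density. Bounds are proved on finitely
    supported functions first, where every operator is a finite sum, and pass to l1 by truncation.
    [S_map] selects a value that is determined only up to an operator of norm 0. The arguments run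
    on the graph relation instead, and two selections are compared through the multiplier bound
    applied to the zero operator. The obstacle in the converse is uniformity in the matrix size on a
    finite dimensional span: the operators spanning it may be dependent, so their coefficients need
    not be controlled by the norm. *)

Definition nrm v : R := complex.Re `|v|.

Lemma nrmE v : `|v| = (nrm v)%:C%C.
Proof.
rewrite /nrm; have := normr_ge0 v.
by case: `|v| => a b; rewrite lecE /= => /andP[/eqP -> _].
Qed.

Lemma nrm_ge0 v : 0 <= nrm v.
Proof. by have := normr_ge0 v; rewrite nrmE lecE /= => /andP[]. Qed.

Lemma nrm0 : nrm 0 = 0.
Proof. by rewrite /nrm normr0. Qed.

Lemma nrm_eq0 v : nrm v = 0 -> v = 0.
Proof. by move=> v0; apply/normr0_eq0; rewrite nrmE v0. Qed.

Lemma nrmN v : nrm (- v) = nrm v.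
Proof. by rewrite /nrm normrN. Qed.

Lemma nrmB v w : nrm (v - w) = nrm (w - v).
Proof. by rewrite -nrmN opprB. Qed.

Lemma ler_nrmD v w : nrm (v + w) <= nrm v + nrm w.
Proof. by have := ler_normD v w; rewrite !nrmE -rmorphD lecR. Qed.

Lemma ler_nrmB v w : nrm (v - w) <= nrm v + nrm w.
Proof. by rewrite -[nrm w]nrmN ler_nrmD. Qed.

Lemma ler_nrm_sum (I : Type) (r : seq I) (P : pred I) (F : I -> V) :
  nrm (\sum_(i <- r | P i) F i) <= \sum_(i <- r | P i) nrm (F i).
Proof.
elim/big_ind2 : _ => [||//]; first by rewrite nrm0.
by move=> x1 x2 y1 y2 h1 h2; rewrite (le_trans (ler_nrmD _ _)) // lerD.
Qed.

(** After the triangle inequality the defect is t (nrm v - nrm w / t)^2. The free weight t either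
    absorbs a small w or, well chosen, gives back the exact triangle inequality for sums of
    squares. *)
Lemma nrm_sqrD (t : R) v w : 0 < t ->
  nrm (v + w) ^+ 2 <= (1 + t) * nrm v ^+ 2 + (1 + t^-1) * nrm w ^+ 2.
Proof.
move=> t0; have h := ler_nrmD v w.
have := nrm_ge0 v; have := nrm_ge0 w; have := nrm_ge0 (v + w).
move: (nrm v) (nrm w) (nrm (v + w)) h => a b c h c0 b0 a0.
apply: (@le_trans _ _ ((a + b) ^+ 2)); first by rewrite ler_sqr ?nnegrE ?addr_ge0.
have -> : (1 + t) * a ^+ 2 + (1 + t^-1) * b ^+ 2 =
    (a + b) ^+ 2 + t * (a - t^-1 * b) ^+ 2 by field; rewrite gt_eqF.
by rewrite lerDl mulr_ge0 ?sqr_ge0 // ltW.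
Qed.

End Norm.

(** * Complex scalars: modulus, conjugation, real and imaginary parts *)

Section ComplexNorm.
Variable R : realType.
Implicit Types c d : R[i].

Lemma nrmZ (V : normedModType R[i]) c (v : V) : nrm (c *: v) = nrm c * nrm v.
Proof. by apply/complexI; rewrite -nrmE normrZ !nrmE rmorphM. Qed.

Lemma nrmM c d : nrm (c * d) = nrm c * nrm d.
Proof. exact: nrmZ. Qed.

Lemma nrmC (x : R) : nrm (x%:C%C) = `|x|.
Proof. by rewrite /nrm normc_def /= expr0n addr0 sqrtr_sqr. Qed.

Lemma nrm_conj c : nrm c^* = nrm c.
Proof. by rewrite /nrm norm_conjC. Qed.

Lemma mul_conj c : c * c^* = (nrm c ^+ 2)%:C%C.
Proof. by rewrite -normCK nrmE rmorphXn. Qed.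

Lemma conj_real (x : R) : (x%:C%C)^* = x%:C%C.
Proof. by apply/eqP; rewrite eq_complex /= oppr0 !eqxx. Qed.

Lemma conjM c d : (c * d)^* = c^* * d^*.
Proof. exact: rmorphM. Qed.

Lemma conj_sum (I : Type) (r : seq I) (P : pred I) (F : I -> R[i]) :
  (\sum_(i <- r | P i) F i)^* = \sum_(i <- r | P i) (F i)^*.
Proof. exact: rmorph_sum. Qed.

Lemma nrm1 : nrm (1 : R[i]) = 1.
Proof. by rewrite /nrm normr1. Qed.

Lemma nrm_sqr c : nrm c ^+ 2 = complex.Re c ^+ 2 + complex.Im c ^+ 2.
Proof.
by rewrite /nrm; case: c => a b; rewrite normc_def /= sqr_sqrtr // addr_ge0 // sqr_ge0.
Qed.

Lemma Re_le_nrm c : `|complex.Re c| <= nrm c.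
Proof.
rewrite -(@ler_pXn2r _ 2) ?nnegrE ?nrm_ge0 //.
by rewrite nrm_sqr real_normK ?num_real // lerDl sqr_ge0.
Qed.

Lemma Im_le_nrm c : `|complex.Im c| <= nrm c.
Proof.
rewrite -(@ler_pXn2r _ 2) ?nnegrE ?nrm_ge0 //.
by rewrite nrm_sqr real_normK ?num_real // lerDr sqr_ge0.
Qed.

Lemma nrm_le_ReIm c : nrm c <= `|complex.Re c| + `|complex.Im c|.
Proof.
rewrite -(@ler_pXn2r _ 2) ?nnegrE ?nrm_ge0 ?addr_ge0 //.
rewrite nrm_sqr -!(@real_normK _ (complex.Re _)) ?num_real //.
rewrite -!(@real_normK _ (complex.Im _)) ?num_real //.
by rewrite sqrrD lerD2r lerDl mulrn_wge0 // mulr_ge0.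
Qed.

Lemma nrm_sqr_sum m (a : 'I_m -> R) :
  (\sum_(i < m) a i) ^+ 2 <= m%:R * \sum_(i < m) a i ^+ 2.
Proof.
have h (i j : 'I_m) : a i * a j <= (a i ^+ 2 + a j ^+ 2) / 2.
  by rewrite ler_pdivlMr // mulrC; have := sqr_ge0 (a i - a j); nra.
rewrite expr2 mulr_suml.
apply: (@le_trans _ _ (\sum_(i < m) \sum_(j < m) (a i ^+ 2 + a j ^+ 2) / 2)).
  by apply: ler_sum => i _; rewrite mulr_sumr; apply: ler_sum.
under eq_bigr do rewrite -mulr_suml big_split /= sumr_const card_ord.
rewrite -mulr_suml big_split /= sumr_const card_ord sumrMnl.
by rewrite -[X in X + _]mulr_natl; lra.
Qed.

End ComplexNorm.

(** * Sums over symmetric windows of integers *)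

Section Windows.

(* The symmetric partial sums whose limit is zsum. *)
Definition win (V : zmodType) (n : nat) (u : int -> V) : V :=
  \sum_(k < n.*2.+1) u (k%:Z - n%:Z).

Definition win_idx (n : nat) : seq int := [seq k%:Z - n%:Z | k <- iota 0 n.*2.+1].

Lemma winE (V : zmodType) n (u : int -> V) : win n u = \sum_(s <- win_idx n) u s.
Proof. by rewrite /win big_map -(big_mkord xpredT (fun k : nat => u (k%:Z - n%:Z))) /index_iota subn0. Qed.

Lemma win_idx_uniq n : uniq (win_idx n).
Proof. by rewrite map_inj_uniq ?iota_uniq // => a b /addIr []. Qed.

Lemma mem_win_idx n (s : int) : (s \in win_idx n) = (`|s| <= n)%N.
Proof.
apply/mapP/idP => [[k]|sn].
  by rewrite mem_iota => /andP[_ kn] ->; lia.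
by exists (absz (s + n%:Z)); [rewrite mem_iota; lia|lia].
Qed.

Lemma eq_win (V : zmodType) n (u v : int -> V) :
  (forall s, (`|s| <= n)%N -> u s = v s) -> win n u = win n v.
Proof.
by move=> uv; rewrite !winE; apply: eq_big_seq => s; rewrite mem_win_idx => /uv.
Qed.

Lemma win_single (V : zmodType) n (u : int -> V) (s : int) : (`|s| <= n)%N ->
  (forall r, r != s -> u r = 0) -> win n u = u s.
Proof.
move=> sn us; rewrite winE (bigD1_seq s) ?win_idx_uniq ?mem_win_idx //=.
by rewrite big1 ?addr0 // => r /us.
Qed.

Lemma win_split (V : zmodType) m n (u : int -> V) : (m <= n)%N ->
  win n u = win m u + win n (fun s => if (`|s| <= m)%N then 0 else u s).
Proof.
move=> mn; rewrite [win n u]winE (bigID (mem (win_idx m))) /=; congr (_ + _).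
  rewrite winE -big_filter; apply: perm_big; apply: uniq_perm.
  - by rewrite filter_uniq ?win_idx_uniq.
  - exact: win_idx_uniq.
  - move=> s; rewrite mem_filter /= !mem_win_idx andb_idr // => sN.
    exact: leq_trans sN mn.
rewrite winE big_mkcond /=; apply: eq_bigr => s _.
by rewrite /= mem_win_idx; case: (leqP _ m).
Qed.

Lemma winD (V : zmodType) n (u v : int -> V) :
  win n (fun s => u s + v s) = win n u + win n v.
Proof. exact: big_split. Qed.

Lemma win0 (V : zmodType) n : win n (fun=> 0 : V) = 0.
Proof. by rewrite /win big1. Qed.

Lemma winZ (K : pzRingType) (V : lmodType K) n (c : K) (u : int -> V) :
  win n (fun s => c *: u s) = c *: win n u.
Proof. by rewrite /win scaler_sumr. Qed.

Lemma winM (K : pzRingType) n (c : K) (u : int -> K) :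
  win n (fun s => c * u s) = c * win n u.
Proof. by rewrite /win mulr_sumr. Qed.

Lemma win_sum (V : zmodType) n (I : Type) (r : seq I) (P : pred I) (u : I -> int -> V) :
  win n (fun s => \sum_(i <- r | P i) u i s) = \sum_(i <- r | P i) win n (u i).
Proof. exact: exchange_big. Qed.

Lemma exchange_win (V : zmodType) n m (u : int -> int -> V) :
  win n (fun s => win m (u s)) = win m (fun t => win n (u^~ t)).
Proof. exact: exchange_big. Qed.

Variable R : realType.
Implicit Types u v : int -> R.

Lemma ler_win n u v : (forall s, (`|s| <= n)%N -> u s <= v s) -> win n u <= win n v.
Proof.
move=> uv; rewrite !winE !big_seq; apply: ler_sum => s.
by rewrite mem_win_idx => /uv.
Qed.

Lemma win_ge0 n u : (forall s, 0 <= u s) -> 0 <= win n u.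
Proof. by move=> u0; apply: sumr_ge0. Qed.

Lemma ler_win_sub (J : seq int) n u : uniq J -> (forall s, 0 <= u s) ->
  (forall s, s \in J -> (`|s| <= n)%N) -> \sum_(s <- J) u s <= win n u.
Proof.
move=> uJ u0 Jn; rewrite winE [leRHS](bigID (mem J)) /=.
rewrite -[leLHS]addr0 lerD ?sumr_ge0 //.
rewrite -[leRHS]big_filter le_eqVlt; apply/orP; left; apply/eqP; apply: perm_big.
apply: uniq_perm; rewrite ?filter_uniq ?win_idx_uniq // => s.
by rewrite mem_filter mem_win_idx; case: (boolP (s \in J)) => // /Jn ->.
Qed.

Lemma ler_win_widen m n u : (m <= n)%N -> (forall s, 0 <= u s) -> win m u <= win n u.
Proof.
move=> mn u0; rewrite [leLHS]winE; apply: ler_win_sub => // [|s].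
  exact: win_idx_uniq.
by rewrite mem_win_idx => /leq_trans; apply.
Qed.

(** Windows are not shift invariant, but the shifted window sits in the one enlarged by |t|. Bounds
    holding for all windows thus survive shifts without loss. *)
Lemma ler_win_shift n u (t : int) : (forall s, 0 <= u s) ->
  win n (fun s => u (s + t)) <= win (n + `|t|) u.
Proof.
move=> u0; rewrite winE -(big_map (fun s => s + t) xpredT u).
apply: ler_win_sub => // [|s].
  by rewrite map_inj_uniq ?win_idx_uniq // => a b /addIr.
by case/mapP => r; rewrite mem_win_idx => rn ->; lia.
Qed.

Lemma ler_nrm_win (V : normedModType R[i]) n (u : int -> V) :
  nrm (win n u) <= win n (fun s => nrm (u s)).
Proof. exact: ler_nrm_sum. Qed.

Lemma ler_win_point n u (s : int) : (`|s| <= n)%N -> (forall s, 0 <= u s) ->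
  u s <= win n u.
Proof.
move=> sn u0; have := @ler_win_sub [:: s] n u isT u0.
by rewrite big_seq1; apply => r; rewrite inE => /eqP ->.
Qed.

(** N is chosen with [win N u] within e of the supremum of all windows, so that no larger window can
    exceed it by more than e. *)
Lemma win_tail u (C : R) : (forall s, 0 <= u s) -> (forall n, win n u <= C) ->
  forall e : R, 0 < e -> exists N, forall n,
    win n (fun s => if (`|s| <= N)%N then 0 else u s) <= e.
Proof.
move=> u0 uC e e0.
pose S : set R := [set x | exists n, x = win n u].
have supS : has_sup S.
  by split; [exists (win 0 u), 0%N|exists C => _ [n ->]].
have [_ [N ->] hN] := sup_adherent e0 supS.
exists N => n.
have [nN|Nn] := leqP n N.
  rewrite (@eq_win _ _ _ (fun=> 0)) ?win0 ?ltW // => s sn.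
  by rewrite (leq_trans sn nN).
have split_u := win_split u (ltnW Nn).
have : win n u <= sup S by apply: ub_le_sup => //; [case: supS|exists n].
rewrite split_u; lra.
Qed.

End Windows.

(** * Convergence with real tolerances, completeness, and the sums [zsum] *)

Section Limits.
Variable R : realType.

(** Filter convergence in V has tolerances in [R[i]]; this form keeps them in R, where the
    arithmetic is done. *)
Definition tends (V : normedModType R[i]) (u : nat -> V) (l : V) :=
  forall e : R, 0 < e -> exists N, forall n, (N <= n)%N -> nrm (u n - l) < e.

Definition cauchy (V : normedModType R[i]) (u : nat -> V) :=
  forall e : R, 0 < e -> exists N, forall n, (N <= n)%N -> nrm (u n - u N) < e.

Section Normed.
Variable V : normedModType R[i].
Implicit Types (u v : nat -> V) (l m : V).

Lemma tends_cvg u l : tends u l -> u @ \oo --> l.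
Proof.
move=> ul; apply/cvgrPdist_lt => e e0.
have eR : e = (complex.Re e)%:C%C.
  by move: e0; case: e => a b; rewrite ltcE /= => /andP[/eqP -> _].
have e1 : 0 < complex.Re e by move: e0; rewrite eR ltcR.
have [N hN] := ul _ e1.
exists N => // n /= Nn; rewrite distrC nrmE eR ltcR; exact: hN.
Qed.

Lemma tends_lim u l : tends u l -> limn u = l.
Proof. by move=> /tends_cvg /cvg_lim; apply; exact: norm_hausdorff. Qed.

Lemma cvg_tends u l : u @ \oo --> l -> tends u l.
Proof.
move=> /cvgrPdist_lt ul e e0; have e1 : 0 < e%:C%C by rewrite ltcR.
have [N _ hN] := ul _ e1; exists N => n Nn.
by have := hN n Nn; rewrite /= distrC nrmE ltcR.
Qed.

Lemma tends_unique u l m : tends u l -> tends u m -> l = m.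
Proof. by move=> /tends_lim <- /tends_lim <-. Qed.

Lemma tends_cst l : tends (fun=> l) l.
Proof. by move=> e e0; exists 0%N => n _; rewrite subrr nrm0. Qed.

Lemma tendsD u v l m : tends u l -> tends v m -> tends (fun n => u n + v n) (l + m).
Proof.
move=> ul vm e e0; have e2 : 0 < e / 2 by rewrite divr_gt0.
have [N hN] := ul _ e2; have [M hM] := vm _ e2.
exists (maxn N M) => n; rewrite geq_max => /andP[/hN h1 /hM h2].
have -> : u n + v n - (l + m) = (u n - l) + (v n - m) by rewrite opprD addrACA.
by apply: le_lt_trans (ler_nrmD _ _) _; lra.
Qed.

Lemma tendsZ (c : R[i]) u l : tends u l -> tends (fun n => c *: u n) (c *: l).
Proof.
move=> ul e e0; have c1 : 0 < nrm c + 1 by have := nrm_ge0 c; lra.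
have e2 : 0 < e / (nrm c + 1) by rewrite divr_gt0.
have [N hN] := ul _ e2; exists N => n /hN.
rewrite ltr_pdivlMr // -scalerBr nrmZ => h.
apply: le_lt_trans h; rewrite mulrC ler_wpM2l ?nrm_ge0 //; lra.
Qed.

Lemma tends_sum (I : Type) (r : seq I) (u : I -> nat -> V) (l : I -> V) :
  (forall i, tends (u i) (l i)) ->
  tends (fun n => \sum_(i <- r) u i n) (\sum_(i <- r) l i).
Proof.
move=> ul; elim: r => [|i r IH].
  rewrite big_nil; under eq_fun do rewrite big_nil; exact: tends_cst.
by rewrite big_cons; under eq_fun do rewrite big_cons; exact: tendsD.
Qed.

Lemma tends_shift u l (N : nat) : tends (fun n => u (n + N)%N) l -> tends u l.
Proof.
move=> ul e /ul[M hM]; exists (M + N)%N => n Mn.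
have := hM (n - N)%N; rewrite subnK; last by lia.
by apply; lia.
Qed.

Lemma tends_nrm_le u l (C : R) : tends u l ->
  (exists N, forall n, (N <= n)%N -> nrm (u n) <= C) -> nrm l <= C.
Proof.
move=> ul [N hN]; apply/ler_addgt0Pr => e /ul[M hM].
have := hN (maxn N M) (leq_maxl _ _); have := hM (maxn N M) (leq_maxr _ _).
move: (u _) => x h1 h2.
have -> : l = x - (x - l) by rewrite opprB addrC subrK.
by apply: le_trans (ler_nrmB _ _) _; lra.
Qed.

Lemma win_cauchy (u : int -> V) (C : R) :
  (forall n, win n (fun s => nrm (u s)) <= C) -> cauchy (fun n => win n u).
Proof.
move=> uC e e0; have e2 : 0 < e / 2 by rewrite divr_gt0.
have [N hN] := win_tail (fun s => nrm_ge0 (u s)) uC e2.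
exists N => n Nn; rewrite (win_split _ Nn) [X in X - _]addrC addrK.
apply: le_lt_trans (ler_nrm_win _ _) _.
apply: le_lt_trans (_ : e / 2 < e); last by lra.
apply: le_trans (hN n); apply: ler_win => s _.
by case: ifP; rewrite ?nrm0.
Qed.

Lemma tends_sub u l (phi : nat -> nat) : (forall n, (n <= phi n)%N) ->
  tends u l -> tends (u \o phi) l.
Proof.
move=> phin ul e /ul[N hN]; exists N => n Nn; apply: hN.
exact: leq_trans Nn (phin n).
Qed.

End Normed.

Lemma cauchy_tends (V : completeNormedModType R[i]) (u : nat -> V) :
  cauchy u -> exists l, tends u l.
Proof.
move=> uc; suff : cvg (u @ \oo) by move=> /cvg_ex[l /= /cvg_tends ul]; exists l.
apply/cauchy_cvgP/cauchyP => e e0.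
have eR : e = (complex.Re e)%:C%C.
  by move: e0; case: e => a b; rewrite ltcE /= => /andP[/eqP -> _].
have e1 : 0 < complex.Re e by move: e0; rewrite eR ltcR.
have [N hN] := uc _ e1; exists (u N).
exists N => // n /= Nn; rewrite -ball_normE /= distrC nrmE eR ltcR; exact: hN.
Qed.

Lemma cauchy_real (u : nat -> R) :
  (forall e : R, 0 < e -> exists N, forall n, (N <= n)%N -> `|u n - u N| < e) ->
  exists l, forall e : R, 0 < e -> exists N, forall n, (N <= n)%N -> `|u n - l| < e.
Proof.
move=> uc; suff : cvg (u @ \oo).
  move=> /cvg_ex[l /= /cvgrPdist_lt ul]; exists l => e /ul[N _ hN].
  by exists N => n /hN /=; rewrite distrC.
apply/cauchy_cvgP/cauchyP => e /uc[N hN]; exists (u N).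
by exists N => // n /= Nn; rewrite -ball_normE /= distrC; exact: hN.
Qed.

Lemma cauchy_complex (u : nat -> R[i]) : cauchy u -> exists l, tends u l.
Proof.
move=> uc.
have [a ha] : exists l, forall e : R, 0 < e -> exists N, forall n, (N <= n)%N ->
    `|complex.Re (u n) - l| < e.
  apply: cauchy_real => e /uc[N hN]; exists N => n /hN; apply: le_lt_trans.
  by rewrite -raddfB; exact: Re_le_nrm.
have [b hb] : exists l, forall e : R, 0 < e -> exists N, forall n, (N <= n)%N ->
    `|complex.Im (u n) - l| < e.
  apply: cauchy_real => e /uc[N hN]; exists N => n /hN; apply: le_lt_trans.
  by rewrite -raddfB; exact: Im_le_nrm.
exists (a +i* b)%C => e e0; have e2 : 0 < e / 2 by rewrite divr_gt0.
have [N hN] := ha _ e2; have [M hM] := hb _ e2.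
exists (maxn N M) => n; rewrite geq_max => /andP[/hN h1 /hM h2].
apply: le_lt_trans (nrm_le_ReIm _) _; rewrite !raddfB /=; lra.
Qed.

Lemma tends_zsum (V : completeNormedModType R[i]) (u : int -> V) (C : R) :
  (forall n, win n (fun s => nrm (u s)) <= C) -> tends (fun n => win n u) (zsum u).
Proof.
by move=> /win_cauchy /cauchy_tends[l ul]; rewrite /zsum (tends_lim ul).
Qed.

Lemma tends_zsum_complex (u : int -> R[i]) (C : R) :
  (forall n, win n (fun s => nrm (u s)) <= C) -> tends (fun n => win n u) (zsum u).
Proof.
by move=> /win_cauchy /cauchy_complex[l ul]; rewrite /zsum (tends_lim ul).
Qed.

Lemma zsum_finite (V : normedModType R[i]) (u : int -> V) (T : nat) :
  (forall s, (T < `|s|)%N -> u s = 0) -> zsum u = win T u.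
Proof.
move=> uT; apply: tends_lim => e e0; exists T => n Tn.
rewrite -/(win n u) (win_split _ Tn) addrC addrA addNr add0r.
rewrite (@eq_win _ _ _ (fun=> 0)) ?win0 ?nrm0 // => s _.
by case: leqP => // /uT.
Qed.

End Limits.

(** * Extended suprema and infima turned into real inequalities *)

Section Suprema.
Variable R : realType.
Local Open Scope ereal_scope.

(** A sum of nonnegative terms is the supremum over finite sets, and every finite set of integers
    lies in a window. *)
Lemma esum_winP (g : int -> R) (C : R) : (forall s, (0 <= g s)%R) ->
  (\esum_(s in [set: int]) (g s)%:E <= C%:E) <-> (forall n, (win n g <= C)%R).
Proof.
move=> g0; split=> [h n|h].
  rewrite -lee_fin; apply: le_trans h; rewrite winE -sumEFin.
  rewrite fsbig_seq ?win_idx_uniq //; apply: ereal_sup_ubound.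
  by exists [set` win_idx n] => //=; split => //; exact: finite_seq.
apply: ge_ereal_sup => _ [A [finA _] <-].
have [s ->] := (finite_seqP A).1 finA.
have -> : [set` s] = [set` undup s].
  by apply/seteqP; split => x /=; rewrite mem_undup.
rewrite -fsbig_seq ?undup_uniq // sumEFin lee_fin.
pose n := \max_(x <- undup s) `|x|%N.
apply: le_trans (h n); apply: ler_win_sub => // [|x xs]; first exact: undup_uniq.
by rewrite /n (big_rem x xs) /= leq_max leqnn.
Qed.

Lemma ler_sqr_eps (L c K : R) : (0 <= c)%R -> (0 <= K)%R ->
  (forall e : R, (0 < e)%R -> (L <= (c + e) ^+ 2 * K)%R) -> (L <= c ^+ 2 * K)%R.
Proof.
move=> c0 K0 b; apply/ler_addgt0Pr => e e0.
have D0 : (0 < (2 * c + 1) * (K + 1))%R by rewrite mulr_gt0 // ltr_wpDl ?mulr_ge0.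
(* With d at most 1, (c + d)^2 exceeds c^2 by at most d (2 c + 1), and the second bound makes K
   times this at most e. *)
pose d := Num.min 1%R (e / ((2 * c + 1) * (K + 1)))%R.
have d0 : (0 < d)%R by rewrite lt_min ltr01 divr_gt0.
apply: le_trans (b d d0) _.
have d1 : (d <= 1)%R by rewrite ge_min lexx.
have : (d * ((2 * c + 1) * (K + 1)) <= e)%R.
  by rewrite -ler_pdivlMr // ge_min lexx orbT.
have : (0 <= d * (K * (1 - d)))%R by rewrite !mulr_ge0 ?subr_ge0 // ltW.
have : (0 <= d * (2 * c + 1))%R by rewrite mulr_ge0 ?ltW // ltr_wpDl ?mulr_ge0.
nra.
Qed.

(** The infimum is attained: every c + e is admissible, and for a fixed family xi the inequality is
    closed as e goes to 0. *)
Lemma opmx_normP (E : lmodType R[i]) (q : E -> \bar R) m (X : 'M[E -> E]_m) (c : R) :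
  (forall x, 0 <= q x) -> (0 <= c)%R ->
  (opmx_norm q X <= c%:E) <->
  (forall xi : 'I_m -> E, (\sum_(j < m) q (xi j) < +oo)%E ->
      (\sum_(i < m) q (\sum_(j < m) X i j (xi j))%R
         <= (c ^+ 2)%:E * \sum_(j < m) q (xi j))%E).
Proof.
move=> q0 c0; split=> [h xi xifin|h]; last first.
  by apply: ereal_inf_lbound; exists c.
have S0 : 0 <= \sum_(j < m) q (xi j) by exact: sume_ge0.
have [K KE] : exists K : R, \sum_(j < m) q (xi j) = K%:E.
  by exists (fine (\sum_(j < m) q (xi j))); rewrite fineK // ge0_fin_numE.
rewrite KE -EFinM; move: S0; rewrite KE lee_fin => K0.
have b (e : R) : (0 < e)%R -> \sum_(i < m) q (\sum_(j < m) X i j (xi j))%R <=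
    ((c + e) ^+ 2 * K)%:E.
  move=> e0; have : opmx_norm q X < (c + e)%:E.
    by apply: le_lt_trans h _; rewrite lte_fin ltrDl.
  move=> /ereal_inf_lt[_ [d [d0 hd] <-]]; rewrite lte_fin => dce.
  apply: le_trans (hd _ xifin) _; rewrite KE -EFinM lee_fin ler_wpM2r //.
  by rewrite ler_sqr ?nnegrE ?(le_trans d0) // ltW.
have FE : \sum_(i < m) q (\sum_(j < m) X i j (xi j))%R \is a fin_num.
  rewrite ge0_fin_numE ?sume_ge0 //.
  by apply: le_lt_trans (b 1%R ltr01) _; rewrite ltry.
rewrite -(fineK FE) lee_fin; apply: ler_sqr_eps => // e e0.
by rewrite -lee_fin fineK //; exact: b.
Qed.

End Suprema.

(** * Norm bounds for matrices of operators on l2(Z, H) *)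

Section OperatorBounds.
Variables (R : realType) (H : completeNormedModType R[i]).
Local Notation E := (int -> H).
Local Notation op := (@l2op R H).
Implicit Types (m : nat) (c d : R).

(** A bound on the square of the norm replaces its value, so square summability and the estimate are
    one hypothesis. *)
Definition l2bd m (xi : 'I_m -> E) (C : R) :=
  forall n, \sum_(j < m) win n (fun s => nrm (xi j s) ^+ 2) <= C.

Definition isl2 (xi : E) := exists C : R, forall n, win n (fun s => nrm (xi s) ^+ 2) <= C.

(* The operator norm of X on l2 is at most c. Square sums are replaced by their
   symmetric windows, so that all inequalities are between real numbers. *)
Definition opbd c m (X : 'M[op]_m) := 0 <= c /\
  forall xi C, l2bd xi C -> l2bd (fun i => \sum_(j < m) X i j (xi j)) (c ^+ 2 * C).

Definition opbd1 c (X : op) := opbd c (const_mx X : 'M[op]_1).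

Lemma l2bd_ge0 m (xi : 'I_m -> E) C : l2bd xi C -> 0 <= C.
Proof.
move=> /(_ 0%N); apply: le_trans; apply: sumr_ge0 => j _.
by apply: win_ge0 => s; rewrite sqr_ge0.
Qed.

Lemma l2bd_isl2 m (xi : 'I_m -> E) C j : l2bd xi C -> isl2 (xi j).
Proof.
move=> xiC; exists C => n; apply: le_trans (xiC n).
rewrite (bigD1 j) //= lerDl; apply: sumr_ge0 => k _.
by apply: win_ge0 => s; rewrite sqr_ge0.
Qed.

Lemma l2bd1 (xi : E) C :
  (forall n, win n (fun s => nrm (xi s) ^+ 2) <= C) -> l2bd ((fun=> xi) : 'I_1 -> E) C.
Proof. by move=> xiC n; rewrite big_ord1. Qed.

Lemma sum_l2_sqP m (xi : 'I_m -> E) C :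
  (\sum_(j < m) l2_sq (xi j) <= C%:E)%E <-> l2bd xi C.
Proof.
rewrite /l2_sq -esum_sum; last by move=> s j _ _; rewrite /norm_sq lee_fin sqr_ge0.
under eq_esum do rewrite /norm_sq sumEFin.
rewrite esum_winP; last by move=> s; apply: sumr_ge0 => j _; rewrite sqr_ge0.
by split=> h n; have := h n; rewrite win_sum.
Qed.

Lemma l2_sq_ge0 (xi : E) : (0 <= l2_sq xi)%E.
Proof. by apply: esum_ge0 => s _; rewrite /norm_sq lee_fin sqr_ge0. Qed.

Lemma l2P (xi : E) : l2 xi <-> isl2 xi.
Proof.
have hC C : (l2_sq xi <= C%:E)%E <-> forall n, win n (fun s => nrm (xi s) ^+ 2) <= C.
  have := sum_l2_sqP ((fun=> xi) : 'I_1 -> E) C; rewrite big_ord1 => ->.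
  by split=> h n; have := h n; rewrite big_ord1.
split=> [xifin|[C /hC xiC]]; last by apply: le_lt_trans xiC _; rewrite ltry.
exists (fine (l2_sq xi)); apply/hC; rewrite fineK // ge0_fin_numE //.
exact: l2_sq_ge0.
Qed.

Lemma l2op_normP m (X : 'M[op]_m) c : 0 <= c ->
  (l2op_norm X <= c%:E)%E <-> opbd c X.
Proof.
move=> c0; rewrite /l2op_norm opmx_normP //; last exact: l2_sq_ge0.
split=> [h|[_ h] xi xifin].
  split=> // xi C /sum_l2_sqP xiC; apply/sum_l2_sqP.
  apply: le_trans (h xi _) _; first by apply: le_lt_trans xiC _; rewrite ltry.
  by rewrite [leRHS]EFinM lee_wpmul2l // lee_fin sqr_ge0.
have S0 : (0 <= \sum_(j < m) l2_sq (xi j))%E.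
  by apply: sume_ge0 => j _; exact: l2_sq_ge0.
have F : (\sum_(j < m) l2_sq (xi j))%E \is a fin_num by rewrite ge0_fin_numE.
rewrite -(fineK F) -EFinM; apply/sum_l2_sqP/h/sum_l2_sqP; by rewrite fineK.
Qed.

Lemma opbd_ge0 m c (X : 'M[op]_m) : opbd c X -> 0 <= c.
Proof. by case. Qed.

Lemma opbd_le m c d (X : 'M[op]_m) : c <= d -> opbd c X -> opbd d X.
Proof.
move=> cd [c0 h]; split=> [|xi C xiC n]; first exact: le_trans cd.
apply: le_trans (h xi C xiC n) _; rewrite ler_wpM2r ?(l2bd_ge0 xiC) //.
by rewrite ler_sqr ?nnegrE // (le_trans c0).
Qed.

Lemma l2op_norm_ltP m (X : 'M[op]_m) (e : R) :
  (l2op_norm X < e%:E)%E <-> exists c, c < e /\ opbd c X.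
Proof.
split=> [/ereal_inf_lt[_ [c [c0 hc] <-]]|[c [ce cX]]].
  rewrite lte_fin => ce; exists c; split=> //; apply/l2op_normP => //.
  apply/opmx_normP => //; exact: l2_sq_ge0.
by apply: le_lt_trans (_ : (c%:E < _)%E); rewrite ?lte_fin // l2op_normP //; case: cX.
Qed.

(** Operators are functions on all families, and outside l2 their values, such as limits of
    divergent sums, mean nothing. Equality is therefore asked on l2 only. *)
Lemma opbd_eq m c (X Y : 'M[op]_m) :
  (forall i j xi, isl2 xi -> X i j xi = Y i j xi) -> opbd c X -> opbd c Y.
Proof.
move=> XY [c0 h]; split=> // xi C xiC n; apply: le_trans (h xi C xiC n).
rewrite le_eqVlt; apply/orP; left; apply/eqP; apply: eq_bigr => i _.
suff -> : \sum_(j < m) Y i j (xi j) = \sum_(j < m) X i j (xi j) by [].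
by apply: eq_bigr => j _; rewrite XY //; exact: l2bd_isl2 xiC.
Qed.

Lemma opbd_eps m c (X : 'M[op]_m) : 0 <= c ->
  (forall e, 0 < e -> opbd (c + e) X) -> opbd c X.
Proof.
move=> c0 h; split=> // xi C xiC n; apply: ler_sqr_eps => //; first exact: l2bd_ge0 xiC.
by move=> e /h[_]; apply.
Qed.

Lemma opbd0 m : opbd 0 (0 : 'M[op]_m).
Proof.
split=> // xi C xiC n; rewrite expr0n mul0r.
rewrite big1 // => i _; rewrite big1 => [|j _]; last by rewrite mxE.
by rewrite (@eq_win _ _ _ (fun=> 0)) ?win0 // => s _; rewrite nrm0 expr0n.
Qed.

Lemma opbdZ m (a : R[i]) c (X : 'M[op]_m) :
  opbd c X -> opbd (nrm a * c) (map_mx ( *:%R a) X).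
Proof.
move=> [c0 h]; split=> [|xi C xiC n]; first by rewrite mulr_ge0 ?nrm_ge0.
have -> : \sum_(i < m) win n
      (fun s => nrm ((\sum_(j < m) map_mx ( *:%R a) X i j (xi j)) s) ^+ 2) =
    nrm a ^+ 2 * \sum_(i < m) win n (fun s => nrm ((\sum_(j < m) X i j (xi j)) s) ^+ 2).
  rewrite mulr_sumr; apply: eq_bigr => i _; rewrite -winM; congr (win n _).
  apply/funext => s; rewrite -exprMn -nrmZ; congr (nrm _ ^+ 2).
  by rewrite !fct_sumE scaler_sumr; apply: eq_bigr => j _; rewrite mxE.
by rewrite exprMn -[leRHS]mulrA ler_wpM2l ?sqr_ge0 //; exact: h.
Qed.

(** The weight d/c in [nrm_sqrD] turns (1 + t) c^2 + (1 + 1/t) d^2 into (c + d)^2. Both bounds are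
    first enlarged by e/2 so that this weight is defined and positive. *)
Lemma opbdD m c d (X Y : 'M[op]_m) : opbd c X -> opbd d Y -> opbd (c + d) (X + Y).
Proof.
move=> cX dY; have c0 := opbd_ge0 cX; have d0 := opbd_ge0 dY.
apply: opbd_eps => [|e e0]; first exact: addr_ge0.
pose c' := c + e / 2; pose d' := d + e / 2.
have c'0 : 0 < c' by rewrite /c'; lra.
have d'0 : 0 < d' by rewrite /d'; lra.
have [_ hX] : opbd c' X by apply: opbd_le cX; rewrite /c'; lra.
have [_ hY] : opbd d' Y by apply: opbd_le dY; rewrite /d'; lra.
have -> : c + d + e = c' + d' by rewrite /c' /d'; field.
split=> [|xi C xiC n]; first by rewrite addr_ge0 // ltW.
have t0 : 0 < d' / c' by rewrite divr_gt0.
apply: le_trans (_ : (1 + d' / c') * (c' ^+ 2 * C) +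
    (1 + (d' / c')^-1) * (d' ^+ 2 * C) <= _); last first.
  rewrite le_eqVlt; apply/orP; left; apply/eqP; field.
  by rewrite !gt_eqF.
apply: le_trans (lerD (ler_wpM2l _ (hX xi C xiC n)) (ler_wpM2l _ (hY xi C xiC n)));
  rewrite ?addr_ge0 ?invr_ge0 ?(ltW t0) //.
rewrite !mulr_sumr -big_split; apply: ler_sum => i _ /=.
rewrite -!winM -winD; apply: ler_win => s _.
rewrite (_ : (\sum_(j < m) (X + Y) i j (xi j)) s =
  (\sum_(j < m) X i j (xi j)) s + (\sum_(j < m) Y i j (xi j)) s); first exact: nrm_sqrD.
by rewrite !fct_sumE -big_split; apply: eq_bigr => j _; rewrite mxE.
Qed.

Lemma opbdN m c (X : 'M[op]_m) : opbd c X -> opbd c (- X).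
Proof.
move=> /(opbdZ (-1)); rewrite nrmN nrm1 mul1r.
by apply: opbd_eq => i j xi _; rewrite !mxE scaleN1r.
Qed.

Lemma opbdB m c d (X Y : 'M[op]_m) : opbd c X -> opbd d Y -> opbd (c + d) (X - Y).
Proof. by move=> cX /opbdN; exact: opbdD. Qed.

Lemma opbd_sum m (I : Type) (r : seq I) (c : I -> R) (X : I -> 'M[op]_m) :
  (forall i, opbd (c i) (X i)) -> opbd (\sum_(i <- r) c i) (\sum_(i <- r) X i).
Proof.
move=> cX; elim: r => [|i r IH]; first by rewrite !big_nil; exact: opbd0.
by rewrite !big_cons; apply: opbdD.
Qed.

(** Any factor depending on m alone would serve: the lemma is applied where the entries are made
    small after m is fixed. *)
Lemma opbd_entries m c (X : 'M[op]_m) : 0 <= c ->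
  (forall i j, opbd1 c (X i j)) -> opbd (m%:R ^+ 2 * c) X.
Proof.
move=> c0 h; split=> [|xi C xiC n]; first by rewrite mulr_ge0 ?sqr_ge0.
have C0 := l2bd_ge0 xiC.
apply: (@le_trans _ _ (\sum_(i < m) \sum_(j < m) m%:R * (c ^+ 2 * C))); last first.
  rewrite !sumr_const !card_ord -[X in X *+ m]mulr_natl -[leLHS]mulr_natl.
  have K0 : 0 <= c ^+ 2 * C by rewrite mulr_ge0 ?sqr_ge0.
  have -> : (m%:R ^+ 2 * c) ^+ 2 * C = m%:R ^+ 3 * (c ^+ 2 * C) * m%:R by ring.
  have -> : m%:R * (m%:R * (m%:R * (c ^+ 2 * C))) = m%:R ^+ 3 * (c ^+ 2 * C) by ring.
  have [->|m1] := posnP m; first by rewrite expr0n !mul0r.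
  by rewrite ler_peMr ?mulr_ge0 ?exprn_ge0 // ler1n.
apply: ler_sum => i _; rewrite -mulr_sumr.
apply: le_trans (_ : win n (fun s => m%:R * \sum_(j < m) nrm (X i j (xi j) s) ^+ 2) <= _).
  apply: ler_win => s _; rewrite fct_sumE; apply: le_trans (nrm_sqr_sum _).
  by rewrite ler_sqr ?nnegrE ?nrm_ge0 ?sumr_ge0 ?ler_nrm_sum // => k _; exact: nrm_ge0.
rewrite winM ler_wpM2l // win_sum; apply: ler_sum => j _.
have [_ /(_ (fun=> xi j) C)] := h i j.
have hj : l2bd ((fun=> xi j) : 'I_1 -> E) C.
  apply: l2bd1 => k; apply: le_trans (xiC k).
  rewrite (bigD1 j) //= lerDl; apply: sumr_ge0 => l _.
  by apply: win_ge0 => s; rewrite sqr_ge0.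
by move=> /(_ hj n); rewrite !big_ord1 mxE.
Qed.

Lemma cvg_nrm (V : normedModType R[i]) (u : nat -> V) (l : V) : tends u l ->
  (fun n => nrm (u n)) @ \oo --> nrm l.
Proof.
move=> ul; apply/cvgrPdist_lt => e /ul[N hN]; exists N => // n /= /hN.
apply: le_lt_trans; have h1 := ler_nrmD (u n - l) l; have h2 := ler_nrmD (l - u n) (u n).
by move: h1 h2; rewrite !subrK [nrm (l - _)]nrmB => h1 h2; rewrite ler_norml; lra.
Qed.

Lemma cvg_big_sum (I : Type) (r : seq I) (u : I -> nat -> R) (l : I -> R) :
  (forall i, u i @ \oo --> l i) ->
  (fun n => \sum_(i <- r) u i n) @ \oo --> \sum_(i <- r) l i.
Proof.
move=> ul; elim: r => [|i r IH].
  by rewrite big_nil; under eq_fun do rewrite big_nil; exact: cvg_cst.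
by rewrite big_cons; under eq_fun do rewrite big_cons; exact: cvgD.
Qed.

(** Lower semicontinuity of the norm. A window of the image involves finitely many coordinates, so
    convergence of each coordinate carries its bound to the limit. *)
Lemma opbd_lim m c (Xn : nat -> 'M[op]_m) (X : 'M[op]_m) : 0 <= c ->
  (forall i j xi, isl2 xi -> forall s, tends (fun n => Xn n i j xi s) (X i j xi s)) ->
  (forall e, 0 < e -> exists N, forall n, (N <= n)%N -> opbd (c + e) (Xn n)) ->
  opbd c X.
Proof.
move=> c0 XnX h; split=> // xi C xiC n.
apply: ler_sqr_eps => //; first exact: l2bd_ge0 xiC.
move=> e /h[N hN].
pose f k := \sum_(i < m) win n (fun s => nrm ((\sum_(j < m) Xn k i j (xi j)) s) ^+ 2).
apply: (cvgr_to_le (F := \oo) (f := f)); last first.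
  by exists N => // k /= /hN[_ hk]; exact: hk.
apply: cvg_big_sum => i; apply: cvg_big_sum => k.
have t : tends (fun l => (\sum_(j < m) Xn l i j (xi j)) (k%:Z - n%:Z))
    ((\sum_(j < m) X i j (xi j)) (k%:Z - n%:Z)).
  rewrite fct_sumE; under eq_fun do rewrite fct_sumE.
  by apply: tends_sum => j; apply: XnX; exact: l2bd_isl2 xiC.
by under eq_fun do rewrite expr2; rewrite expr2; apply: cvgM; exact: cvg_nrm.
Qed.

End OperatorBounds.

(** * The circle group and its chordal distance *)

Section Circle.
Variable R : realType.
Local Notation T := (circle R).
Local Notation C := R[i].
Implicit Types (z w : T) (g h : T -> C).

Definition cval z : C := set_val z.

Definition cdist z w : R := nrm (cval z - cval w).

Lemma cval_inj z w : cval z = cval w -> z = w.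
Proof. by rewrite /cval set_valE; exact: val_inj. Qed.

Lemma nrm_cval z : nrm (cval z) = 1.
Proof. by have /= := set_valP z; rewrite nrmE => /complexI. Qed.

Lemma cval_neq0 z : cval z != 0.
Proof. by apply/eqP => z0; have := nrm_cval z; rewrite z0 nrm0; lra. Qed.

Lemma cval_mul z w : cval (circle_mul z w) = cval z * cval w.
Proof. by []. Qed.

Lemma cval_exp (t : R) : cval (circle_exp t) = (cos (2 * pi * t) +i* sin (2 * pi * t))%C.
Proof. by []. Qed.

Lemma circle_expD (s t : R) : circle_exp (s + t) = circle_mul (circle_exp s) (circle_exp t).
Proof.
apply: cval_inj; rewrite cval_mul !cval_exp mulrDr cosD sinD; congr (_ +i* _)%C.
by rewrite addrC [cos _ * sin _]mulrC mulrC.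
Qed.

Lemma circle_mulC z w : circle_mul z w = circle_mul w z.
Proof. by apply: cval_inj; rewrite !cval_mul mulrC. Qed.

Lemma circle_mulA z w x : circle_mul z (circle_mul w x) = circle_mul (circle_mul z w) x.
Proof. by apply: cval_inj; rewrite !cval_mul mulrA. Qed.

Lemma circle_exp0 z : circle_mul (circle_exp 0) z = z.
Proof. by apply: cval_inj; rewrite cval_mul cval_exp mulr0 cos0 sin0 mul1r. Qed.

Lemma circle_exp1 : circle_exp 1 = circle_exp 0 :> T.
Proof.
apply: cval_inj; rewrite !cval_exp mulr1 mulr0 cos0 sin0.
by rewrite [2 * _]mulrC mulr_natr cos2pi sin2pi.
Qed.

Lemma circle_expN (t : R) : cval (circle_exp (- t)) = (cval (circle_exp t))^*.
Proof. by rewrite !cval_exp mulrN cosN sinN. Qed.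

Lemma circle_exp_surj z : exists2 t : R, 0 <= t <= 1 & z = circle_exp t.
Proof.
have := nrm_cval z; case E : (cval z) => [x y] h.
have xy : x ^+ 2 + y ^+ 2 = 1 by have := nrm_sqr (x +i* y)%C; rewrite h /= expr1n.
have x1 : -1 <= x <= 1 by apply/andP; split; nra.
have p0 : 0 < 2 * pi :> R by rewrite mulr_gt0 // pi_gt0.
have cK : cos (acos x) = x by rewrite acosK // in_itv.
have := acos_ge0 x1; have := acos_lepi x1 => a1 a0.
have sa : sin (acos x) = `|y|.
  by rewrite sin_acos // (_ : 1 - x ^+ 2 = y ^+ 2) ?sqrtr_sqr //; lra.
have pp : 0 < pi :> R := pi_gt0 R.
have [y0|y0] := leP 0 y.
  exists (acos x / (2 * pi)); last first.
    by apply: cval_inj; rewrite E cval_exp mulrC divfK ?gt_eqF // cK sa ger0_norm.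
  by rewrite divr_ge0 ?(ltW p0) //= ler_pdivrMr // mul1r; lra.
(* On the lower half circle the angle given by [acos] is reflected, since the cosine does not see
   the sign of y. *)
exists (1 - acos x / (2 * pi)); last first.
  apply: cval_inj; rewrite E cval_exp mulrBr mulr1 [2 * pi * (_ / _)]mulrC divfK ?gt_eqF //.
  rewrite [2 * pi]mulrC mulr_natr addrC cosD2pi sinD2pi cosN sinN cK sa.
  by rewrite ltr0_norm // opprK.
have : 0 <= acos x / (2 * pi) <= 1.
  by rewrite divr_ge0 ?(ltW p0) //= ler_pdivrMr // mul1r; lra.
by move=> /andP[? ?]; apply/andP; split; lra.
Qed.

Lemma cdist_exp (s t : R) :
  cdist (circle_exp s) (circle_exp t) ^+ 2 = 2 - 2 * cos (2 * pi * (s - t)).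
Proof.
rewrite /cdist !cval_exp nrm_sqr /= mulrBr cosB.
have := cos2Dsin2 (2 * pi * s); have := cos2Dsin2 (2 * pi * t); nra.
Qed.

Lemma cdistC z w : cdist z w = cdist w z.
Proof. exact: nrmB. Qed.

Lemma cdist_trans z w x : cdist z x <= cdist z w + cdist w x.
Proof. by apply: le_trans (ler_nrmD _ _); rewrite addrA subrK. Qed.

Lemma cdist_mul z w x : cdist (circle_mul x z) (circle_mul x w) = cdist z w.
Proof. by rewrite /cdist !cval_mul -mulrBr nrmM nrm_cval mul1r. Qed.

Lemma cdist_cos z w : cdist z w ^+ 2 = 2 - 2 * complex.Re (cval z * (cval w)^*).
Proof.
have := nrm_cval z; have := nrm_cval w; rewrite /cdist.
case: (cval z) (cval w) => a b [c d] h1 h2.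
have := nrm_sqr (c +i* d)%C; have := nrm_sqr (a +i* b)%C.
rewrite h1 h2 expr1n nrm_sqr /= => e1 e2; nra.
Qed.

Lemma C_circleP g : C_circle g <-> forall z (e : R), 0 < e -> exists2 d : R, 0 < d &
  forall w, cdist w z < d -> nrm (g w - g z) < e.
Proof.
split=> [gC z e e0|h z].
  have e1 : 0 < e%:C%C by rewrite ltcR.
  have : nbhs z [set t | `|g z - g t| < e%:C%C].
    by have := gC z; move/cvgrPdist_lt; apply.
  rewrite nbhsE /= => -[_ [[U oU <-] Uz] sub].
  have : nbhs (set_val z) U by exact: open_nbhs_nbhs.
  move=> /nbhs_ballP[d d0 hd].
  have dR : d = (complex.Re d)%:C%C.
    by move: d0; case: (d) => a b; rewrite /= ltcE /= => /andP[/eqP -> _].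
  exists (complex.Re d); first by move: d0; rewrite dR /= ltcR.
  move=> w wz; have /sub : (set_val @^-1` U) w.
    by apply: hd; rewrite -ball_normE /= distrC nrmE dR ltcR.
  by rewrite /= distrC nrmE ltcR.
apply: ((@cvgrPdist_lt _ _ _ _ (nbhs_filter z) g (g z)).2) => e e0.
have eR : e = (complex.Re e)%:C%C.
  by move: e0; case: e => a b; rewrite ltcE /= => /andP[/eqP -> _].
have e1 : 0 < complex.Re e by move: e0; rewrite eR ltcR.
have [d d0 hd] := h z _ e1.
have d1 : 0 < d%:C%C by rewrite ltcR.
have : nbhs z [set t | `|(set_val z : C) - set_val t| < d%:C%C].
  by have := @initial_continuous _ _ (set_val : T -> C) z; move/cvgrPdist_lt; apply.
apply: (@filterS _ _ (nbhs_filter z)) => w wz.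
rewrite /= distrC nrmE eR ltcR; apply: hd.
by move: wz; rewrite /= distrC nrmE ltcR.
Qed.

End Circle.

(** * Continuous functions on the circle and compactness *)

Section ContinuousFunctions.
Variable R : realType.
Local Notation T := (circle R).
Local Notation C := R[i].
Implicit Types (z w : T) (g h : T -> C).

Lemma C_circle_cst (c : C) : C_circle (fun _ : T => c).
Proof. by apply/C_circleP => z e e0; exists 1 => // w _; rewrite subrr nrm0. Qed.

Lemma C_circle_cval : C_circle (@cval R).
Proof. by apply/C_circleP => z e e0; exists e. Qed.

Lemma C_circleD g h : C_circle g -> C_circle h -> C_circle (fun z => g z + h z).
Proof.
move=> /C_circleP gC /C_circleP hC; apply/C_circleP => z e e0.
have e2 : 0 < e / 2 by rewrite divr_gt0.
have [d d0 hd] := gC z _ e2; have [d' d'0 hd'] := hC z _ e2.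
exists (Num.min d d') => [|w]; first by rewrite lt_min d0.
rewrite lt_min => /andP[/hd h1 /hd' h2].
rewrite opprD addrACA; apply: le_lt_trans (ler_nrmD _ _) _; lra.
Qed.

Lemma C_circleM g h : C_circle g -> C_circle h -> C_circle (fun z => g z * h z).
Proof.
move=> /C_circleP gC /C_circleP hC; apply/C_circleP => z e e0.
pose K := 1 + nrm (g z) + nrm (h z).
have K1 : 1 <= K by rewrite /K; have := nrm_ge0 (g z); have := nrm_ge0 (h z); lra.
have K0 : 0 < K by lra.
pose e' := Num.min 1 (e / K / 2).
have e'0 : 0 < e' by rewrite lt_min ltr01 !divr_gt0.
have [d d0 hd] := gC z _ e'0; have [d' d'0 hd'] := hC z _ e'0.
exists (Num.min d d') => [|w]; first by rewrite lt_min d0.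
rewrite lt_min => /andP[/hd h1 /hd' h2].
have -> : g w * h w - g z * h z =
    (g w - g z) * (h w - h z) + ((g w - g z) * h z + g z * (h w - h z)) by ring.
apply: le_lt_trans (ler_nrmD _ _) _.
apply: le_lt_trans (lerD (lexx _) (ler_nrmD _ _)) _; rewrite !nrmM.
have e'1 : e' <= 1 by rewrite ge_min lexx.
have : e' <= e / K / 2 by rewrite ge_min lexx orbT.
rewrite ler_pdivlMr // ler_pdivlMr // => eK.
have := nrm_ge0 (g w - g z); have := nrm_ge0 (h w - h z).
move: eK; rewrite /K; have := nrm_ge0 (g z); have := nrm_ge0 (h z); nra.
Qed.

Lemma C_circle_conj g : C_circle g -> C_circle (fun z => (g z)^*).
Proof.
move=> /C_circleP gC; apply/C_circleP => z e /(gC z)[d d0 hd].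
by exists d => // w /hd; rewrite -rmorphB nrm_conj.
Qed.

Lemma C_circleZ (c : C) g : C_circle g -> C_circle (c *: g).
Proof. by move=> gC; exact (C_circleM (@C_circle_cst c) gC). Qed.

Lemma C_circle_add g h : C_circle g -> C_circle h -> C_circle (g + h).
Proof. by move=> gC hC; exact (C_circleD gC hC). Qed.

Lemma C_circle_comb (c : C) g h : C_circle g -> C_circle h -> C_circle (c *: g + h).
Proof. by move=> gC hC; exact (C_circle_add (C_circleZ gC) hC). Qed.

Lemma C_circle_sub g h : C_circle g -> C_circle h -> C_circle (g - h).
Proof.
move=> gC hC; rewrite -scaleN1r; exact (C_circle_add gC (C_circleZ hC)).
Qed.

Lemma C_circle0 : C_circle (0 : T -> C).
Proof. exact (@C_circle_cst 0). Qed.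

Lemma C_circle_sum (I : Type) (r : seq I) (F : I -> T -> C) :
  (forall i, C_circle (F i)) -> C_circle (\sum_(i <- r) F i).
Proof.
move=> FC; elim: r => [|i r IH]; first by rewrite big_nil; exact C_circle0.
by rewrite big_cons; exact (C_circle_add (FC i) IH).
Qed.

Lemma C_circle_rot w g : C_circle g -> C_circle (fun z => g (circle_mul w z)).
Proof.
move=> /C_circleP gC; apply/C_circleP => z e /(gC (circle_mul w z))[d d0 hd].
by exists d => // x xz; apply: hd; rewrite cdist_mul.
Qed.

Lemma C_circle_rotation (theta : R) n g : C_circle g -> C_circle (rotation theta n g).
Proof. by move=> gC; exact (C_circle_rot gC). Qed.

(** From |sqrt x - sqrt y|^2 <= |x - y|, valid also near zeros. Square roots are what turns
    pointwise inequalities into operator inequalities under [rho]. *)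
Lemma C_circle_sqrt (r : T -> R) : (forall z, 0 <= r z) ->
  C_circle (fun z => (r z)%:C%C) -> C_circle (fun z => (Num.sqrt (r z))%:C%C).
Proof.
move=> r0 /C_circleP rC; apply/C_circleP => z e e0.
have e2 : 0 < e ^+ 2 by rewrite exprn_gt0.
have [d d0 hd] := rC z _ e2; exists d => // w /hd.
rewrite -!rmorphB !nrmC /= => h.
rewrite -(@ltr_pXn2r _ 2) ?nnegrE ?(ltW e0) //; apply: le_lt_trans h.
rewrite -{2}[r w]sqr_sqrtr // -{2}[r z]sqr_sqrtr //.
move: (sqrtr_ge0 (r w)) (sqrtr_ge0 (r z)).
move: (Num.sqrt (r w)) (Num.sqrt (r z)) => a b a0 b0.
rewrite real_normK ?num_real // subr_sqr normrM -[(a - b) ^+ 2]ger0_norm ?sqr_ge0 //.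
by rewrite normrX expr2 ler_wpM2l // [leRHS]ger0_norm ?addr_ge0 // ler_norml; lra.
Qed.

Lemma circle_exp_near (t d : R) : 0 < d ->
  nbhs t [set s : R | cdist (circle_exp s) (circle_exp t) < d].
Proof.
move=> d0.
have d20 : 0 < d / 2 by rewrite divr_gt0.
have cc (f : R -> R) : continuous f -> nbhs t [set s : R | `|f (2 * pi * t) - f (2 * pi * s)| < d / 2].
  move=> fc; have : {for t, continuous (fun s : R => f (2 * pi * s))}.
    apply: continuous_comp; last exact: fc.
    by apply: cvgM; [exact: cvg_cst|exact: cvg_id].
  by move=> /cvgrPdist_lt; apply.
apply: filterS2 (cc _ (@continuous_cos R)) (cc _ (@continuous_sin R)) => s h1 h2.
rewrite /= cdistC /cdist !cval_exp; apply: le_lt_trans (nrm_le_ReIm _) _ => /=.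
rewrite /= in h1 h2; lra.
Qed.

(** Compactness of [0, 1] as a covering property, transported by [circle_exp]: a property that holds
    locally for large n holds everywhere for some n. *)
Lemma circle_uniform (P : nat -> T -> Prop) :
  (forall z, exists (d : R) (N : nat), 0 < d /\
     forall w n, cdist w z < d -> (N <= n)%N -> P n w) ->
  exists N, forall w, P N w.
Proof.
move=> h.
have /compact_near_coveringP cpt := @segment_compact R 0 1.
have : \forall n \near \oo, `[0, 1]%classic `<=` (fun t : R => P n (circle_exp t)).
  apply: cpt => t _; have [d [N [d0 hN]]] := h (circle_exp t).
  exists ([set s : R | cdist (circle_exp s) (circle_exp t) < d], [set n | (N <= n)%N]).
    by split; [exact: circle_exp_near|exists N].
  by move=> [s n] [/= h1 h2]; exact: hN.
move=> [N _ hN]; exists N => w; have [t t01 ->] := circle_exp_surj w.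
by apply: (hN N) => //=; rewrite in_itv.
Qed.

Lemma C_circle_bounded g : C_circle g -> exists B : R, 0 <= B /\ forall z, nrm (g z) <= B.
Proof.
move=> /C_circleP gC.
have [N hN] : exists N : nat, forall w, nrm (g w) <= N%:R.
  apply: circle_uniform => z; have [d d0 hd] := gC z 1 ltr01.
  exists d, (Num.trunc (nrm (g z) + 1)).+1; split=> // w n /hd h1 Nn.
  have : nrm (g z) + 1 < n%:R.
    apply: lt_le_trans (_ : (Num.trunc (nrm (g z) + 1)).+1%:R <= _).
      by have /andP[] := trunc_itv (addr_ge0 (nrm_ge0 (g z)) ler01).
    by rewrite ler_nat.
  have := ler_nrmD (g w - g z) (g z); rewrite subrK; lra.
by exists N%:R.
Qed.

(** Uniform continuity in quadratic form. A bound e + K dist^2 can be averaged against a kernel of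
    small second moment, without splitting into near and far points. *)
Lemma C_circle_modulus g : C_circle g -> forall e : R, 0 < e ->
  exists K : R, 0 <= K /\ forall z w, nrm (g z - g w) <= e + K * cdist z w ^+ 2.
Proof.
move=> gC e e0; have [B [B0 hB]] := C_circle_bounded gC.
have [N hN] : exists N : nat, forall z, forall w,
    cdist w z < N.+1%:R^-1 -> nrm (g z - g w) <= e.
  apply: (circle_uniform (P := fun n z => forall w,
    cdist w z < n.+1%:R^-1 -> nrm (g z - g w) <= e)) => z.
  have e2 : 0 < e / 2 by rewrite divr_gt0.
  have [d d0 hd] := (C_circleP g).1 gC z _ e2.
  exists (d / 2), (Num.trunc (2 / d)); split; first by rewrite divr_gt0.
  move=> w n wz Nn x xw.
  have nd : n.+1%:R^-1 <= d / 2.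
    rewrite -[d / 2]invf_div lef_pV2 ?posrE ?divr_gt0 ?ltr0n //.
    apply: ltW; apply: lt_le_trans (_ : (Num.trunc (2 / d)).+1%:R <= _).
      by have /andP[] := trunc_itv (ltW (divr_gt0 (ltr0Sn R 1) d0)).
    by rewrite ler_nat.
  have h1 : nrm (g w - g z) < e / 2 by apply: hd; lra.
  have h2 : nrm (g x - g z) < e / 2.
    by apply: hd; have := cdist_trans x w z; have := lt_le_trans xw nd; rewrite (cdistC x w); lra.
  have -> : g w - g x = (g w - g z) - (g x - g z) by ring.
  by apply: le_trans (ler_nrmB _ _) _; lra.
(* At distance at least 1/(N+1), the trivial bound 2 B is below 2 B (N+1)^2 dist^2. *)
have K0 : 0 <= 2 * B * N.+1%:R ^+ 2 by rewrite mulr_ge0 ?sqr_ge0 // mulr_ge0.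
exists (2 * B * N.+1%:R ^+ 2); split=> //.
move=> z w; have [h|h] := ltP (cdist w z) N.+1%:R^-1.
  by apply: le_trans (hN z w h) _; rewrite lerDl mulr_ge0 ?sqr_ge0.
apply: le_trans (_ : 2 * B <= _).
  by apply: le_trans (ler_nrmB _ _) _; have := hB z; have := hB w; lra.
have : 1 <= N.+1%:R * cdist z w by rewrite cdistC -ler_pdivrMl ?mulr1 ?ltr0n.
move=> h1; have h2 : 1 <= (N.+1%:R * cdist z w) ^+ 2 by rewrite exprn_ege1.
rewrite -mulrA -exprMn; have : 0 <= 2 * B by lra.
nra.
Qed.

End ContinuousFunctions.

(** * Characters, roots of unity and Fejer weights *)

Section Characters.
Variable R : realType.
Local Notation T := (circle R).
Local Notation C := R[i].
Implicit Types (z w : T) (g h : T -> C) (j k : int).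

Definition chi k z : C := cval z ^ k.

Lemma nrm_chi k z : nrm (chi k z) = 1.
Proof.
have h (n : nat) : nrm (cval z ^+ n) = 1.
  elim: n => [|n IH]; first by rewrite expr0 nrm1.
  by rewrite exprS nrmM nrm_cval IH mulr1.
rewrite /chi; case: k => n; first exact: h.
rewrite NegzE -exprnN /=; have := nrmM (cval z ^+ n.+1) (cval z ^- n.+1).
by rewrite mulfV ?expf_neq0 ?cval_neq0 // nrm1 h mul1r => <-.
Qed.

Lemma chi0 z : chi 0 z = 1.
Proof. by []. Qed.

Lemma chiD j k z : chi (j + k) z = chi j z * chi k z.
Proof. by rewrite /chi expfzDr ?cval_neq0. Qed.

Lemma chi_mul k z w : chi k (circle_mul z w) = chi k z * chi k w.
Proof. by rewrite /chi cval_mul expfzMl. Qed.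

Lemma chiN k z : chi (- k) z = (chi k z)^*.
Proof.
apply: (mulfI (_ : chi k z != 0)); first by rewrite expfz_neq0 ?cval_neq0.
by rewrite mul_conj nrm_chi expr1n -chiD subrr.
Qed.

Lemma C_circle_chi k : C_circle (chi k).
Proof.
have h (n : nat) : C_circle (chi n%:Z).
  elim: n => [|n IH]; first exact (@C_circle_cst R 1).
  have -> : chi n.+1%:Z = fun z => cval z * chi n%:Z z.
    by apply/funext => z; rewrite /chi -exprnP exprS.
  exact (C_circleM (@C_circle_cval R) IH).
case: k => n; first exact: h.
have -> : chi (Negz n) = fun z => (chi n.+1%:Z z)^*.
  by apply/funext => z; rewrite NegzE chiN.
exact (C_circle_conj (h n.+1)).
Qed.

Lemma chi_exp_real (k : int) (t : R) : chi k (circle_exp t) = cval (circle_exp (k%:~R * t)).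
Proof.
have h (n : nat) : chi n%:Z (circle_exp t) = cval (circle_exp (n%:R * t)).
  elim: n => [|n IH]; first by rewrite mul0r chi0 cval_exp mulr0 cos0 sin0.
  rewrite -natr1 mulrDl mul1r circle_expD cval_mul -IH -addn1 PoszD chiD.
  by rewrite /chi expr1z.
case: k => n; first exact: h.
by rewrite NegzE chiN h mulrNz mulNr circle_expN.
Qed.

Lemma cos_lt1 (d : R) : 0 < d <= 1 / 2 -> cos (2 * pi * d) < 1.
Proof.
move=> /andP[d0 d1]; have p0 := pi_gt0 R.
rewrite -[ltRHS](@cos0 R) ltr_cos ?in_itv /= ?lexx ?pi_ge0 //.
  by rewrite !mulr_gt0.
by apply/andP; split; nra.
Qed.

(** The cosine decreases on [0, pi], and an e beyond 1/2 is reflected to 1 - e. In terms of the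
    circle, parameters at distance at least d from the integers stay at least the chord of d away
    from 1. *)
Lemma cos_far (d e : R) : 0 < d <= 1 / 2 -> d <= e <= 1 - d ->
  cos (2 * pi * e) <= cos (2 * pi * d).
Proof.
move=> /andP[d0 d1] /andP[de ed]; have p0 := pi_gt0 R.
have h (f : R) : d <= f <= 1 / 2 -> cos (2 * pi * f) <= cos (2 * pi * d).
  move=> /andP[df f1]; rewrite leNgt ltr_cos ?in_itv /=; last 2 first.
  - by apply/andP; split; nra.
  - by apply/andP; split; nra.
  by rewrite -leNgt; nra.
have [e1|e1] := leP e (1 / 2); first by apply: h; rewrite de.
have -> : cos (2 * pi * e) = cos (2 * pi * (1 - e)).
  rewrite mulrBr mulr1 [X in cos (X - _)]mulrC mulr_natr addrC cosD2pi.
  by rewrite cosN.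
by apply: h; apply/andP; split; lra.
Qed.

Lemma circle_exp_int k (t : R) : circle_exp (t + k%:~R) = circle_exp t.
Proof.
rewrite circle_expD; suff -> : circle_exp (k%:~R : R) = circle_exp 0.
  by rewrite circle_mulC circle_exp0.
apply: cval_inj; rewrite -[k%:~R]mulr1 -chi_exp_real circle_exp1.
by rewrite chi_exp_real mulr0.
Qed.

(** A nonzero fractional part d would have cos (2 pi d) at most the cosine at min(d, 1 - d), which
    is below 1. *)
Lemma circle_exp_eq1 (t : R) : cval (circle_exp t) = 1 -> exists k, t = k%:~R.
Proof.
move=> t1; exists (Num.floor t); apply/eqP; rewrite -subr_eq0; apply/eqP.
set d := t - _; have d01 : 0 <= d < 1.
  have := Num.Theory.floor_le_tmp t; have := Num.Theory.floorD1_gt t.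
  by rewrite intrD /d => h1 h2; apply/andP; split; lra.
have d1 : cval (circle_exp d) = 1 by rewrite /d -intrN circle_exp_int.
have [//|d0] := eqVneq d 0.
case/andP: d01 => d00 dlt1; have dp : 0 < d by rewrite lt_neqAle eq_sym d0.
have c1 : cos (2 * pi * d) = 1 by have := d1; rewrite cval_exp => -[].
have dm : 0 < Num.min d (1 - d) <= 1 / 2.
  rewrite lt_min dp subr_gt0 dlt1 /= ge_min.
  have [h|h] := leP d (1 / 2) => //=; lra.
have := cos_lt1 dm; have := @cos_far _ d dm.
rewrite c1 ge_min lexx /= => /(_ _) h1 h2.
have : 1 <= cos (2 * pi * Num.min d (1 - d)).
  apply: h1; have : Num.min d (1 - d) <= 1 - d by rewrite ge_min lexx orbT.
  lra.
lra.
Qed.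

(** A nonzero k with |k| <= n is not a multiple of n + 1, so this is a geometric sum of ratio a root
    of unity other than 1. *)
Lemma sum_roots (n : nat) k : (`|k| <= n)%N ->
  \sum_(p < n.+1) chi k (circle_exp (p%:R / n.+1%:R)) = ((k == 0)%:R * n.+1%:R : C).
Proof.
move=> kn; have [->|k0] := eqVneq k 0.
  by under eq_bigr do rewrite chi0; rewrite sumr_const card_ord mul1r.
pose x := cval (circle_exp (k%:~R / n.+1%:R : R)).
have E (p : 'I_n.+1) : chi k (circle_exp (p%:R / n.+1%:R)) = x ^+ p.
  by rewrite chi_exp_real mulrCA [p%:R]pmulrn -chi_exp_real.
under eq_bigr do rewrite E.
have xn : x ^+ n.+1 = 1.
  have -> : x ^+ n.+1 = chi n.+1%:Z (circle_exp (k%:~R / n.+1%:R)) by [].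
  rewrite chi_exp_real mulrC divfK ?pnatr_eq0 //.
  by rewrite -[k%:~R]add0r circle_exp_int cval_exp mulr0 cos0 sin0.
have x1 : x != 1.
  apply/eqP => /circle_exp_eq1[l] /(canRL (mulfVK _)).
  rewrite pnatr_eq0 => /(_ isT) /eqP.
  rewrite -[n.+1%:R]/((n.+1%:Z)%:~R) -intrM eqr_int => /eqP kl.
  have : (l != 0) by apply: contraNneq k0 => l0; rewrite kl l0 mul0r.
  move: kn; rewrite kl abszM => h l0.
  by have := leq_pmull n.+1 (_ : 0 < `|l|)%N; rewrite absz_gt0 => /(_ l0); lia.
rewrite mul0r; apply: (mulfI (_ : x - 1 != 0)); first by rewrite subr_eq0.
by rewrite -subrX1 xn subrr mulr0.
Qed.

(** The triangular weight max(0, 1 - |k|/n), written as a count of pairs: this is the form produced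
    by expanding the square modulus of a Dirichlet sum. *)
Definition fej (n : nat) k : R :=
  n%:R^-1 * \sum_(a < n) \sum_(b < n) (a%:Z - b%:Z == k)%:R.

Lemma fejN n k : fej n (- k) = fej n k.
Proof.
rewrite /fej exchange_big; congr (_ * _); apply: eq_bigr => a _; apply: eq_bigr => b _.
by rewrite -eqr_opp opprK opprB.
Qed.

Lemma fej_le1 n k : fej n k <= 1.
Proof.
have [->|n0] := posnP n; first by rewrite /fej invr0 mul0r.
rewrite /fej ler_pdivrMl ?ltr0n // mulr1.
apply: (@le_trans _ _ (\sum_(a < n) 1)); last by rewrite sumr_const card_ord.
apply: ler_sum => a _.
have [[b /eqP hb]|h] := pselect (exists b : 'I_n, a%:Z - b%:Z == k).
  rewrite (bigD1 b) //= big1 ?addr0 => [|c cb]; first by rewrite hb eqxx.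
  apply/eqP; rewrite pnatr_eq0 eqb0; apply: contraNneq cb => hc.
  by apply/eqP/val_inj => /=; lia.
rewrite big1 // => b _; apply/eqP; rewrite pnatr_eq0 eqb0; apply/negP => hb.
by apply: h; exists b.
Qed.

Lemma fej_lower n k : (0 < n)%N -> 1 - `|k|%:R / n%:R <= fej n k.
Proof.
move=> n0.
have h (m : nat) : (n - m)%:R <= \sum_(a < n) \sum_(b < n) (a%:Z - b%:Z == m%:Z)%:R :> R.
  rewrite exchange_big /=.
  (* For fixed b the only candidate is a = b + m, present exactly when b + m < n. *)
  apply: (@le_trans _ _ (\sum_(b < n) ((b + m < n)%N)%:R)).
    rewrite -natr_sum ler_nat {n0}; elim: n => [//|n IH].
    rewrite big_ord_recl /= add0n.
    under eq_bigr do rewrite /bump /= add1n addSn ltnS.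
    by apply: leq_trans (leq_add (leqnn _) IH); lia.
  apply: ler_sum => b _; case: (ltnP (b + m) n) => bm; last exact: sumr_ge0.
  rewrite (bigD1 (Ordinal bm)) //= (_ : _ == _ = true); last by lia.
  by rewrite lerDl sumr_ge0.
wlog k0 : k / 0 <= k => [H|].
  have [k0|k0] := leP 0 k; first exact: H.
  by have := H (- k); rewrite fejN abszN; apply; lia.
case: k k0 => // m _; rewrite /fej ler_pdivlMl ?ltr0n //.
apply: le_trans (h m); rewrite mulrBr mulr1 mulrCA mulfV ?pnatr_eq0 -?lt0n // mulr1.
have [mn|mn] := leqP m n; first by rewrite natrB.
by rewrite lerBlDr (le_trans (_ : n%:R <= m%:R)) ?lerDr // ler_nat ltnW.
Qed.

Lemma fej_tends k (e : R) : 0 < e ->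
  exists N, forall n, (N <= n)%N -> 1 - e < fej n k.
Proof.
move=> e0; exists (Num.trunc (`|k|%:R / e)).+1 => n Nn.
have n0 : (0 < n)%N by exact: leq_trans Nn.
apply: lt_le_trans (fej_lower k n0); rewrite ltrD2l ltrN2.
have p : 0 <= `|k|%:R / e :> R by rewrite divr_ge0 // ltW.
have /andP[_ h] := trunc_itv p.
rewrite ltr_pdivrMr ?ltr0n // mulrC -ltr_pdivrMr //.
by apply: lt_le_trans h _; rewrite ler_nat.
Qed.

End Characters.

(** * Positive kernels at roots of unity, uniform density of trigonometric polynomials, Weyl
    means *)

Section Density.
Variable R : realType.
Local Notation T := (circle R).
Local Notation C := R[i].
Implicit Types (z w : T) (g h : T -> C) (j k : int).

Definition node (n p : nat) : T := circle_exp (p%:R / n.+1%:R).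

(* Dirichlet kernels translated to the (n+1)-th roots of unity: by orthogonality
   their squared moduli [wpart] are a partition of unity, concentrated near the
   nodes. *)
Definition hpart (n p : nat) z : C :=
  ((Num.sqrt (n%:R * n.+1%:R))^-1)%:C%C *
  \sum_(a < n) chi a%:Z (circle_mul (circle_exp (- (p%:R / n.+1%:R))) z).

Definition wpart (n p : nat) z : R := nrm (hpart n p z) ^+ 2.

Lemma C_circle_hpart n p : C_circle (hpart n p).
Proof.
refine (C_circleM (@C_circle_cst R _) _).
have -> : (fun z => \sum_(a < n) chi a%:Z (circle_mul (circle_exp (- (p%:R / n.+1%:R))) z)) =
    \sum_(a < n) (fun z => chi a%:Z (circle_mul (circle_exp (- (p%:R / n.+1%:R))) z)).
  by apply/funext => z; rewrite fct_sumE.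
refine (@C_circle_sum R _ _ _ _) => a; exact (C_circle_rot (@C_circle_chi R a%:Z)).
Qed.

Lemma chi_expN k (t : R) : chi k (circle_exp (- t)) = chi (- k) (circle_exp t).
Proof. by rewrite !chi_exp_real intrN mulrN mulNr. Qed.

Lemma wpartE n p z : (wpart n p z)%:C%C = ((n%:R * n.+1%:R)^-1)%:C%C *
  \sum_(a < n) \sum_(b < n) chi (a%:Z - b%:Z) z * chi (b%:Z - a%:Z) (node n p).
Proof.
rewrite /wpart -mul_conj /hpart conjM mulrACA; congr (_ * _).
  rewrite conj_real.
  by rewrite -rmorphM -invfM -expr2 sqr_sqrtr // mulr_ge0.
rewrite conj_sum mulr_suml; apply: eq_bigr => a _.
rewrite mulr_sumr; apply: eq_bigr => b _.
by rewrite -chiN -chiD chi_mul chi_expN opprB mulrC.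
Qed.

(** Summation over n + 1 nodes is exact up to frequency n. The kernel has frequencies up to n - 1,
    which leaves room for one more: enough for the squared chord, a trigonometric polynomial of
    degree 1. *)
Lemma wpart_sum n k z : (0 < n)%N -> (`|k| <= 1)%N ->
  \sum_(p < n.+1) (wpart n p z)%:C%C * chi k (node n p) = (fej R n k)%:C%C * chi k z.
Proof.
move=> n0 k1; under eq_bigr do rewrite wpartE -mulrA mulr_suml.
rewrite -mulr_sumr exchange_big /=.
under eq_bigr => a _.
  under eq_bigr do rewrite mulr_suml.
  rewrite exchange_big /=.
  under eq_bigr => b _.
    under eq_bigr do rewrite -mulrA -chiD.
    rewrite -mulr_sumr sum_roots; last by have := ltn_ord a; have := ltn_ord b; lia.
    rewrite (_ : chi (a%:Z - b%:Z) z * _ =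
      ((a%:Z - b%:Z == k)%:R * n.+1%:R)%:C%C * chi k z); last first.
      rewrite (_ : _ + k == 0 = (a%:Z - b%:Z == k)); last by lia.
      case: eqP => [->|_]; last by rewrite !mul0r mulr0 ?rmorph0 ?mul0r.
      by rewrite !mul1r mulrC rmorph_nat.
    over.
  rewrite -mulr_suml; over.
rewrite -mulr_suml mulrA; congr (_ * _).
under eq_bigr do rewrite -(rmorph_sum (real_complex R)).
rewrite /fej -(rmorph_sum (real_complex R)) -(rmorphM (real_complex R)); congr (_%:C)%C.
under eq_bigr do rewrite -mulr_suml.
rewrite -mulr_suml invfM -mulrA; congr (_ * _).
by rewrite mulrC mulfK ?pnatr_eq0.
Qed.

Lemma wpart_sum1 n z : (0 < n)%N -> \sum_(p < n.+1) wpart n p z = 1.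
Proof.
move=> n0; have := @wpart_sum n 0 z n0 isT.
under eq_bigr do rewrite chi0 mulr1.
rewrite chi0 mulr1 -rmorph_sum => /complexI ->.
apply/eqP; rewrite eq_le fej_le1 /=.
by have := fej_lower R 0 n0; rewrite absz0 mul0r subr0.
Qed.

Lemma wpart_ge0 n p z : 0 <= wpart n p z.
Proof. exact: sqr_ge0. Qed.

(** The squared chord is 2 - 2 Re(z conj w), so the second moment is 2 minus twice the Fejer weight
    at -1, which is at least 1 - 1/n. *)
Lemma wpart_dist n z : (0 < n)%N ->
  \sum_(p < n.+1) wpart n p z * cdist z (node n p) ^+ 2 <= 2 / n%:R.
Proof.
move=> n0.
have E (p : 'I_n.+1) : wpart n p z * cdist z (node n p) ^+ 2 =
    2 * wpart n p z - 2 * complex.Re (cval z * ((wpart n p z)%:C%C * chi (- 1) (node n p))).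
  rewrite cdist_cos chiN /chi expr1z [cval z * (_ * _)]mulrCA.
  by case: (cval z * _) => a b /=; ring.
under eq_bigr do rewrite E.
rewrite big_split /= -mulr_sumr wpart_sum1 // sumrN -mulr_sumr -raddf_sum -mulr_sumr.
rewrite wpart_sum // chiN mulrCA /chi expr1z mul_conj nrm_cval expr1n mulr1 /=.
have := fej_lower R (-1) n0; rewrite abszN1 => h.
rewrite (_ : 2 / n%:R = 2 * (1 / n%:R)) ?mulrA ?mulr1 //; lra.
Qed.

Definition trig (r : seq (C * int)) z : C := \sum_(x <- r) x.1 * chi x.2 z.

Lemma trigE r : trig r = \sum_(x <- r) x.1 *: chi x.2.
Proof. by apply/funext => z; rewrite fct_sumE. Qed.

Lemma C_circle_trig r : C_circle (trig r).
Proof.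
rewrite trigE; refine (@C_circle_sum R _ _ _ _) => x.
exact (C_circleZ (@C_circle_chi R x.2)).
Qed.

(** Only sample values v p enter, so the same sums approximate functions on [0, 1] whose values at
    the two ends differ. *)
Definition jackson (n : nat) (v : nat -> C) z : C :=
  \sum_(p < n.+1) v p * (wpart n p z)%:C%C.

Lemma jackson_trig n (v : nat -> C) : exists r, jackson n v = trig r.
Proof.
exists [seq (v (x.1).1 * (((n%:R * n.+1%:R)^-1)%:C%C *
   chi ((x.2)%:Z - (x.1).2%:Z) (node n (x.1).1)), (x.1).2%:Z - (x.2)%:Z) |
   x <- [seq (x, b) | x <- [seq (p, a) | p <- iota 0 n.+1, a <- iota 0 n], b <- iota 0 n]].
apply/funext => z; rewrite /trig big_map big_allpairs_dep big_allpairs_dep /=.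
rewrite /jackson -(big_mkord xpredT (fun p => v p * (wpart n p z)%:C%C)) /=.
rewrite /index_iota subn0; apply: eq_bigr => p _.
rewrite wpartE mulr_sumr mulr_sumr.
rewrite -(big_mkord xpredT (fun a => v p * (((n%:R * n.+1%:R)^-1)%:C%C *
  \sum_(b < n) chi (a%:Z - b%:Z) z * chi (b%:Z - a%:Z) (node n p)))) /=.
rewrite /index_iota subn0; apply: eq_bigr => a _.
rewrite mulr_sumr mulr_sumr.
rewrite -(big_mkord xpredT (fun b => v p * (((n%:R * n.+1%:R)^-1)%:C%C *
  (chi (a%:Z - b%:Z) z * chi (b%:Z - a%:Z) (node n p))))) /=.
rewrite /index_iota subn0; apply: eq_bigr => b _.
by rewrite -!mulrA [chi _ z * _]mulrC.
Qed.

Lemma jackson_dist n (v : nat -> C) z (y : C) (e K : R) : (0 < n)%N ->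
  (forall p : nat, (p < n.+1)%N ->
    nrm (v p - y) <= e + K * cdist z (node n p) ^+ 2) ->
  0 <= K -> nrm (jackson n v z - y) <= e + K * (2 / n%:R).
Proof.
move=> n0 h K0.
have -> : jackson n v z - y = \sum_(p < n.+1) (v p - y) * (wpart n p z)%:C%C.
  under [RHS]eq_bigr do rewrite mulrBl.
  by rewrite sumrB -mulr_sumr -rmorph_sum wpart_sum1 // mulr1.
apply: le_trans (ler_nrm_sum _ _ _) _.
apply: (@le_trans _ _ (\sum_(p < n.+1) (e * wpart n p z +
    K * (wpart n p z * cdist z (node n p) ^+ 2)))).
  apply: ler_sum => p _; rewrite nrmM nrmC ger0_norm ?wpart_ge0 //.
  have := h p (ltn_ord p); have := wpart_ge0 n p z; nra.
rewrite big_split /= -!mulr_sumr wpart_sum1 // mulr1 lerD2l ler_wpM2l //.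
exact: wpart_dist.
Qed.

Lemma trig_dense g : C_circle g -> forall e : R, 0 < e ->
  exists r, forall z, nrm (trig r z - g z) <= e.
Proof.
move=> gC e e0; have e2 : 0 < e / 2 by rewrite divr_gt0.
have [K [K0 hK]] := C_circle_modulus gC e2.
(* Chosen so that the second moment contributes K (2 / n) <= e / 2. *)
pose n := (Num.trunc (4 * K / e)).+1.
have [r hr] := jackson_trig n (g \o node n); exists r => z; rewrite -hr.
apply: le_trans (@jackson_dist n (g \o node n) z _ (e / 2) K _ _ _) _ => //.
  by move=> p _; rewrite cdistC; exact: hK.
have p0 : 0 <= 4 * K / e by rewrite divr_ge0 ?mulr_ge0 // ltW.
have /andP[_] := trunc_itv p0; rewrite -/n ltr_pdivrMr // => h.
have : K * (2 / n%:R) <= e / 2.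
  by rewrite mulrA ler_pdivrMr ?ltr0n //; lra.
lra.
Qed.

Definition utends (F : nat -> T -> C) g := forall e : R, 0 < e ->
  exists N, forall n, (N <= n)%N -> forall z, nrm (F n z - g z) <= e.

(** A Riemann-type sum for p * g along the orbit of theta: the integration variable w is replaced by
    e(t theta), and g(w^-1 z) by the rotation by -t. *)
Definition wmean (theta : R) (p : T -> C) (N : nat) g : T -> C :=
  N%:R^-1 *: \sum_(t < N) p (circle_exp (t%:R * theta)) *: rotation theta (- t%:Z) g.

Lemma circle_exp_irrational (theta : R) k : irrational theta -> k != 0 ->
  cval (circle_exp (k%:~R * theta)) != 1.
Proof.
move=> irr k0; apply/eqP => /circle_exp_eq1[l kl]; apply: irr.
have kR : k%:~R != 0 :> R by rewrite intr_eq0.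
exists (l%:~R / k%:~R) => //.
by rewrite fmorph_div !rmorph_int -kl mulrC mulKf.
Qed.

Lemma nrm_geometric (x : C) (N : nat) : nrm x = 1 ->
  nrm (x - 1) * nrm (\sum_(t < N) x ^+ t) <= 2.
Proof.
move=> x1; rewrite -nrmM -subrX1; apply: le_trans (ler_nrmB _ _) _.
suff -> : nrm (x ^+ N) = 1 by rewrite nrm1; lra.
by elim: N => [|N IH]; rewrite ?expr0 ?nrm1 // exprS nrmM x1 IH mulr1.
Qed.

Lemma rotation_chi (theta : R) n k z :
  rotation theta n (chi k) z = chi k (circle_exp (n%:~R * theta)) * chi k z.
Proof. by rewrite /rotation chi_mul. Qed.

Lemma fct_scaleE (c : C) g z : (c *: g) z = c * g z.
Proof. by []. Qed.

(** The mean is a geometric sum of ratio e((k - j) theta). For k different from j the ratio is not 1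
    by irrationality, and the sum stays bounded by 2 / |ratio - 1|. *)
Lemma wmean_chi (theta : R) k j : irrational theta ->
  utends (fun N => wmean theta (chi k) N (chi j)) ((k == j)%:R *: chi k).
Proof.
move=> irr e e0.
have E N z : wmean theta (chi k) N (chi j) z = (N%:R^-1 *
    \sum_(t < N) cval (circle_exp ((k - j)%:~R * theta)) ^+ t) * chi j z.
  rewrite /wmean -mulrA mulr_suml.
  rewrite fct_scaleE; congr (_ * _); rewrite fct_sumE.
  apply: eq_bigr => t _; rewrite fct_scaleE rotation_chi mulrA; congr (_ * _).
  rewrite intrN mulNr chi_expN -chiD !chi_exp_real.
  have -> (x : R) : cval (circle_exp x) ^+ t = chi t%:Z (circle_exp x) by [].
  by rewrite chi_exp_real; congr (cval (circle_exp _)); rewrite mulrCA.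
move: E; have [<-|kj] := eqVneq k j => E.
  exists 1%N => N N1 z; rewrite E subrr mul0r.
  rewrite cval_exp mulr0 cos0 sin0.
  under eq_bigr do rewrite expr1n.
  rewrite sumr_const card_ord mulVf ?pnatr_eq0 -?lt0n // scale1r mul1r subrr nrm0.
  exact: ltW.
set x := cval _ in E; have x1 : 0 < nrm (x - 1).
  rewrite lt_neqAle nrm_ge0 eq_sym andbT; apply/eqP => /nrm_eq0 /eqP.
  by rewrite subr_eq0; apply/negP/circle_exp_irrational => //; rewrite subr_eq0.
exists (Num.trunc (2 / nrm (x - 1) / e)).+1 => N hN z.
have N0 : 0 < N%:R :> R by rewrite ltr0n; exact: leq_trans hN.
rewrite E scale0r subr0 nrmM nrm_chi mulr1 nrmM.
have -> : nrm (N%:R^-1 : C) = N%:R^-1.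
  by rewrite -(rmorph_nat (real_complex R)) -fmorphV nrmC ger0_norm ?invr_ge0 ?ltW.
rewrite ler_pdivrMl //.
have p0 : 0 <= 2 / nrm (x - 1) / e by rewrite !divr_ge0 // ltW.
have /andP[_] := trunc_itv p0; rewrite ltr_pdivrMr // ltr_pdivrMr // => h.
have : (Num.trunc (2 / nrm (x - 1) / e)).+1%:R <= N%:R :> R by rewrite ler_nat.
have := nrm_geometric N (nrm_cval (circle_exp ((k - j)%:~R * theta))).
rewrite -/x; move: (nrm (x - 1)) x1 h (nrm (\sum_(t < N) _)) => d d0 h S h1 h2.
have : d * S <= d * (N%:R * e).
  apply: le_trans h1 _; apply: le_trans (ltW h) _.
  by rewrite mulrC ler_wpM2l ?(ltW d0) // ler_wpM2r // ltW.
by rewrite ler_pM2l.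
Qed.

End Density.

(** * Real and complex integrals over [0, 1] *)

Section Integrals.
Variable R : realType.
Local Notation C := R[i].
Implicit Types (f g : R -> R) (h k : R -> C).
Local Notation mu := (@lebesgue_measure R).
Local Notation D := `[0%R, 1%R]%classic.

Definition rint f : R := Rintegral mu D f.
Definition rintegrable f := mu.-integrable D (EFin \o f).

Lemma measurable_unit_itv : measurable (D : set (measurableTypeR R)).
Proof. exact: measurable_itv. Qed.
Local Notation mD := measurable_unit_itv.

Lemma rintegrableD f g : rintegrable f -> rintegrable g ->
  rintegrable (fun t => f t + g t).
Proof. by move=> fi gi; exact: (integrableD mD fi gi). Qed.

Lemma rintegrableZ (a : R) f : rintegrable f -> rintegrable (fun t => a * f t).
Proof. by move=> fi; exact: (integrableZl mD a fi). Qed.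

Lemma rintegrable_norm f : rintegrable f -> rintegrable (fun t => `|f t|).
Proof. exact: integrable_norm. Qed.

Lemma rintegrable_continuous f : continuous f -> rintegrable f.
Proof.
move=> fc; apply: continuous_compact_integrable; first exact: segment_compact.
exact: continuous_subspaceT.
Qed.

Lemma rintegrableM f g (B : R) : rintegrable f -> continuous g ->
  (forall t, `|g t| <= B) -> rintegrable (fun t => f t * g t).
Proof.
move=> fi gc gB; have B0 : 0 <= B by apply: le_trans (gB 0).
apply: (le_integrable mD) (rintegrableZ B fi).
  apply/measurable_EFinP/measurable_funM.
    by have /integrableP[/measurable_EFinP] := fi.
  apply: subspace_continuous_measurable_fun; first exact: mD.
  exact: continuous_subspaceT.
move=> t _ /=; rewrite lee_fin normrM [leRHS]normrM mulrC ler_wpM2r //.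
by rewrite [leRHS]ger0_norm.
Qed.

Lemma rintD f g : rintegrable f -> rintegrable g ->
  rint (fun t => f t + g t) = rint f + rint g.
Proof. by move=> fi gi; rewrite /rint RintegralD //; exact: mD. Qed.

Lemma rintZ (a : R) f : rintegrable f -> rint (fun t => a * f t) = a * rint f.
Proof. by move=> fi; rewrite /rint RintegralZl //; exact: mD. Qed.

Lemma ler_rint f g : rintegrable f -> rintegrable g -> (forall t, f t <= g t) ->
  rint f <= rint g.
Proof. by move=> fi gi fg; apply: le_Rintegral => //; exact: mD. Qed.

Lemma rint_norm f : rintegrable f -> `|rint f| <= rint (fun t => `|f t|).
Proof. by move=> fi; apply: le_normr_Rintegral => //; exact: mD. Qed.

Lemma rint_ge0 f : (forall t, 0 <= f t) -> 0 <= rint f.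
Proof. by move=> f0; apply: Rintegral_ge0. Qed.

Lemma rint_FTC (f F : R -> R) : continuous f ->
  (forall t : R, is_derive t 1 F (f t)) -> rint f = F 1 - F 0.
Proof.
move=> fc dF; rewrite /rint /Rintegral.
have dF1 (t : R) : derivable F t 1 by have [] := dF t.
have cF : continuous F by move=> t; apply/differentiable_continuous/derivable1_diffP.
rewrite (@continuous_FTC2 _ f F 0 1) //.
- exact: continuous_subspaceT.
- split=> [t _|//|].
  + exact: dF1.
  + exact/cvg_at_right_filter/cF.
  + exact/cvg_at_left_filter/cF.
- by move=> t _; rewrite derive1E; have [_ ->] := dF t.
Qed.

Lemma rint_cst (a : R) : rint (fun=> a) = a.
Proof.
have dM (t : R) : is_derive t 1 (fun t => a * t) a.
  have := is_deriveZ (f := id) a (is_derive_id t 1).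
  by rewrite /GRing.scale /= mulr1.
by rewrite (rint_FTC (@cst_continuous _ _ a) dM) mulr1 mulr0 subr0.
Qed.

Definition cintegrable h :=
  rintegrable (fun t => complex.Re (h t)) /\ rintegrable (fun t => complex.Im (h t)).

(* An equivalent of the L1 norm, equal to it on real-valued functions. *)
Definition norm1 h : R := rint (fun t => `|complex.Re (h t)| + `|complex.Im (h t)|).

Lemma cintegrable_norm h : cintegrable h ->
  rintegrable (fun t => `|complex.Re (h t)| + `|complex.Im (h t)|).
Proof. by move=> [h1 h2]; apply: rintegrableD; exact: rintegrable_norm. Qed.

Lemma cintegrable_comb (c : C) h k : cintegrable h -> cintegrable k ->
  cintegrable (fun t => c * h t + k t).
Proof.
case: c => a b [h1 h2] [k1 k2]; split.
- have -> : (fun t => complex.Re ((a +i* b)%C * h t + k t)) =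
     fun t => (a * complex.Re (h t) + (- b) * complex.Im (h t)) + complex.Re (k t).
    by apply/funext => t; case: (h t) (k t) => x y [x' y'] /=; ring.
  by apply: rintegrableD => //; apply: rintegrableD; exact: rintegrableZ.
- have -> : (fun t => complex.Im ((a +i* b)%C * h t + k t)) =
     fun t => (a * complex.Im (h t) + b * complex.Re (h t)) + complex.Im (k t).
    by apply/funext => t; case: (h t) (k t) => x y [x' y'] /=; ring.
  by apply: rintegrableD => //; apply: rintegrableD; exact: rintegrableZ.
Qed.

Lemma cintegral_comb (c : C) h k : cintegrable h -> cintegrable k ->
  cintegral (fun t => c * h t + k t) = c * cintegral h + cintegral k.
Proof.
case: c => a b [h1 h2] [k1 k2]; rewrite /cintegral -!/(rint _).
have -> : (fun t => complex.Re ((a +i* b)%C * h t + k t)) =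
     fun t => (a * complex.Re (h t) + (- b) * complex.Im (h t)) + complex.Re (k t).
  by apply/funext => t; case: (h t) (k t) => x y [x' y'] /=; ring.
have -> : (fun t => complex.Im ((a +i* b)%C * h t + k t)) =
     fun t => (a * complex.Im (h t) + b * complex.Re (h t)) + complex.Im (k t).
  by apply/funext => t; case: (h t) (k t) => x y [x' y'] /=; ring.
have z1 := rintegrableZ a h1; have z2 := rintegrableZ (- b) h2.
have z3 := rintegrableZ a h2; have z4 := rintegrableZ b h1.
rewrite !rintD ?rintZ //; try exact: rintegrableD.
by apply/eqP; rewrite eq_complex /= mulNr !eqxx.
Qed.

Lemma nrm_cintegral h : cintegrable h -> nrm (cintegral h) <= norm1 h.
Proof.
move=> [h1 h2]; apply: le_trans (nrm_le_ReIm _) _ => /=.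
rewrite /norm1 rintD; [|exact: rintegrable_norm..].
by apply: lerD; exact: rint_norm.
Qed.

(** The factor 2 comes from working with |Re| + |Im|: each of |Re k| and |Im k| is only bounded by
    B. *)
Lemma cintegrableM h k (B : R) : cintegrable h ->
  continuous (fun t => complex.Re (k t)) -> continuous (fun t => complex.Im (k t)) ->
  (forall t, nrm (k t) <= B) ->
  cintegrable (fun t => h t * k t) /\ norm1 (fun t => h t * k t) <= 2 * B * norm1 h.
Proof.
move=> hi kr ki kB; have [h1 h2] := hi.
have B0 : 0 <= B by apply: le_trans (nrm_ge0 _) (kB 0).
have rB t : `|complex.Re (k t)| <= B by exact: le_trans (Re_le_nrm _) _.
have iB t : `|complex.Im (k t)| <= B by exact: le_trans (Im_le_nrm _) _.
have I : cintegrable (fun t => h t * k t).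
  split.
  - have -> : (fun t => complex.Re (h t * k t)) = fun t =>
        complex.Re (h t) * complex.Re (k t) + (-1) * (complex.Im (h t) * complex.Im (k t)).
      by apply/funext => t; case: (h t) (k t) => x y [x' y'] /=; ring.
    apply: rintegrableD; first exact: rintegrableM rB.
    by apply: rintegrableZ; exact: rintegrableM iB.
  - have -> : (fun t => complex.Im (h t * k t)) = fun t =>
        complex.Re (h t) * complex.Im (k t) + complex.Im (h t) * complex.Re (k t).
      by apply/funext => t; case: (h t) (k t) => x y [x' y'] /=; ring.
    apply: rintegrableD; first exact: rintegrableM iB.
    exact: rintegrableM rB.
split=> //; rewrite /norm1 -rintZ; last exact: cintegrable_norm.
apply: ler_rint => [||t].
- exact: cintegrable_norm.
- by apply: rintegrableZ; exact: cintegrable_norm.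
- have := rB t; have := iB t; case: (h t) (k t) => x y [x' y'] /= i1 i2.
  have a1 := ler_normB (x * x') (y * y'); have a2 := ler_normD (x * y') (y * x').
  rewrite !normrM in a1 a2.
  have := normr_ge0 x; have := normr_ge0 y.
  rewrite [x * y' + _]addrC in a2.
  move: (`|x|) (`|y|) (`|x'|) (`|y'|) a1 a2 i1 i2 => X Y X' Y' a1 a2 i1 i2 X0 Y0.
  have := ler_wpM2l X0 i1; have := ler_wpM2l X0 i2.
  have := ler_wpM2l Y0 i1; have := ler_wpM2l Y0 i2.
  by rewrite [y * x' + _]addrC in a2 *; lra.
Qed.

Lemma norm1_ge0 h : 0 <= norm1 h.
Proof. by apply: rint_ge0 => t; rewrite addr_ge0. Qed.

Lemma norm1D h k : cintegrable h -> cintegrable k ->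
  norm1 (fun t => h t + k t) <= norm1 h + norm1 k.
Proof.
move=> hi ki; rewrite /norm1 -rintD; [|exact: cintegrable_norm..].
apply: ler_rint => [||t].
- apply: cintegrable_norm.
  have := cintegrable_comb 1 hi ki; congr cintegrable.
  by apply/funext => t; rewrite mul1r.
- by apply: rintegrableD; exact: cintegrable_norm.
- by rewrite !raddfD /=; have := ler_normD (complex.Re (h t)) (complex.Re (k t));
    have := ler_normD (complex.Im (h t)) (complex.Im (k t)); lra.
Qed.

Lemma cintegrable_continuous k : continuous (fun t => complex.Re (k t)) ->
  continuous (fun t => complex.Im (k t)) -> cintegrable k.
Proof. by move=> kr ki; split; exact: rintegrable_continuous. Qed.

Lemma cintegral_exp (n : int) :
  cintegral (fun t : R => cval (circle_exp (n%:~R * t))) = (n == 0)%:R.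
Proof.
have [->|n0] := eqVneq n 0.
  have -> : (fun t : R => cval (circle_exp (0%:~R * t))) = fun=> 1.
    by apply/funext => t; rewrite mul0r cval_exp mulr0 cos0 sin0.
  by rewrite /cintegral -!/(rint _) !rint_cst.
pose a : R := 2 * pi * n%:~R.
have a0 : a != 0 by rewrite !mulf_neq0 ?pnatr_eq0 ?intr_eq0 // gt_eqF // pi_gt0.
have dM (t : R) : is_derive t 1 (fun t => a * t) a.
  have := is_deriveZ (f := id) a (is_derive_id t 1).
  by rewrite /GRing.scale /= mulr1.
have cM : continuous (fun t => a * t).
  by move=> t; apply: cvgM; [exact: cvg_cst|exact: cvg_id].
have per : cos a = 1 /\ sin a = 0.
  have : cval (circle_exp n%:~R) = cval (circle_exp (0 : R)).
    by rewrite -[n%:~R]add0r circle_exp_int.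
  by rewrite !cval_exp mulr0 cos0 sin0 => -[].
rewrite /cintegral -!/(rint _).
have c1 : continuous (fun t : R => complex.Re (cval (circle_exp (n%:~R * t)))).
  have -> : (fun t : R => complex.Re (cval (circle_exp (n%:~R * t)))) = cos \o (fun t => a * t).
    by apply/funext => t; rewrite cval_exp /= /a mulrA.
  by move=> t; apply: continuous_comp; [exact: cM|exact: continuous_cos].
have d1 (t : R) : is_derive t 1 (fun t => a^-1 * sin (a * t))
    (complex.Re (cval (circle_exp (n%:~R * t)))).
  rewrite cval_exp /= mulrA -/a.
  have d1 : is_derive t 1 (sin \o (fun t => a * t)) (cos (a * t) * a).
    have := is_derive1_comp (f := sin) (g := fun t => a * t) (is_derive_sin _) (dM t).
    by rewrite mulrC.
  have := is_deriveZ a^-1 d1; rewrite /GRing.scale /=.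
  by rewrite mulrC mulfK.
have c2 : continuous (fun t : R => complex.Im (cval (circle_exp (n%:~R * t)))).
  have -> : (fun t : R => complex.Im (cval (circle_exp (n%:~R * t)))) = sin \o (fun t => a * t).
    by apply/funext => t; rewrite cval_exp /= /a mulrA.
  by move=> t; apply: continuous_comp; [exact: cM|exact: continuous_sin].
have d2 (t : R) : is_derive t 1 (fun t => a^-1 * - cos (a * t))
    (complex.Im (cval (circle_exp (n%:~R * t)))).
  rewrite cval_exp /= mulrA -/a.
  have d2 : is_derive t 1 (cos \o (fun t => a * t)) (- sin (a * t) * a).
    have := is_derive1_comp (f := cos) (g := fun t => a * t) (is_derive_cos _) (dM t).
    by rewrite mulrC.
  have := is_deriveZ a^-1 (is_deriveN d2); rewrite /GRing.scale /=.
  by rewrite mulNr opprK mulrC mulfK.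
rewrite (rint_FTC c1 d1) (rint_FTC c2 d2).
have [ca sa] := per.
by rewrite !mulr1 !mulr0 ca sa cos0 sin0 !mulr0 !subrr.
Qed.

End Integrals.

(** * Convolution of integrable with continuous functions *)

Section Convolution.
Variable R : realType.
Local Notation T := (circle R).
Local Notation C := R[i].
Implicit Types (z w : T) (f g h : T -> C) (j k : int).

(** Stated for paths that do not stretch chords, to cover both [circle_exp] and the translated
    argument in a convolution. *)
Lemma continuous_circle_path (p : R -> T) g : C_circle g ->
  (forall s t, cdist (p s) (p t) <= cdist (circle_exp s) (circle_exp t)) ->
  continuous (fun t => complex.Re (g (p t))) /\ continuous (fun t => complex.Im (g (p t))).
Proof.
move=> /C_circleP gC pL.
have near (t e : R) : 0 < e -> nbhs t [set s : R | nrm (g (p s) - g (p t)) < e].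
  move=> e0; have [d d0 hd] := gC (p t) _ e0.
  apply: filterS (circle_exp_near t d0) => s /= h; apply: hd.
  exact: le_lt_trans (pL s t) h.
split=> t; apply/cvgrPdist_lt => e e0; apply: filterS (near t e e0) => s /=;
  apply: le_lt_trans; rewrite nrmB -raddfB; [exact: Re_le_nrm|exact: Im_le_nrm].
Qed.

Definition translate (t : R) z : T := circle_mul (circle_exp (- t)) z.

Lemma cdist_translate z (s t : R) :
  cdist (translate s z) (translate t z) = cdist (circle_exp s) (circle_exp t).
Proof.
rewrite /translate ![circle_mul _ z]circle_mulC cdist_mul /cdist !circle_expN.
by rewrite -rmorphB nrm_conj.
Qed.

Lemma ler_cdist_translate z (s t : R) :
  cdist (translate s z) (translate t z) <= cdist (circle_exp s) (circle_exp t).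
Proof. by rewrite cdist_translate. Qed.

Lemma cintegrable_circle f : C_circle f -> cintegrable (fun t => f (circle_exp t)).
Proof.
move=> fC; have [h1 h2] := continuous_circle_path (p := @circle_exp R) fC (fun s t => lexx _).
exact: cintegrable_continuous.
Qed.

Definition L1norm f : R := norm1 (fun t => f (circle_exp t)).

Lemma L1norm_ge0 f : 0 <= L1norm f.
Proof. exact: norm1_ge0. Qed.

Lemma convolution_integrable f g z : L1_circle f -> C_circle g ->
  cintegrable (fun t => f (circle_exp t) * g (translate t z)).
Proof.
move=> fL gC; have [B [B0 gB]] := C_circle_bounded gC.
have [c1 c2] := continuous_circle_path (p := translate^~ z) gC
  (ler_cdist_translate z).
by have [] := cintegrableM (B := B) (fL : cintegrable (fun t => f (circle_exp t))) c1 c2 (fun t => gB _).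
Qed.

Lemma nrm_convolution f g z (B : R) : L1_circle f -> C_circle g ->
  (forall w, nrm (g w) <= B) -> nrm (convolution f g z) <= 2 * B * L1norm f.
Proof.
move=> fL gC gB; apply: le_trans (nrm_cintegral (convolution_integrable z fL gC)) _.
have [c1 c2] := continuous_circle_path (p := translate^~ z) gC
  (ler_cdist_translate z).
by have [] := cintegrableM (B := B) (fL : cintegrable (fun t => f (circle_exp t))) c1 c2 (fun t => gB _).
Qed.

Lemma convolution_combr f (c : C) g h : L1_circle f -> C_circle g -> C_circle h ->
  convolution f (c *: g + h) = c *: convolution f g + convolution f h.
Proof.
move=> fL gC hC; apply/funext => z.
rewrite -[RHS]/(c * convolution f g z + convolution f h z) /convolution.
rewrite -cintegral_comb; [|exact: convolution_integrable..].
congr cintegral; apply/funext => t.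
by rewrite -[(c *: g + h) _]/(c * g _ + h _) mulrDr mulrCA.
Qed.

Lemma convolution_combl (c : C) f f' g : L1_circle f -> L1_circle f' -> C_circle g ->
  convolution (c *: f + f') g = c *: convolution f g + convolution f' g.
Proof.
move=> fL fL' gC; apply/funext => z.
rewrite -[RHS]/(c * convolution f g z + convolution f' g z) /convolution.
rewrite -cintegral_comb; [|exact: convolution_integrable..].
congr cintegral; apply/funext => t.
by rewrite -[(c *: f + f') _]/(c * f _ + f' _) mulrDl mulrA.
Qed.

Lemma L1_circle_comb (c : C) f f' : L1_circle f -> L1_circle f' -> L1_circle (c *: f + f').
Proof. exact: cintegrable_comb. Qed.

Lemma L1_circle_C f : C_circle f -> L1_circle f.
Proof. exact: cintegrable_circle. Qed.

Lemma convolution_subr f g h : L1_circle f -> C_circle g -> C_circle h ->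
  convolution f (g - h) = convolution f g - convolution f h.
Proof.
move=> fL gC hC; rewrite -[g - h]addrC -scaleN1r convolution_combr //.
by rewrite scaleN1r addrC.
Qed.

Lemma C_circle_convolution f g : L1_circle f -> C_circle g -> C_circle (convolution f g).
Proof.
move=> fL gC; apply/C_circleP => z e e0.
have L0 := L1norm_ge0 f.
have e1 : 0 < e / 4 / (L1norm f + 1) by rewrite !divr_gt0 // ltr_wpDl.
have [K [K0 hK]] := C_circle_modulus gC e1.
have d2 : 0 < e / 4 / (L1norm f + 1) / (K + 1) by rewrite divr_gt0 // ltr_wpDl.
(* The bound 1 ensures that the squared distance is also below d. *)
pose d := Num.min 1 (e / 4 / (L1norm f + 1) / (K + 1)).
have d0 : 0 < d by rewrite lt_min ltr01.
exists d => // w wd.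
have dist (x : T) : circle_mul (circle_mul w (circle_exp 0)) x = circle_mul w x.
  by rewrite [circle_mul w _]circle_mulC circle_exp0.
(* Moving the point into g turns a difference of two values into one value of the convolution with a
   uniformly small function. *)
have E y : convolution f g y = convolution f (fun x => g (circle_mul y x)) (circle_exp 0).
  rewrite /convolution; congr cintegral; apply/funext => t; congr (_ * g _).
  by rewrite [circle_mul y _]circle_mulC -circle_mulA circle_exp0.
rewrite E [convolution f g z]E.
have gw := C_circle_rot (w := w) gC; have gz := C_circle_rot (w := z) gC.
have -> : convolution f (fun x => g (circle_mul w x)) (circle_exp 0) -
    convolution f (fun x => g (circle_mul z x)) (circle_exp 0) =
    convolution f ((fun x => g (circle_mul w x)) - (fun x => g (circle_mul z x))) (circle_exp 0).
  by rewrite convolution_subr.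
have c0 := nrm_ge0 (cval w - cval z).
have d1 : d <= 1 by rewrite ge_min lexx.
have d3 : d <= e / 4 / (L1norm f + 1) / (K + 1) by rewrite ge_min lexx orbT.
rewrite ler_pdivlMr ?ltr_wpDl // in d3.
apply: le_lt_trans (nrm_convolution (B := 2 * (e / 4 / (L1norm f + 1))) _ fL _ _) _.
- exact (C_circle_sub gw gz).
- move=> x; apply: le_trans (hK _ _) _.
  rewrite [circle_mul w x]circle_mulC [circle_mul z x]circle_mulC cdist_mul.
  have c1 : cdist w z ^+ 2 <= d by rewrite /cdist in wd *; rewrite /cdist; nra.
  have : K * cdist w z ^+ 2 <= K * d by rewrite ler_wpM2l.
  nra.
- set q := e / 4 / (L1norm f + 1).
  have : q * (L1norm f + 1) = e / 4 by rewrite /q divfK // gt_eqF // ltr_wpDl.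
  have : 0 < q by []. nra.
Qed.

Lemma convolution_chi k j : convolution (chi k) (chi j) = (k == j)%:R *: chi k :> (T -> C).
Proof.
apply/funext => z; rewrite fct_scaleE /convolution.
have -> : (fun t => chi k (circle_exp t) * chi j (circle_mul (circle_exp (- t)) z)) =
    fun t : R => chi j z * cval (circle_exp ((k - j)%:~R * t)) + 0.
  apply/funext => t; rewrite chi_mul chi_expN mulrA -chiD chi_exp_real addr0 mulrC.
  by [].
rewrite cintegral_comb; last 2 first.
- have := cintegrable_circle (@C_circle_chi R (k - j)).
  by congr cintegrable; apply/funext => t; rewrite chi_exp_real.
- by have := cintegrable_circle (@C_circle0 R).
rewrite cintegral_exp (_ : cintegral _ = 0) ?addr0; last first.
  by rewrite /cintegral -!/(rint _) !rint_cst.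
by rewrite subr_eq0; case: eqP => [->|_]; rewrite ?mulr1 ?mul1r // mulr0 mul0r.
Qed.

Lemma convolution_rotation (theta : R) n f g :
  rotation theta n (convolution f g) = convolution f (rotation theta n g).
Proof.
apply/funext => z; rewrite /rotation /convolution; congr cintegral; apply/funext => t.
by rewrite !circle_mulA [circle_mul (circle_exp (- t)) _]circle_mulC.
Qed.

Definition lin_on_C (L : (T -> C) -> T -> C) := forall (c : C) g h,
  C_circle g -> C_circle h -> L (c *: g + h) = c *: L g + L h.

Definition sup_bounded (M : R) (L : (T -> C) -> T -> C) := forall g (B : R),
  C_circle g -> (forall z, nrm (g z) <= B) -> forall z, nrm (L g z) <= M * B.

Lemma lin_on_C_sub L g h : lin_on_C L -> C_circle g -> C_circle h -> L (g - h) = L g - L h.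
Proof.
by move=> LL gC hC; rewrite addrC -scaleN1r LL // scaleN1r addrC.
Qed.

Lemma lin_on_C0 L : lin_on_C L -> L 0 = 0.
Proof.
move=> LL; have := LL 1 0 0 (@C_circle0 R) (@C_circle0 R).
by rewrite scaler0 addr0 scale1r => /(congr1 (fun x => x - L 0)); rewrite addrK subrr.
Qed.

Lemma lin_on_C_trig L (r : seq (C * int)) : lin_on_C L ->
  L (trig r) = \sum_(x <- r) x.1 *: L (chi x.2).
Proof.
move=> LL; rewrite trigE; elim: r => [|x r IH]; first by rewrite !big_nil lin_on_C0.
rewrite !big_cons LL ?IH //; first exact (@C_circle_chi R x.2).
by have := @C_circle_trig R r; rewrite trigE.
Qed.

(** Uniform boundedness together with density of trigonometric polynomials: convergence on
    characters suffices. The error e splits into e/4 for each replacement of g and e/2 for the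
    polynomial. *)
Lemma utends_ext (F : nat -> (T -> C) -> T -> C) L (M : R) : 0 <= M ->
  (forall n, lin_on_C (F n)) -> lin_on_C L ->
  (forall n, sup_bounded M (F n)) -> sup_bounded M L ->
  (forall k, utends (fun n => F n (chi k)) (L (chi k))) ->
  forall g, C_circle g -> utends (fun n => F n g) (L g).
Proof.
move=> M0 linF linL bF bL hchi g gC e e0.
have e3 : 0 < e / 4 / (M + 1) by rewrite !divr_gt0 // ltr_wpDl.
have [r hr] := trig_dense gC e3.
have [N hN] : exists N, forall n, (N <= n)%N -> forall z,
    nrm (F n (trig r) z - L (trig r) z) <= e / 2.
  have e2 : 0 < e / 2 by rewrite divr_gt0.
  elim: (r) (e / 2) e2 => [|x s IH] d d0.
    exists 0%N => n _ z; rewrite !lin_on_C_trig // !big_nil subrr nrm0; exact: ltW.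
  have d2 : 0 < d / 2 by rewrite divr_gt0.
  have d3 : 0 < d / 2 / (nrm x.1 + 1) by rewrite divr_gt0 // ltr_wpDl ?nrm_ge0.
  have [N1 h1] := IH _ d2; have [N2 h2] := hchi x.2 _ d3.
  exists (maxn N1 N2) => n; rewrite geq_max => /andP[/h1 i1 /h2 i2] z.
  move: (i1 z) (i2 z); rewrite !lin_on_C_trig // !big_cons => j1 j2.
  rewrite -![(_ + _) z]/(_ z + _ z) opprD addrACA.
  apply: le_trans (ler_nrmD _ _) _.
  rewrite -![(_ *: _) z]/(_ * _ z) -mulrBr nrmM.
  have : nrm x.1 * nrm (F n (chi x.2) z - L (chi x.2) z) <= d / 2.
    rewrite ler_pdivlMr ?ltr_wpDl ?nrm_ge0 // in j2.
    apply: le_trans j2; rewrite mulrC ler_wpM2l ?nrm_ge0 //; lra.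
  lra.
exists N => n Nn z.
have gr : C_circle (g - trig r) := C_circle_sub gC (@C_circle_trig R r).
have grB w : nrm ((g - trig r) w) <= e / 4 / (M + 1) by rewrite nrmB; exact: hr.
have h1 := bF n _ _ gr grB z; have h2 := bL _ _ gr grB z.
rewrite (lin_on_C_sub (linF n) gC (@C_circle_trig R r)) in h1.
rewrite (lin_on_C_sub linL gC (@C_circle_trig R r)) in h2.
have -> : F n g z - L g z = (F n g - F n (trig r)) z - (L g - L (trig r)) z +
    (F n (trig r) z - L (trig r) z).
  rewrite -![(_ - _ : T -> C) z]/(_ z - _ z); ring.
apply: le_trans (ler_nrmD _ _) _.
apply: le_trans (lerD (ler_nrmB _ _) (hN n Nn z)) _.
have : M * (e / 4 / (M + 1)) <= e / 4.
  rewrite mulrA ler_pdivrMr ?ltr_wpDl // mulrC ler_wpM2l //; lra.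
lra.
Qed.

End Convolution.

(** * Dominated convergence and L1 approximation on [0, 1] *)

Section DominatedIntegrals.
Variable R : realType.
Local Notation mu := (@lebesgue_measure R).

(** Convergence is asked inside the interval only. The end points form a null set, and periodic
    approximants of a non-periodic function fail there. *)
Lemma rint_dominated (F : nat -> R -> R) (f : R -> R) (B : R) :
  (forall n, continuous (F n)) -> continuous f ->
  (forall n t, 0 <= t <= 1 -> `|F n t| <= B) ->
  (forall t, 0 < t < 1 -> (fun n => F n t) @ \oo --> f t) ->
  forall e : R, 0 < e -> exists N, forall n, (N <= n)%N ->
    rint (fun t => `|F n t - f t|) <= e.
Proof.
move=> Fc fc FB Ff e e0.
pose O : set (measurableTypeR R) := `]0%R, 1%R[%classic.
have mO : measurable O by exact: measurable_itv.
have sub : O `<=` `[0%R, 1%R]%classic.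
  by move=> t /=; rewrite !in_itv /= => /andP[a b]; rewrite !ltW.
have cO (h : R -> R) : continuous h -> mu.-integrable O (EFin \o h).
  by move=> hc; exact: (integrableS (@measurable_unit_itv R) mO sub (rintegrable_continuous hc)).
have mOf (h : R -> R) : continuous h -> measurable_fun O (EFin \o h).
  by move=> hc; have /integrableP[] := cO h hc.
have := @dominated_convergence _ _ R mu O mO (fun n => EFin \o F n) (EFin \o f) (EFin \o cst B).
move=> /(_ (fun n => mOf _ (Fc n)) (mOf _ fc)) [].
- apply: aeW => t; rewrite /O /= in_itv /= => t01.
  by apply/fine_cvgP; split; [exact: nearW|exact: Ff].
- by apply: cO; exact: cst_continuous.
- apply: aeW => t n; rewrite /O /= in_itv /= => /andP[t0 t1].
  by rewrite lee_fin FB // !ltW.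
- move=> _ /fine_cvgP[_ /cvgrPdist_le /(_ e e0) [N _ hN]] _.
  exists N => n /hN /=; rewrite sub0r normrN; apply: le_trans.
  have nc : continuous (fun t => `|F n t - f t|).
    move=> t; apply: (@continuous_comp _ _ _ (fun t => F n t - f t) Num.norm).
      by apply: cvgB; [exact: Fc|exact: fc].
    exact: norm_continuous.
  rewrite /rint -Rintegral_itv_obnd_cbnd; last first.
    have mO' : measurable (`]0%R, 1%R]%classic : set (measurableTypeR R)) by exact: measurable_itv.
    apply: (integrableS (@measurable_unit_itv R) mO' _ (rintegrable_continuous nc)).
    by move=> t /=; rewrite !in_itv /= => /andP[a ->]; rewrite ltW.
  rewrite -Rintegral_itv_bndo_bndc; last exact: cO.
  by rewrite /Rintegral; apply: ler_norm.
Qed.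

Lemma rintegrable_approx (f : R -> R) : rintegrable f -> forall e : R, 0 < e ->
  exists g : R -> R, continuous g /\ rint (fun t => `|f t - g t|) <= e.
Proof.
move=> fi e e0.
have fin : (mu `[0%R, 1%R]%classic < +oo)%E by rewrite lebesgue_measure_itv /= lte_fin ltr01 ltry.
have [g [gc gi]] := approximation_continuous_integrable (@measurable_unit_itv R) fin fi.
move=> /fine_cvgP[_ /cvgrPdist_le /(_ e e0) [N _ hN]].
exists (g N); split; first exact: gc.
have /= := hN N (leqnn N); rewrite sub0r normrN; apply: le_trans.
by rewrite /rint /Rintegral; apply: ler_norm.
Qed.

End DominatedIntegrals.

(** * Density of trigonometric polynomials in L1 *)

Section TrigonometricDensity.
Variable R : realType.
Local Notation T := (circle R).
Local Notation C := R[i].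
Implicit Types (z w : T) (f g h : T -> C) (j k : int).

(** G may take different values at 0 and 1, so t must be interior: then nodes close to e(t) on the
    circle have parameters close to t. *)
Lemma jackson_cvg (G : R -> C) (B t : R) : 0 < t < 1 ->
  (forall s, 0 <= s <= 1 -> nrm (G s) <= B) ->
  (forall e : R, 0 < e -> exists2 d : R, 0 < d & forall s, `|s - t| < d -> nrm (G s - G t) <= e) ->
  tends (fun n => jackson n.+1 (fun p => G (p%:R / n.+2%:R)) (circle_exp t)) (G t).
Proof.
move=> /andP[t0 t1] GB Gc e e0.
have e2 : 0 < e / 2 by rewrite divr_gt0.
have [d d0 hd] := Gc _ e2.
(* For s in [0, 1] with |s - t| >= d this gives m <= |t - s| <= 1 - m, hence a squared chord of at
   least c. *)
pose m := Num.min (Num.min d (1 / 2)) (Num.min t (1 - t)).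
have m0 : 0 < m by rewrite !lt_min d0 t0 subr_gt0 t1 divr_gt0.
have m1 : m <= d by rewrite /m !ge_min lexx.
have m2 : m <= 1 / 2 by rewrite /m !ge_min lexx !orbT.
have m3 : m <= t by rewrite /m !ge_min lexx !orbT.
have m4 : m <= 1 - t by rewrite /m !ge_min lexx !orbT.
have m5 : 0 < m <= 1 / 2 by rewrite m0.
pose c := 2 - 2 * cos (2 * pi * m).
have c0 : 0 < c by rewrite /c; have := cos_lt1 m5; lra.
have B0 : 0 <= B by apply: le_trans (nrm_ge0 _) (GB 0 _); rewrite lexx ler01.
pose K := 2 * B / c.
have K0 : 0 <= K by rewrite divr_ge0 ?mulr_ge0 // ltW.
have key n (p : nat) : (p < n.+2)%N -> nrm (G (p%:R / n.+2%:R) - G t) <=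
    e / 2 + K * cdist (circle_exp t) (node R n.+1 p) ^+ 2.
  move=> pn; rewrite /node; set s : R := p%:R / n.+2%:R.
  have s0 : 0 <= s by rewrite divr_ge0.
  have s1 : s <= 1 by rewrite ler_pdivrMr ?ltr0n // mul1r ler_nat ltnW.
  have [sd|sd] := ltP `|s - t| d.
    by apply: le_trans (hd _ sd) _; rewrite lerDl mulr_ge0 ?sqr_ge0.
  apply: le_trans (_ : 2 * B <= _).
    apply: le_trans (ler_nrmB _ _) _.
    have i1 : nrm (G s) <= B by apply: GB; rewrite s0.
    have i2 : nrm (G t) <= B by apply: GB; rewrite !ltW.
    lra.
  apply: le_trans (_ : K * c <= _); first by rewrite /K divfK // gt_eqF.
  apply: le_trans (_ : K * cdist (circle_exp t) (circle_exp s) ^+ 2 <= _); last first.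
    by rewrite lerDr ltW.
  rewrite ler_wpM2l // cdist_exp /c.
  suff : cos (2 * pi * (t - s)) <= cos (2 * pi * m) by lra.
  rewrite -[cos (_ * (t - s))]cos_norm normrM ger0_norm; last first.
    by rewrite mulr_ge0 // pi_ge0.
  apply: cos_far => //; rewrite distrC; apply/andP; split; first exact: le_trans sd.
  rewrite ler_norml; lra.
exists (Num.trunc (4 * K / e)) => n hn.
apply: le_lt_trans (@jackson_dist R n.+1 (fun p => G (p%:R / n.+2%:R)) (circle_exp t) (G t)
  (e / 2) K isT (key n) K0) _.
have p0 : 0 <= 4 * K / e by apply: divr_ge0; [exact: mulr_ge0|exact: ltW].
have /andP[_] := trunc_itv p0; rewrite ltr_pdivrMr // => h.
have h2 : (Num.trunc (4 * K / e)).+1%:R <= n.+1%:R :> R by rewrite ler_nat.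
have : K * (2 / n.+1%:R) < e / 2.
  rewrite mulrA ltr_pdivrMr ?ltr0n //.
  have : (Num.trunc (4 * K / e)).+1%:R * e <= n.+1%:R * e by rewrite ler_wpM2r // ltW.
  by move=> /(lt_le_trans h); move: (n.+1%:R : R) => x; lra.
by move=> h3; rewrite [ltRHS]splitr ltrD2l.
Qed.

Lemma nrm_jackson n (v : nat -> C) z (B : R) : (forall p, (p < n.+2)%N -> nrm (v p) <= B) ->
  nrm (jackson n.+1 v z) <= B.
Proof.
move=> vB.
have h p : (p < n.+2)%N -> nrm (v p - 0) <= B + 0 * cdist z (node R n.+1 p) ^+ 2.
  by move=> /vB; rewrite subr0 mul0r addr0.
by have := @jackson_dist R n.+1 v z 0 B 0 isT h (lexx 0); rewrite subr0 mul0r addr0.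
Qed.

(** The real and imaginary parts are replaced by continuous a and b on [0, 1]. The Jackson sums of G
    = a + i b are bounded trigonometric polynomials converging to G inside the interval, so
    dominated convergence applies. Two steps for each of two parts cost e/4 each. *)
Lemma L1norm_trig_dense f : L1_circle f -> forall e : R, 0 < e ->
  exists r, L1norm (f - trig r) <= e.
Proof.
move=> [fr fi] e e0; have e4 : 0 < e / 4 by rewrite divr_gt0.
have [a [ac ha]] := rintegrable_approx fr e4.
have [b [bc hb]] := rintegrable_approx fi e4.
pose G t : C := (a t +i* b t)%C.
have cont_bounded (h : R -> R) : continuous h -> exists B, forall s, 0 <= s <= 1 -> `|h s| <= B.
  move=> hc; have hn : continuous (fun s => `|h s|).
    by move=> s; apply: (@continuous_comp _ _ _ h Num.norm); [exact: hc|exact: norm_continuous].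
  have [c _ hc'] := EVT_max (ler01 : (0 : R) <= 1) (continuous_subspaceT hn).
  by exists `|h c| => s s01; apply: hc'; rewrite in_itv.
have [Ba hBa] := cont_bounded a ac; have [Bb hBb] := cont_bounded b bc.
have GB s : 0 <= s <= 1 -> nrm (G s) <= Ba + Bb.
  by move=> s01; apply: le_trans (nrm_le_ReIm _) _; rewrite lerD ?hBa ?hBb.
pose J n t := jackson n.+1 (fun p => G (p%:R / n.+2%:R)) (circle_exp t).
have JB n t : nrm (J n t) <= Ba + Bb.
  apply: nrm_jackson => p pn; apply: GB.
  by rewrite divr_ge0 //= ler_pdivrMr ?ltr0n // mul1r ler_nat ltnW.
have Jt t : 0 < t < 1 -> tends (fun n => J n t) (G t).
  move=> t01; apply: jackson_cvg t01 GB _ => d d0.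
  have d2 : 0 < d / 2 by rewrite divr_gt0.
  have /cvgrPdist_lt /(_ _ d2) /nbhs_ballP[d1 /= d10 h1] := ac t.
  have /cvgrPdist_lt /(_ _ d2) /nbhs_ballP[d3 /= d30 h3] := bc t.
  exists (Num.min d1 d3) => [|s]; first by rewrite lt_min d10.
  rewrite lt_min distrC => /andP[s1 s3].
  have := h1 s; rewrite -ball_normE /= => /(_ s1) i1.
  have := h3 s; rewrite -ball_normE /= => /(_ s3) i3.
  apply: le_trans (nrm_le_ReIm _) _ => /=.
  rewrite distrC in i1; rewrite distrC in i3; lra.
pose r n := sval (cid (@jackson_trig R n.+1 (fun p => G (p%:R / n.+2%:R)))).
have hr n : jackson n.+1 (fun p => G (p%:R / n.+2%:R)) = trig (r n).
  exact (svalP (cid (@jackson_trig R n.+1 (fun p => G (p%:R / n.+2%:R))))).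
have JE n t : J n t = trig (r n) (circle_exp t) by rewrite /J hr.
have Jc n := continuous_circle_path (p := @circle_exp R) (@C_circle_trig R (r n)) (fun s t => lexx _).
have re_c n : continuous (fun t => complex.Re (J n t)).
  by have [h _] := Jc n; under eq_fun do rewrite JE.
have im_c n : continuous (fun t => complex.Im (J n t)).
  by have [_ h] := Jc n; under eq_fun do rewrite JE.
have cvgP (u : nat -> R) (l : R) : (forall d, 0 < d -> exists N, forall n, (N <= n)%N ->
    `|u n - l| < d) -> u @ \oo --> l.
  move=> h; apply/cvgrPdist_lt => d /h[N hN]; exists N => // n /= /hN; by rewrite distrC.
have cre t : 0 < t < 1 -> (fun n => complex.Re (J n t)) @ \oo --> a t.
  move=> /Jt ht; apply: cvgP => d /ht[N hN]; exists N => n /hN; apply: le_lt_trans.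
  by rewrite -[a t]/(complex.Re (G t)) -raddfB; exact: Re_le_nrm.
have cim t : 0 < t < 1 -> (fun n => complex.Im (J n t)) @ \oo --> b t.
  move=> /Jt ht; apply: cvgP => d /ht[N hN]; exists N => n /hN; apply: le_lt_trans.
  by rewrite -[b t]/(complex.Im (G t)) -raddfB; exact: Im_le_nrm.
have [N1 hN1] := rint_dominated re_c ac
  (fun n t _ => le_trans (Re_le_nrm _) (JB n t)) cre e4.
have [N2 hN2] := rint_dominated im_c bc
  (fun n t _ => le_trans (Im_le_nrm _) (JB n t)) cim e4.
pose n := maxn N1 N2; exists (r n).
have i1 := hN1 n (leq_maxl _ _); have i2 := hN2 n (leq_maxr _ _).
have sub_int (u v : R -> R) : rintegrable u -> rintegrable v ->
    rintegrable (fun t => `|u t - v t|).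
  move=> ui vi; apply: rintegrable_norm.
  have := rintegrableD ui (rintegrableZ (-1) vi); congr (is_true (rintegrable _)).
  by apply/funext => t; rewrite mulN1r.
have ai := rintegrable_continuous ac; have bi := rintegrable_continuous bc.
have ri := rintegrable_continuous (re_c n); have ii := rintegrable_continuous (im_c n).
have fa := sub_int _ _ fr ai; have fb := sub_int _ _ fi bi.
have ja := sub_int _ _ ri ai; have jb := sub_int _ _ ii bi.
apply: le_trans (_ : rint (fun t => (`|complex.Re (f (circle_exp t)) - a t| +
   `|complex.Im (f (circle_exp t)) - b t|) + (`|complex.Re (J n t) - a t| +
   `|complex.Im (J n t) - b t|)) <= _).
  apply: ler_rint => [||t].
  - apply: cintegrable_norm.
    have := cintegrable_comb (-1) (cintegrable_circle (@C_circle_trig R (r n))) (conj fr fi).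
    congr cintegrable; apply/funext => t.
    by rewrite mulN1r addrC.
  - by apply: rintegrableD; apply: rintegrableD.
  - rewrite -[(f - trig (r n)) _]/(f _ - trig (r n) _) -JE !raddfB /=.
    have h1 := ler_normB (complex.Re (f (circle_exp t)) - a t) (complex.Re (J n t) - a t).
    have h2 := ler_normB (complex.Im (f (circle_exp t)) - b t) (complex.Im (J n t) - b t).
    rewrite opprB addrA subrK in h1; rewrite opprB addrA subrK in h2.
    lra.
rewrite rintD; [|by apply: rintegrableD..].
rewrite (rintD fa fb) (rintD ja jb); lra.
Qed.

End TrigonometricDensity.

(** * Weyl equidistribution and the Fejer kernel *)

Section WeylMeans.
Variables (R : realType) (theta : R).
Hypothesis irr : irrational theta.
Local Notation T := (circle R).
Local Notation C := R[i].
Implicit Types (z w : T) (f g h p : T -> C) (j k : int).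

Lemma wmeanE p N g z : wmean theta p N g z =
  N%:R^-1 * \sum_(t < N) p (circle_exp (t%:R * theta)) * rotation theta (- t%:Z) g z.
Proof. by rewrite /wmean fct_scaleE fct_sumE. Qed.

Lemma lin_on_C_wmean p N : lin_on_C (wmean theta p N).
Proof.
move=> c g h _ _; apply/funext => z.
rewrite -[RHS]/(c * wmean theta p N g z + wmean theta p N h z) !wmeanE mulrCA -mulrDr.
congr (_ * _); rewrite mulr_sumr -big_split; apply: eq_bigr => t _.
by rewrite /rotation -[(c *: g + h) _]/(c * g _ + h _) mulrDr mulrCA.
Qed.

Lemma nrm_inv_nat N : nrm (N%:R^-1 : C) = N%:R^-1.
Proof.
by rewrite -(rmorph_nat (real_complex R)) -(fmorphV (real_complex R)) nrmC ger0_norm ?invr_ge0.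
Qed.

Lemma sup_bounded_wmean_chi k N : sup_bounded 1 (wmean theta (chi k) N).
Proof.
move=> g B _ gB z; rewrite mul1r wmeanE nrmM nrm_inv_nat.
have B0 : 0 <= B by apply: le_trans (nrm_ge0 _) (gB z).
have [->|N0] := posnP N; first by rewrite invr0 mul0r.
rewrite ler_pdivrMl ?ltr0n //; apply: le_trans (ler_nrm_sum _ _ _) _.
rewrite mulr_natl -[X in B *+ X]card_ord -sumr_const; apply: ler_sum => t _.
by rewrite nrmM nrm_chi mul1r; exact: gB.
Qed.

Lemma lin_on_C_convolution f : L1_circle f -> lin_on_C (convolution f).
Proof. by move=> fL c g h gC hC; exact: convolution_combr. Qed.

Lemma sup_bounded_convolution f : L1_circle f -> sup_bounded (2 * L1norm f) (convolution f).
Proof. by move=> fL g B gC gB z; rewrite mulrAC; exact: nrm_convolution. Qed.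

Lemma sup_bounded_le (M M' : R) (L : (T -> C) -> T -> C) :
  M <= M' -> sup_bounded M L -> sup_bounded M' L.
Proof.
move=> MM' LM g B gC gB z; apply: le_trans (LM g B gC gB z) _.
by rewrite ler_wpM2r // (le_trans (nrm_ge0 _) (gB z)).
Qed.

Lemma L1_circle_chi k : L1_circle (chi k : T -> C).
Proof. exact (L1_circle_C (@C_circle_chi R k)). Qed.

Lemma weyl_chi k g : C_circle g ->
  utends (fun N => wmean theta (chi k) N g) (convolution (chi k) g).
Proof.
have L := L1norm_ge0 (chi k : T -> C).
apply: (@utends_ext R (wmean theta (chi k)) _ (1 + 2 * L1norm (chi k : T -> C))).
- by rewrite addr_ge0 ?mulr_ge0.
- exact: lin_on_C_wmean.
- exact: lin_on_C_convolution (L1_circle_chi k).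
- by move=> N; apply: sup_bounded_le (@sup_bounded_wmean_chi k N); rewrite lerDl mulr_ge0.
- by apply: sup_bounded_le (sup_bounded_convolution (L1_circle_chi k)); rewrite lerDr.
- by move=> j; rewrite convolution_chi; exact: wmean_chi.
Qed.

Lemma utends_comb (c : C) (F G : nat -> T -> C) g h : utends F g -> utends G h ->
  utends (fun n => c *: F n + G n) (c *: g + h).
Proof.
move=> Fg Gh e e0; have e2 : 0 < e / 2 by rewrite divr_gt0.
have e3 : 0 < e / 2 / (nrm c + 1) by rewrite divr_gt0 // ltr_wpDl ?nrm_ge0.
have [N1 h1] := Fg _ e3; have [N2 h2] := Gh _ e2.
exists (maxn N1 N2) => n; rewrite geq_max => /andP[/h1 i1 /h2 i2] z.
rewrite -[(c *: F n + G n) z]/(c * F n z + G n z) -[(c *: g + h) z]/(c * g z + h z).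
rewrite opprD addrACA -mulrBr; apply: le_trans (ler_nrmD _ _) _; rewrite nrmM.
have := i2 z; have := i1 z; rewrite ler_pdivlMr ?ltr_wpDl ?nrm_ge0 // => j1 j2.
have : nrm c * nrm (F n z - g z) <= e / 2.
  apply: le_trans j1; rewrite mulrC ler_wpM2l ?nrm_ge0 //; lra.
lra.
Qed.

Lemma utends_cst g : utends (fun=> g) g.
Proof. by move=> e e0; exists 0%N => n _ z; rewrite subrr nrm0 ltW. Qed.

Lemma convolution0l g : convolution (0 : T -> C) g = 0.
Proof.
apply/funext => z; rewrite /convolution.
rewrite (_ : (fun t : R => _) = fun=> 0); last by apply/funext => t; rewrite mul0r.
by rewrite /cintegral -!/(rint _) !rint_cst.
Qed.

Lemma convolution_trig r g : C_circle g ->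
  convolution (trig r) g = \sum_(x <- r) x.1 *: convolution (chi x.2) g.
Proof.
move=> gC; rewrite trigE; elim: r => [|x r IH].
  by rewrite !big_nil convolution0l.
rewrite !big_cons convolution_combl ?IH //; first exact: L1_circle_chi.
by apply: L1_circle_C; have := @C_circle_trig R r; rewrite trigE.
Qed.

Lemma weyl_trig r g : C_circle g ->
  utends (fun N => wmean theta (trig r) N g) (convolution (trig r) g).
Proof.
move=> gC; rewrite convolution_trig //.
have -> : (fun N => wmean theta (trig r) N g) =
    fun N => \sum_(x <- r) x.1 *: wmean theta (chi x.2) N g.
  apply/funext => N; apply/funext => z; rewrite wmeanE fct_sumE.
  under [RHS]eq_bigr do rewrite fct_scaleE wmeanE mulrCA.
  rewrite -mulr_sumr; congr (_ * _).
  under [RHS]eq_bigr do rewrite mulr_sumr.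
  rewrite exchange_big; apply: eq_bigr => t _.
  by rewrite /trig mulr_suml; apply: eq_bigr => x _; rewrite mulrA.
elim: r => [|x r IH].
  by rewrite big_nil; under eq_fun do rewrite big_nil; exact: utends_cst.
rewrite big_cons; under eq_fun do rewrite big_cons.
by apply: utends_comb => //; exact: weyl_chi.
Qed.

Lemma chi_one k : chi k (circle_exp 0) = 1 :> C.
Proof. by rewrite chi_exp_real mulr0 cval_exp mulr0 cos0 sin0. Qed.

(** Both sides are bounded and linear in g and agree on characters; [utends_ext] for a constant
    sequence then forces equality. *)
Lemma convolution_chi_rank1 k g : C_circle g ->
  convolution (chi k) g = convolution (chi k) g (circle_exp 0) *: chi k.
Proof.
move=> gC; have kL := L1_circle_chi k.
pose L h := convolution (chi k) h (circle_exp 0) *: (chi k : T -> C).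
have L0 := L1norm_ge0 (chi k : T -> C).
have linL : lin_on_C L.
  move=> c h h' hC hC'; rewrite /L convolution_combr //.
  by rewrite -[(c *: _ + _) _]/(c * _ + _) scalerDl scalerA.
have U : utends (fun=> convolution (chi k) g) (L g).
  apply: (@utends_ext R (fun=> convolution (chi k)) L (2 * L1norm (chi k : T -> C))) => //.
  - by rewrite mulr_ge0.
  - by move=> n; exact: lin_on_C_convolution.
  - by move=> n; exact: sup_bounded_convolution.
  - by move=> h B hC hB z; rewrite nrmM nrm_chi mulr1; exact: sup_bounded_convolution.
  - move=> j; rewrite /L convolution_chi fct_scaleE chi_one mulr1.
    exact: utends_cst.
apply/funext => z; apply/eqP; rewrite -subr_eq0; apply/eqP/nrm_eq0.
apply/eqP; rewrite eq_le nrm_ge0 andbT; apply/ler_addgt0Pr => e /U[N hN].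
by rewrite add0r; exact: hN N (leqnn N) z.
Qed.

(** Means and integral are encoded as operators with constant functions as values, which brings the
    statement under [utends_ext]. *)
Lemma mean_cvg g : C_circle g -> tends
  (fun N => N%:R^-1 * \sum_(t < N) g (circle_exp (t%:R * theta)))
  (cintegral (fun t => g (circle_exp t))).
Proof.
move=> gC.
pose F N h : T -> C := fun=> N%:R^-1 * \sum_(t < N) h (circle_exp (t%:R * theta)).
pose L h : T -> C := fun=> cintegral (fun t => h (circle_exp t)).
have U : utends (F^~ g) (L g).
  apply: (@utends_ext R F L 2) => //.
  - move=> n c h h' _ _; apply/funext => z.
    rewrite -[RHS]/(c * F n h z + F n h' z) /F mulrCA -mulrDr; congr (_ * _).
    by rewrite mulr_sumr -big_split.
  - move=> c h h' hC hC'; apply/funext => z.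
    rewrite -[RHS]/(c * L h z + L h' z) /L -cintegral_comb //; exact: cintegrable_circle.
  - move=> n h B _ hB z; rewrite nrmM nrm_inv_nat.
    have B0 : 0 <= B by apply: le_trans (nrm_ge0 _) (hB z).
    have [->|N0] := posnP n; first by rewrite invr0 mul0r mulr_ge0.
    rewrite ler_pdivrMl ?ltr0n //; apply: le_trans (ler_nrm_sum _ _ _) _.
    apply: (@le_trans _ _ (\sum_(t < n) B)); first by apply: ler_sum => t _; exact: hB.
    by rewrite sumr_const card_ord -[leLHS]mulr_natl ler_wpM2l // ler_peMl // ler1n.
  - move=> h B hC hB z; have hi := cintegrable_circle hC.
    apply: le_trans (nrm_cintegral hi) _; rewrite /norm1 -[leRHS](@rint_cst R).
    apply: ler_rint => [||t]; first exact: cintegrable_norm.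
      by apply: rintegrable_continuous; exact: cst_continuous.
    have := hB (circle_exp t); have := Re_le_nrm (h (circle_exp t)).
    have := Im_le_nrm (h (circle_exp t)); lra.
  (* Applied to the constant function [chi 0], the Weyl mean with weight [chi k] is the sampling
     mean of [chi k]. *)
  - move=> k; have := @wmean_chi R theta k 0 irr.
    move=> W e /W[N hN]; exists N => n Nn z; have := hN n Nn (circle_exp 0).
    rewrite wmeanE fct_scaleE chi_one mulr1 /F /L.
    rewrite (_ : cintegral _ = (k == 0)%:R); last first.
      rewrite -cintegral_exp; congr cintegral; apply/funext => t; exact: chi_exp_real.
    under eq_bigr => t _ do rewrite (_ : rotation theta (- t%:Z) (chi 0) _ = 1) // mulr1.
    by [].
move=> e e0; have e2 : 0 < e / 2 by rewrite divr_gt0.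
have [N hN] := U _ e2; exists N => n /hN /(_ (circle_exp 0)).
move=> h; apply: le_lt_trans h _; lra.
Qed.

(** The function |Re p| + |Im p| is continuous, dominates the modulus and has integral [L1norm p],
    so equidistribution applies to it. *)
Lemma mean_nrm_le p : C_circle p -> forall e : R, 0 < e -> exists N0, forall N, (N0 <= N)%N ->
  N%:R^-1 * \sum_(t < N) nrm (p (circle_exp (t%:R * theta))) <= L1norm p + e.
Proof.
move=> pC e e0.
pose q z : C := (`|complex.Re (p z)| + `|complex.Im (p z)|)%:C%C.
have qC : C_circle q.
  apply/C_circleP => z d d0; have d2 : 0 < d / 2 by rewrite divr_gt0.
  have [d1 d10 hd] := (C_circleP p).1 pC z _ d2; exists d1 => // w /hd h.
  rewrite /q -(rmorphB (real_complex R)) nrmC.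
  have h1 := Re_le_nrm (p w - p z); have h2 := Im_le_nrm (p w - p z).
  rewrite !raddfB /= in h1 h2.
  have := ler_dist_dist (complex.Re (p w)) (complex.Re (p z)).
  have := ler_dist_dist (complex.Im (p w)) (complex.Im (p z)).
  rewrite !ler_norml ltr_norml; lra.
have [N0 h0] := mean_cvg qC e0; exists N0 => N /h0 h.
have E : N%:R^-1 * \sum_(t < N) q (circle_exp (t%:R * theta)) = 
   (N%:R^-1 * \sum_(t < N) (`|complex.Re (p (circle_exp (t%:R * theta)))| +
     `|complex.Im (p (circle_exp (t%:R * theta)))|))%:C%C.
  by rewrite (rmorphM (real_complex R)) (fmorphV (real_complex R)) (rmorph_sum (real_complex R)) rmorph_nat.
have I : cintegral (fun t => q (circle_exp t)) = (L1norm p)%:C%C.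
  by rewrite /cintegral /= -!/(rint _) rint_cst.
rewrite E I -(rmorphB (real_complex R)) nrmC in h.
apply: le_trans (_ : N%:R^-1 * \sum_(t < N) (`|complex.Re (p (circle_exp (t%:R * theta)))| +
     `|complex.Im (p (circle_exp (t%:R * theta)))|) <= _).
  rewrite ler_wpM2l ?invr_ge0 //; apply: ler_sum => t _; exact: nrm_le_ReIm.
by move: h; rewrite ltr_norml; lra.
Qed.

Definition fejer (n : nat) z : C :=
  (n%:R^-1)%:C%C * (\sum_(a < n) \sum_(b < n) chi (a%:Z - b%:Z) z).

Lemma fejerE n : fejer n = trig [seq ((n%:R^-1)%:C%C, x.1%:Z - x.2%:Z) |
  x <- [seq (a, b) | a <- iota 0 n, b <- iota 0 n]].
Proof.
apply/funext => z; rewrite /trig big_map big_allpairs_dep /=.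
rewrite /fejer mulr_sumr -(big_mkord xpredT (fun a => (n%:R^-1)%:C%C *
  \sum_(b < n) chi (a%:Z - b%:Z) z)) /= /index_iota subn0; apply: eq_bigr => a _.
rewrite mulr_sumr -(big_mkord xpredT (fun b => (n%:R^-1)%:C%C * chi (a%:Z - b%:Z) z)) /=.
by rewrite /index_iota subn0.
Qed.

Lemma fejer_ge0 n z : exists2 x : R, 0 <= x & fejer n z = x%:C%C.
Proof.
exists (n%:R^-1 * nrm (\sum_(a < n) chi a%:Z z) ^+ 2); first by rewrite mulr_ge0 ?sqr_ge0 ?invr_ge0.
rewrite (_ : (_ * _)%:C%C = (n%:R^-1)%:C%C * (nrm (\sum_(a < n) chi a%:Z z) ^+ 2)%:C%C); last exact: rmorphM.
rewrite /fejer -mul_conj; congr (_ * _).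
rewrite conj_sum mulr_suml; apply: eq_bigr => a _.
by rewrite mulr_sumr; apply: eq_bigr => b _; rewrite -chiN -chiD.
Qed.

Lemma C_circle_fejer n : C_circle (fejer n).
Proof. rewrite fejerE; exact (@C_circle_trig R _). Qed.

Lemma convolution_fejerE n g : C_circle g -> convolution (fejer n) g =
  (n%:R^-1)%:C%C *: \sum_(a < n) \sum_(b < n) convolution (chi (a%:Z - b%:Z)) g.
Proof.
move=> gC; rewrite fejerE convolution_trig // big_map big_allpairs_dep /= scaler_sumr.
rewrite -(big_mkord xpredT (fun a => (n%:R^-1)%:C%C *:
    \sum_(b < n) convolution (chi (a%:Z - b%:Z)) g)) /= /index_iota subn0; apply: eq_bigr => a _.
rewrite scaler_sumr -(big_mkord xpredT (fun b => (n%:R^-1)%:C%C *: convolution (chi (a%:Z - b%:Z)) g)) /=.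
by rewrite /index_iota subn0.
Qed.

Lemma convolution_fejer_chi n j : convolution (fejer n) (chi j) = (fej R n j)%:C%C *: chi j.
Proof.
rewrite convolution_fejerE; last exact (@C_circle_chi R j).
apply/funext => z; rewrite !fct_scaleE /fej (rmorphM (real_complex R)) -mulrA; congr (_ * _).
rewrite fct_sumE (rmorph_sum (real_complex R)) mulr_suml; apply: eq_bigr => a _.
rewrite fct_sumE (rmorph_sum (real_complex R)) mulr_suml; apply: eq_bigr => b _.
by rewrite convolution_chi fct_scaleE rmorph_nat; case: eqP => [->|_]; rewrite ?mul0r.
Qed.

Lemma cintegral_fejer n : (0 < n)%N -> cintegral (fun t => fejer n (circle_exp t)) = 1.
Proof.
move=> n0; have := convolution_fejer_chi n 0.
move=> /(congr1 (fun f : T -> C => f (circle_exp 0))); rewrite fct_scaleE chi0 mulr1.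
rewrite /convolution; under eq_fun do rewrite chi0 mulr1.
move=> ->; congr (_%:C)%C; apply/eqP; rewrite eq_le fej_le1 /=.
by have := fej_lower R 0 n0; rewrite absz0 mul0r subr0.
Qed.

(** The kernel is nonnegative, so |Re| + |Im| is the kernel itself and its integral is the
    coefficient at frequency 0. *)
Lemma L1norm_fejer n : (0 < n)%N -> L1norm (fejer n) = 1.
Proof.
move=> n0; have := cintegral_fejer n0; rewrite /cintegral => -[<- _].
rewrite /L1norm /norm1 -/(rint _); congr rint; apply/funext => t.
by have [x x0 ->] := fejer_ge0 n (circle_exp t); rewrite /= normr0 addr0 ger0_norm.
Qed.

Lemma fejer_cvg g : C_circle g -> utends (fun n => convolution (fejer n.+1) g) g.
Proof.
have L n := L1norm_fejer (ltn0Sn n); have fL n := L1_circle_C (@C_circle_fejer n.+1).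
apply: (@utends_ext R (fun n => convolution (fejer n.+1)) id 2) => //.
- by move=> n; exact: lin_on_C_convolution.
- by move=> n; have := sup_bounded_convolution (fL n); rewrite L mulr1.
- by move=> h B hC hB z; apply: le_trans (hB z) _; have := nrm_ge0 (h z); have := hB z; lra.
- move=> k e e0; have [N hN] := fej_tends k e0; exists N => n Nn z.
  rewrite convolution_fejer_chi fct_scaleE -[X in _ - X]mul1r -mulrBl nrmM nrm_chi mulr1.
  rewrite -(rmorph1 (real_complex R)) -(rmorphB (real_complex R)) nrmC.
  have := hN n.+1 (leqW Nn); have := fej_le1 R n.+1 k; rewrite ler_norml; lra.
Qed.

End WeylMeans.

(** Closes estimates made with [nrm_sqrD]: t is fixed first to make t P small, then the error d is
    taken small against 1 + 1/t. *)
Lemma ler_two_eps (R : realType) (L P Q : R) : 0 <= P -> 0 <= Q ->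
  (forall t d, 0 < t -> 0 < d -> L <= (1 + t) * P + (1 + t^-1) * (d * Q)) -> L <= P.
Proof.
move=> P0 Q0 h; apply/ler_addgt0Pr => e e0.
pose t := e / (2 * (P + 1)).
have P1 : 0 < 2 * (P + 1) by rewrite mulr_gt0 // ltr_wpDl.
have t0 : 0 < t by rewrite divr_gt0.
have s0 : 0 < 1 + t^-1 by rewrite addr_gt0 // invr_gt0.
have Q1 : 0 < (1 + t^-1) * (Q + 1) by rewrite mulr_gt0 // ltr_wpDl.
pose d := e / 2 / ((1 + t^-1) * (Q + 1)).
have d0 : 0 < d by rewrite !divr_gt0.
apply: le_trans (h t d t0 d0) _.
have h1 : t * (2 * (P + 1)) = e by rewrite /t divfK // gt_eqF.
have h2 : d * ((1 + t^-1) * (Q + 1)) = e / 2 by rewrite /d divfK // gt_eqF.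
have h3 : 0 < d * (1 + t^-1) by rewrite mulr_gt0.
move: h2 h3; move: (1 + t^-1) => s h2 h3.
have : d * (s * (Q + 1)) = s * (d * Q) + d * s by ring.
rewrite h2 => h4.
have : (1 + t) * P = P + t * (2 * (P + 1)) / 2 - t by field.
rewrite h1; lra.
Qed.

(** * Inner products and scalar matrices acting on Hilbert space vectors *)

Section InnerProduct.
Variables (R : realType) (H : completeNormedModType R[i]).
Variables (dot : {dot H for Num.conj}).
Hypothesis hdot : hilbert_dot dot.
Local Notation C := R[i].
Implicit Types (u v w : H).

Lemma dot_nrm v : dot v v = (nrm v ^+ 2)%:C%C.
Proof. by rewrite -hdot nrmE -[RHS]/((real_complex R) _) rmorphXn. Qed.

Lemma dotC u v : dot u v = (dot v u)^*.
Proof. by rewrite hermC expr0 mul1r. Qed.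

Lemma dotDl u v w : dot (u + v) w = dot u w + dot v w.
Proof. exact: linearDl. Qed.

Lemma dotZl (c : C) u v : dot (c *: u) v = c * dot u v.
Proof. exact: linearZl_LR. Qed.

Lemma dotDr u v w : dot w (u + v) = dot w u + dot w v.
Proof. exact: linearDr. Qed.

Lemma dotZr (c : C) u v : dot u (c *: v) = c^* * dot u v.
Proof. by rewrite dotC dotZl conjM -dotC. Qed.

Lemma dot0l u : dot 0 u = 0.
Proof. exact: linear0l. Qed.

Lemma dot_suml (I : Type) (r : seq I) (F : I -> H) v :
  dot (\sum_(i <- r) F i) v = \sum_(i <- r) dot (F i) v.
Proof.
elim: r => [|i r IH]; first by rewrite !big_nil dot0l.
by rewrite !big_cons dotDl IH.
Qed.

Lemma nrm_orthogonal u v : dot v u = 0 -> nrm (u + v) ^+ 2 = nrm u ^+ 2 + nrm v ^+ 2.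
Proof.
move=> vu; have uv : dot u v = 0 by rewrite dotC vu; exact: rmorph0.
apply: (@complexI R); rewrite -dot_nrm dotDl !dotDr uv vu addr0 add0r !dot_nrm.
by rewrite -[RHS]/((real_complex R) _) rmorphD.
Qed.

(* Gram-Schmidt: the span of v embeds isometrically in some C^p. *)
Lemma gram_factor m (v : 'I_m -> H) : exists p (B : 'I_m -> 'I_p -> C),
  forall a : 'I_m -> C, nrm (\sum_(j < m) a j *: v j) ^+ 2 =
    \sum_(l < p) nrm (\sum_(j < m) a j * B j l) ^+ 2.
Proof.
elim: m v => [|m IH] v.
  exists 0%N, (fun _ _ => 0) => a; rewrite !big_ord0 nrm0 expr0n.
  by [].
pose v0 := v ord0.
(* The coefficient of the projection onto v0. If v0 is 0 the quotient is 0 by convention and the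
   orthogonality below is trivial. *)
pose c j := dot (v (lift ord0 j)) v0 / (nrm v0 ^+ 2)%:C%C.
pose v' j := v (lift ord0 j) - c j *: v0.
have orth j : dot (v' j) v0 = 0.
  rewrite /v' -scaleNr dotDl dotZl dot_nrm mulNr /c.
  have [v00|v00] := eqVneq (nrm v0) 0.
    have -> : v0 = 0 by exact: nrm_eq0.
    by rewrite dotC dot0l nrm0 expr0n mulr0 subr0; exact: rmorph0.
  rewrite divfK ?subrr //; apply/eqP => /complexI /eqP; rewrite sqrf_eq0; exact/negP.
have [p [B' hB']] := IH v'.
exists p.+1, (fun i l => if unlift ord0 l is Some l' then
    (if unlift ord0 i is Some j then B' j l' else 0)
  else (if unlift ord0 i is Some j then c j * (nrm v0)%:C%C else (nrm v0)%:C%C)).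
move=> a; rewrite [RHS]big_ord_recl unlift_none.
have -> : \sum_(j < m.+1) a j *: v j =
    (a ord0 + \sum_(j < m) a (lift ord0 j) * c j) *: v0 + \sum_(j < m) a (lift ord0 j) *: v' j.
  rewrite big_ord_recl scalerDl -addrA; congr (_ + _).
  rewrite scaler_suml -big_split; apply: eq_bigr => j _ /=.
  by rewrite /v' scalerBr scalerA addrC subrK.
rewrite nrm_orthogonal; last first.
  rewrite dot_suml big1 // => j _.
  by rewrite dotZl dotZr orth !mulr0.
congr (_ + _).
  rewrite [in RHS]big_ord_recl unlift_none.
  under [in RHS]eq_bigr do rewrite liftK mulrA.
  by rewrite -mulr_suml -mulrDl nrmM nrmC ger0_norm ?nrm_ge0 // nrmZ.
rewrite hB'; apply: eq_bigr => l _; rewrite liftK [in RHS]big_ord_recl unlift_none mulr0 add0r.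
by congr (nrm _ ^+ 2); apply: eq_bigr => j _; rewrite liftK.
Qed.

Definition scbd (k : R) m (c : 'I_m -> 'I_m -> C) := forall b : 'I_m -> C,
  \sum_(i < m) nrm (\sum_(j < m) c i j * b j) ^+ 2 <= k ^+ 2 * \sum_(j < m) nrm (b j) ^+ 2.

(** In coordinates for the span of the v j, the scalar bound is applied to each coordinate
    separately and the results are added. *)
Lemma scbd_vector (k : R) m (c : 'I_m -> 'I_m -> C) (v : 'I_m -> H) : scbd k c ->
  \sum_(i < m) nrm (\sum_(j < m) c i j *: v j) ^+ 2 <= k ^+ 2 * \sum_(j < m) nrm (v j) ^+ 2.
Proof.
move=> kc; have [p [B hB]] := gram_factor v.
under eq_bigr do rewrite hB.
have -> : \sum_(j < m) nrm (v j) ^+ 2 = \sum_(j < m) \sum_(l < p) nrm (B j l) ^+ 2.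
  apply: eq_bigr => j _.
  have := hB (fun i => (i == j)%:R).
  rewrite (bigD1 j) //= eqxx scale1r big1 ?addr0 => [->|i /negbTE ->]; last by rewrite scale0r.
  apply: eq_bigr => l _; congr (nrm _ ^+ 2).
  by rewrite (bigD1 j) //= eqxx mul1r big1 ?addr0 // => i /negbTE ->; rewrite mul0r.
rewrite exchange_big [X in _ * X]exchange_big mulr_sumr; apply: ler_sum => l _.
exact: kc.
Qed.

End InnerProduct.

(** * Faithful representations of C(T): positivity and unit *)

Section Representation.
Variables (R : realType) (H : completeNormedModType R[i]).
Variables (dot : {dot H for Num.conj}) (rho : (circle R -> R[i]) -> H -> H).
Hypotheses (hdot : hilbert_dot dot) (hrho : faithful_rep dot rho).
Local Notation T := (circle R).
Local Notation C := R[i].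
Implicit Types (a b : T -> C) (u v w : H).

Lemma rhoD a b v : C_circle a -> C_circle b -> rho (a + b) v = rho a v + rho b v.
Proof. by move=> aC bC; rewrite -[a]scale1r (rep_linear hrho 1 aC bC) !scale1r. Qed.

Lemma rho0 v : rho 0 v = 0.
Proof.
have := rhoD v (@C_circle0 R) (@C_circle0 R); rewrite addr0 => /eqP.
by rewrite -subr_eq subrr eq_sym => /eqP.
Qed.

Lemma rhoZ (c : C) a v : C_circle a -> rho (c *: a) v = c *: rho a v.
Proof.
move=> aC; rewrite -[c *: a]addr0 (rep_linear hrho c aC (@C_circle0 R)).
by rewrite -[LHS]/(c *: rho a v + rho 0 v) rho0 addr0.
Qed.

Lemma rhoB a b v : C_circle a -> C_circle b -> rho (a - b) v = rho a v - rho b v.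
Proof.
by move=> aC bC; rewrite -scaleN1r (rhoD v aC (C_circleZ bC)) (rhoZ _ v bC) scaleN1r.
Qed.

Lemma rho_sum (I : Type) (r : seq I) (F : I -> T -> C) v :
  (forall i, C_circle (F i)) -> rho (\sum_(i <- r) F i) v = \sum_(i <- r) rho (F i) v.
Proof.
move=> FC; elim: r => [|i r IH]; first by rewrite !big_nil rho0.
by rewrite !big_cons (rhoD v (FC i) (@C_circle_sum R _ r F FC)) IH.
Qed.

Lemma rho_vecD a v w : C_circle a -> rho a (v + w) = rho a v + rho a w.
Proof. by move=> /(rep_bounded hrho)[l _]; have := l 1 v w; rewrite !scale1r. Qed.

Lemma rho_vec0 a : C_circle a -> rho a 0 = 0.
Proof.
move=> aC; have := rho_vecD 0 0 aC; rewrite addr0 => /eqP.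
by rewrite -subr_eq subrr eq_sym => /eqP.
Qed.

Lemma rho_vecZ a (c : C) v : C_circle a -> rho a (c *: v) = c *: rho a v.
Proof.
move=> aC; have [l _] := rep_bounded hrho aC.
by have := l c v 0; rewrite !addr0 (rho_vec0 aC) addr0.
Qed.

Lemma rho_vecB a v w : C_circle a -> rho a (v - w) = rho a v - rho a w.
Proof. by move=> aC; rewrite -scaleN1r (rho_vecD _ _ aC) (rho_vecZ _ _ aC) scaleN1r. Qed.

Lemma rho_vec_sum (I : Type) (r : seq I) (F : I -> H) a : C_circle a ->
  rho a (\sum_(i <- r) F i) = \sum_(i <- r) rho a (F i).
Proof.
move=> aC; elim: r => [|i r IH]; first by rewrite !big_nil rho_vec0.
by rewrite !big_cons (rho_vecD _ _ aC) IH.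
Qed.

Lemma rhoM a b v : C_circle a -> C_circle b -> rho (fun z => a z * b z) v = rho a (rho b v).
Proof. by move=> aC bC; rewrite (rep_mul hrho aC bC). Qed.

Lemma rho_nrm_sqr a v : C_circle a ->
  (nrm (rho a v) ^+ 2)%:C%C = dot (rho (fun z => (nrm (a z) ^+ 2)%:C%C) v) v.
Proof.
move=> aC; rewrite -(dot_nrm hdot).
have -> : (fun z => (nrm (a z) ^+ 2)%:C%C) = fun z => (a z)^* * a z.
  by apply/funext => z; rewrite -mul_conj mulrC.
by rewrite (rhoM _ (C_circle_conj aC) aC) (rep_adjoint hrho _ _ aC).
Qed.

Lemma C_circle_nrm_sqr a : C_circle a -> C_circle (fun z => (nrm (a z) ^+ 2)%:C%C).
Proof.
move=> aC; have -> : (fun z => (nrm (a z) ^+ 2)%:C%C) = fun z => a z * (a z)^*.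
  by apply/funext => z; rewrite -mul_conj.
exact (C_circleM aC (C_circle_conj aC)).
Qed.

(* The difference of the two sums is a square in the algebra, hence positive. *)
Lemma rho_dominated p q (a : 'I_p -> T -> C) (b : 'I_q -> T -> C) v :
  (forall i, C_circle (a i)) -> (forall i, C_circle (b i)) ->
  (forall z, \sum_(i < p) nrm (a i z) ^+ 2 <= \sum_(i < q) nrm (b i z) ^+ 2) ->
  \sum_(i < p) nrm (rho (a i) v) ^+ 2 <= \sum_(i < q) nrm (rho (b i) v) ^+ 2.
Proof.
move=> aC bC ab.
pose sa : T -> C := \sum_(i < p) (fun z => (nrm (a i z) ^+ 2)%:C%C).
pose sb : T -> C := \sum_(i < q) (fun z => (nrm (b i z) ^+ 2)%:C%C).
have saC : C_circle sa.
  exact (@C_circle_sum R _ _ _ (fun i => C_circle_nrm_sqr (aC i))).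
have sbC : C_circle sb.
  exact (@C_circle_sum R _ _ _ (fun i => C_circle_nrm_sqr (bC i))).
pose r z := \sum_(i < q) nrm (b i z) ^+ 2 - \sum_(i < p) nrm (a i z) ^+ 2.
have r0 z : 0 <= r z by rewrite subr_ge0.
have rE : (fun z => (r z)%:C%C) = sb - sa.
  apply/funext => z; rewrite /r -[LHS]/((real_complex R) _) rmorphB.
  by rewrite -[RHS]/(sb z - sa z) /sa /sb !fct_sumE !rmorph_sum.
have rC : C_circle (fun z => (r z)%:C%C) by rewrite rE; exact (C_circle_sub sbC saC).
have sC := C_circle_sqrt r0 rC.
have := rho_nrm_sqr v sC.
have -> : (fun z => (nrm (Num.sqrt (r z))%:C%C ^+ 2)%:C%C) = sb - sa.
  rewrite -rE; apply/funext => z; rewrite nrmC ger0_norm ?sqrtr_ge0 // sqr_sqrtr //.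
rewrite (rhoB v sbC saC) /sa /sb.
rewrite (rho_sum _ v (fun i => C_circle_nrm_sqr (aC i))).
rewrite (rho_sum _ v (fun i => C_circle_nrm_sqr (bC i))).
rewrite -scaleN1r dotDl dotZl !dot_suml mulN1r.
under eq_bigr do rewrite -(rho_nrm_sqr _ (bC _)).
under [X in _ - X]eq_bigr do rewrite -(rho_nrm_sqr _ (aC _)).
rewrite -!(rmorph_sum (real_complex R)) -(rmorphB (real_complex R)) => /complexI.
by have := sqr_ge0 (nrm (rho (fun z => (Num.sqrt (r z))%:C%C) v)); move=> ? E; rewrite -subr_ge0 -E.
Qed.

(** The image of 1 is an orthogonal projection, hence a contraction, and it fixes every rho a w. By
    nondegeneracy these vectors span a dense subspace. *)
Lemma rho_1 v : rho (fun=> 1) v = v.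
Proof.
have c1 : C_circle (fun _ : T => 1 : C) := @C_circle_cst R 1.
have id1 w : rho (fun=> 1) (rho (fun=> 1) w) = rho (fun=> 1) w.
  rewrite -(rhoM w c1 c1); congr (rho _ w); apply/funext => z; exact: mulr1.
have le1 w : nrm (rho (fun=> 1) w) <= nrm w.
  have o : dot (w - rho (fun=> 1) w) (rho (fun=> 1) w) = 0.
    rewrite -(rep_adjoint hrho _ _ c1).
    rewrite (_ : (fun z : T => (1 : C)^*) = fun=> 1); last by apply/funext => z; exact: rmorph1.
    by rewrite (rho_vecB _ _ c1) id1 subrr dot0l.
  have := nrm_orthogonal hdot o; rewrite addrC subrK => e.
  rewrite -(@ler_pXn2r _ 2) ?nnegrE ?nrm_ge0 // e lerDl; exact: sqr_ge0.
apply/eqP; rewrite -subr_eq0; apply/eqP/nrm_eq0/eqP; rewrite eq_le nrm_ge0 andbT.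
apply/ler_addgt0Pr => e e0; rewrite add0r.
have e2 : 0 < (e / 2)%:C%C :> C by rewrite ltcR divr_gt0.
have [k [a [w [aC]]]] := rep_nondegenerate hrho v e2.
rewrite nrmE ltcR; set s := \sum_(l < k) _ => h.
have sE : rho (fun=> 1) s = s.
  rewrite /s (rho_vec_sum _ _ c1); apply: eq_bigr => l _; rewrite -(rhoM _ c1 (aC l)); congr (rho _ _).
  by apply/funext => z; rewrite mul1r.
have -> : rho (fun=> 1) v - v = rho (fun=> 1) (v - s) - (v - s).
  by rewrite (rho_vecB _ _ c1) sE opprB addrA subrK.
apply: le_trans (ler_nrmB _ _) _; have := le1 (v - s); lra.
Qed.

Lemma rho_cst (c : C) v : rho (fun=> c) v = c *: v.
Proof.
rewrite -[in RHS](rho_1 v) -(rhoZ _ _ (@C_circle_cst R 1)).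
by congr (rho _ v); apply/funext => z; rewrite fct_scaleE mulr1.
Qed.

Lemma nrm_rho_le a (B : R) v : C_circle a -> (forall z, nrm (a z) <= B) ->
  nrm (rho a v) <= B * nrm v.
Proof.
move=> aC aB; have B0 : 0 <= B by apply: le_trans (nrm_ge0 _) (aB (circle_exp 0)).
have := @rho_dominated 1 1 (fun=> a) (fun=> fun=> B%:C%C) v (fun=> aC)
  (fun=> @C_circle_cst R _).
rewrite !big_ord1 rho_cst nrmZ nrmC ger0_norm // => h.
rewrite -(@ler_pXn2r _ 2) ?nnegrE ?nrm_ge0 ?mulr_ge0 ?nrm_ge0 //; apply: h => z.
by rewrite !big_ord1 ler_pXn2r ?nnegrE ?nrm_ge0.
Qed.

End Representation.

(** * Matrix norms over C(T) as suprema of scalar norms *)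

Section MatrixNorms.
Variables (R : realType) (H : completeNormedModType R[i]).
Variables (dot : {dot H for Num.conj}) (rho : (circle R -> R[i]) -> H -> H).
Hypotheses (hdot : hilbert_dot dot) (hrho : faithful_rep dot rho).
Local Notation T := (circle R).
Local Notation C := R[i].
Implicit Types (a b : T -> C) (u v : H).

Definition alg_bd (c : R) m (x : 'I_m -> 'I_m -> T -> C) := 0 <= c /\
  forall v : 'I_m -> H, \sum_(i < m) nrm (\sum_(j < m) rho (x i j) (v j)) ^+ 2
    <= c ^+ 2 * \sum_(j < m) nrm (v j) ^+ 2.

Lemma sum_sqrD m (t : R) (u w : 'I_m -> H) : 0 < t ->
  \sum_(i < m) nrm (u i + w i) ^+ 2 <=
    (1 + t) * (\sum_(i < m) nrm (u i) ^+ 2) + (1 + t^-1) * (\sum_(i < m) nrm (w i) ^+ 2).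
Proof.
by move=> t0; rewrite !mulr_sumr -big_split; apply: ler_sum => i _; exact: nrm_sqrD.
Qed.

Lemma nrm_sqr_sumv m (w : 'I_m -> H) :
  nrm (\sum_(j < m) w j) ^+ 2 <= m%:R * \sum_(j < m) nrm (w j) ^+ 2.
Proof.
apply: le_trans (nrm_sqr_sum _).
by rewrite ler_sqr ?nnegrE ?nrm_ge0 ?sumr_ge0 ?ler_nrm_sum // => j _; exact: nrm_ge0.
Qed.

(* Vectors of the form rho h u with h concentrated near z see x as the
   scalar matrix x z. *)
Lemma alg_bd_pointwise (c : R) m (x : 'I_m -> 'I_m -> T -> C) :
  (forall i j, C_circle (x i j)) -> alg_bd c x ->
  forall z, scbd c (fun i j => x i j z).
Proof.
move=> xC [c0 h] z b.
set S := \sum_(j < m) nrm (b j) ^+ 2.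
have S0 : 0 <= S by apply: sumr_ge0 => j _; exact: sqr_ge0.
have m0 : 0 <= m%:R * (m%:R * S) :> R by rewrite !mulr_ge0.
apply: (@ler_two_eps R _ _ (m%:R * (m%:R * S))); rewrite ?mulr_ge0 ?sqr_ge0 //.
move=> t d t0 d0.
have e0 : 0 < Num.sqrt d by rewrite sqrtr_gt0.
have [r [r0 hr]] : exists r : R, 0 < r /\ forall i j (w : T), cdist w z < r ->
    nrm (x i j w - x i j z) <= Num.sqrt d.
  have hij i j : exists r : R, 0 < r /\ forall w : T, cdist w z < r ->
      nrm (x i j w - x i j z) <= Num.sqrt d.
    have [r r0 hr] := (C_circleP _).1 (xC i j) z _ e0.
    by exists r; split=> // w /hr /ltW.
  pose f i j := sval (cid (hij i j)).
  have hf i j := svalP (cid (hij i j)).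
  exists (\big[Num.min/1]_(i < m) \big[Num.min/1]_(j < m) f i j); split.
    apply: (big_ind (fun y => 0 < y)) => // [y1 y2 h1 h2|i _]; first by rewrite lt_min h1.
    apply: (big_ind (fun y => 0 < y)) => // [y1 y2 h1 h2|j _]; first by rewrite lt_min h1.
    by have [] := hf i j.
  move=> i j w hw; have [_ hf'] := hf i j; apply: hf'; apply: lt_le_trans hw _.
  rewrite (bigD1 i) //= (bigD1 j) //=; by rewrite !ge_min lexx.
(* A hat function with k z = 1 that vanishes at distance r and more from z, where the entries of x
   are no longer controlled. *)
pose k (w : T) : R := Num.max 0 (1 - r^-1 * cdist w z).
have kC : C_circle (fun w => (k w)%:C%C).
  apply/C_circleP => w e e1; exists (e * r) => [|y yw]; first exact: mulr_gt0.
  rewrite -(rmorphB (real_complex R)) nrmC.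
  have l : `|k y - k w| <= `|(1 - r^-1 * cdist y z) - (1 - r^-1 * cdist w z)|.
    rewrite /k; move: (1 - r^-1 * cdist y z) (1 - r^-1 * cdist w z) => A B.
    rewrite !maxEle; case: (leP 0 A) => hA; case: (leP 0 B) => hB; rewrite ?subrr ?normr0 //.
    - by rewrite subr0 ger0_norm // ger0_norm; lra.
    - by rewrite sub0r normrN ger0_norm // ler0_norm; lra.
  apply: le_lt_trans l _.
  rewrite opprB addrC addrA subrK -mulrBr normrM gtr0_norm ?invr_gt0 //.
  rewrite ltr_pdivrMl // [ltRHS]mulrC; apply: le_lt_trans yw.
  have h1 := cdist_trans y w z; have h2 := cdist_trans w y z.
  rewrite (cdistC w y) in h2; rewrite ler_norml; lra.
have kz : k z = 1.
  by rewrite /k /cdist subrr nrm0 mulr0 subr0 maxEle ler01.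
(* Faithfulness enters here: k is not the zero function, so neither is its image. *)
have [u hu] : exists u, 0 < nrm (rho (fun w => (k w)%:C%C) u).
  apply/not_existsP => nh.
  have := rep_injective hrho kC (@C_circle0 R) => /(_ _) E.
  have /E /(congr1 (fun f : T -> C => f z)) : rho (fun w => (k w)%:C%C) = rho 0.
    apply/funext => u; rewrite (rho0 hrho); apply/nrm_eq0/eqP.
    by rewrite eq_le nrm_ge0 andbT leNgt; apply/negP; exact: nh.
  by rewrite kz => /eqP; rewrite -[X in _ == X]/0 oner_eq0.
set v := rho _ u in hu.
have err i j : nrm (rho (x i j) v - x i j z *: v) <= Num.sqrt d * nrm v.
  have aC : C_circle (fun w => (x i j w - x i j z) * (k w)%:C%C).
    exact (C_circleM (C_circle_sub (xC i j) (@C_circle_cst R (x i j z))) kC).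
  have -> : rho (x i j) v - x i j z *: v =
      rho (fun w => (x i j w - x i j z) * (k w)%:C%C) u.
    rewrite (rhoM hrho _ (C_circle_sub (xC i j) (@C_circle_cst R (x i j z))) kC).
    rewrite (rhoB hrho _ (xC i j) (@C_circle_cst R (x i j z))).
    by rewrite (rho_cst hdot hrho).
  have := @rho_dominated R H dot rho hdot hrho 1 1
    (fun=> fun w => (x i j w - x i j z) * (k w)%:C%C)
    (fun=> (Num.sqrt d)%:C%C *: (fun w => (k w)%:C%C)) u (fun=> aC) (fun=> C_circleZ kC).
  rewrite !big_ord1 (rhoZ hrho _ _ kC) nrmZ nrmC (ger0_norm (ltW e0)) -/v => h1.
  rewrite -(@ler_pXn2r _ 2) ?nnegrE ?nrm_ge0 ?mulr_ge0 ?nrm_ge0 ?(ltW e0) //.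
  apply: h1 => w; rewrite !big_ord1 -[(_ *: _) w]/(_ * _) !nrmM.
  rewrite ler_pXn2r ?nnegrE ?mulr_ge0 ?nrm_ge0 // nrmC [X in _ <= X * _]nrmC (ger0_norm (ltW e0)).
  have [wr|wr] := ltP (cdist w z) r; first by rewrite ler_wpM2r ?normr_ge0 // hr.
  have -> : k w = 0.
    have k0 : 1 - r^-1 * cdist w z <= 0 by rewrite subr_le0 ler_pdivlMl // mulr1.
    rewrite /k maxEle; case: ifP => // k1; apply/eqP; rewrite eq_le k0; exact: k1.
  by rewrite normr0 !mulr0.
have := h (fun j => b j *: v).
have -> : \sum_(j < m) nrm (b j *: v) ^+ 2 = S * nrm v ^+ 2.
  by rewrite mulr_suml; apply: eq_bigr => j _; rewrite nrmZ exprMn.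
move=> hv.
have v2 : 0 < nrm v ^+ 2 by rewrite exprn_gt0.
rewrite -(ler_pM2r v2).
have -> : (\sum_(i < m) nrm (\sum_(j < m) x i j z * b j) ^+ 2) * nrm v ^+ 2 =
    \sum_(i < m) nrm (\sum_(j < m) rho (x i j) (b j *: v) +
       \sum_(j < m) b j *: (x i j z *: v - rho (x i j) v)) ^+ 2.
  rewrite mulr_suml; apply: eq_bigr => i _; rewrite -exprMn -nrmZ; congr (nrm _ ^+ 2).
  rewrite -big_split scaler_suml; apply: eq_bigr => j _ /=.
  by rewrite (rho_vecZ hrho _ _ (xC i j)) scalerBr addrC subrK scalerA mulrC.
apply: le_trans (sum_sqrD _ _ t0) _; rewrite [leRHS]mulrDl; apply: lerD.
  by rewrite -[leRHS]mulrA ler_wpM2l ?addr_ge0 ?(ltW t0) // -mulrA.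
rewrite -mulrA ler_wpM2l ?addr_ge0 ?invr_ge0 ?(ltW t0) //.
apply: (@le_trans _ _ (\sum_(i < m) m%:R * (S * (d * nrm v ^+ 2)))).
  apply: ler_sum => i _; apply: le_trans (nrm_sqr_sumv _) _; rewrite ler_wpM2l //.
  rewrite /S mulr_suml; apply: ler_sum => j _; rewrite nrmZ exprMn ler_wpM2l ?sqr_ge0 //.
  rewrite nrmB -[d in leRHS](sqr_sqrtr (ltW d0)) -exprMn.
  by rewrite ler_pXn2r ?nnegrE ?mulr_ge0 ?nrm_ge0 ?(ltW e0).
by rewrite sumr_const card_ord -[leLHS]mulr_natl; lra.
Qed.

Lemma sum_hpart n (z : T) : (0 < n)%N -> \sum_(p < n.+1) nrm (hpart n p z) ^+ 2 = 1.
Proof. exact: wpart_sum1. Qed.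

(** Squaring e + K c^2 with the chord c at most 2 gives at most 2 e^2 + 8 K^2 c^2. Here 2 e^2 = d/2,
    and the second moment bound 2/n makes the rest at most d/2 once n >= 32 K^2 / d. *)
Lemma oscillation a : C_circle a -> forall d : R, 0 < d -> exists N, forall n, (N < n)%N ->
  forall z, \sum_(p < n.+1) nrm ((a z - a (node R n p)) * hpart n p z) ^+ 2 <= d.
Proof.
move=> aC d d0; pose e := Num.sqrt (d / 4).
have d40 : 0 < d / 4 by rewrite divr_gt0.
have e0 : 0 < e by rewrite sqrtr_gt0.
have e2 : e ^+ 2 = d / 4 by rewrite sqr_sqrtr // ltW.
have [K [K0 hK]] := C_circle_modulus aC e0.
exists (Num.trunc (32 * K ^+ 2 / d)).+1 => n Nn z.
have n0 : (0 < n)%N by exact: leq_trans Nn.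
apply: (@le_trans _ _ (\sum_(p < n.+1) (2 * e ^+ 2 * wpart n p z +
    8 * K ^+ 2 * (wpart n p z * cdist z (node R n p) ^+ 2)))).
  apply: ler_sum => p _; rewrite nrmM exprMn -/(wpart n p z).
  have h1 := hK z (node R n p); have h2 := nrm_ge0 (a z - a (node R n p)).
  have w0 := wpart_ge0 n p z.
  have c0 : 0 <= cdist z (node R n p) by exact: nrm_ge0.
  have c2 : cdist z (node R n p) <= 2.
    by apply: le_trans (ler_nrmB _ _) _; rewrite !nrm_cval; lra.
  move: (cdist z (node R n p)) (nrm _) h1 h2 c0 c2 => c q h1 h2 c0 c2.
  have q2 : q ^+ 2 <= 2 * e ^+ 2 + 8 * K ^+ 2 * c ^+ 2.
    have : q ^+ 2 <= (e + K * c ^+ 2) ^+ 2.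
      by rewrite ler_pXn2r ?nnegrE // (le_trans h2).
    have := sqr_ge0 (e - K * c ^+ 2).
    have : (K * c) ^+ 2 * c ^+ 2 <= (K * c) ^+ 2 * 4.
      by rewrite ler_wpM2l ?sqr_ge0 //; nra.
    have -> : (K * c) ^+ 2 * c ^+ 2 = (K * c ^+ 2) ^+ 2 by ring.
    have -> : (K * c) ^+ 2 * 4 = 4 * K ^+ 2 * c ^+ 2 by ring.
    move: (K * c ^+ 2) (K ^+ 2 * c ^+ 2) => y w; nra.
  have := ler_wpM2l w0 q2; rewrite mulrC.
  by move=> hh; apply: le_trans hh _; rewrite le_eqVlt; apply/orP; left; apply/eqP; ring.
rewrite big_split /= -!mulr_sumr wpart_sum1 // mulr1 e2.
have K8 : 0 <= 8 * K ^+ 2 by rewrite mulr_ge0 ?sqr_ge0.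
have h1 := ler_wpM2l K8 (wpart_dist z n0).
have p0 : 0 <= 32 * K ^+ 2 / d by rewrite divr_ge0 ?mulr_ge0 ?sqr_ge0 ?(ltW d0).
have /andP[_] := trunc_itv p0; rewrite ltr_pdivrMr // => h2.
have h3 : (Num.trunc (32 * K ^+ 2 / d)).+1%:R <= n%:R :> R by rewrite ler_nat ltnW.
have n1 : 0 < n%:R :> R by rewrite ltr0n.
have h4 : 8 * K ^+ 2 * (2 / n%:R) <= d / 2.
  rewrite mulrA ler_pdivrMr //.
  by have := ler_wpM2r (ltW d0) h3; move: (n%:R : R) n1 => y y0; lra.
lra.
Qed.

(** The operators rho (hpart n p) form a column isometry, as their square moduli sum to 1. On the
    p-th component x acts as the scalar matrix of its values at the p-th node, up to a weighted
    oscillation that is small for large n. With [alg_bd_pointwise] this makes matrix norms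
    independent of [rho]. *)
Lemma pointwise_alg_bd (c : R) m (x : 'I_m -> 'I_m -> T -> C) : 0 <= c ->
  (forall i j, C_circle (x i j)) -> (forall z, scbd c (fun i j => x i j z)) -> alg_bd c x.
Proof.
move=> c0 xC h; split=> // v.
set S := \sum_(j < m) nrm (v j) ^+ 2.
have S0 : 0 <= S by apply: sumr_ge0 => j _; exact: sqr_ge0.
apply: (@ler_two_eps R _ _ (m%:R * (m%:R * S))); rewrite ?mulr_ge0 ?sqr_ge0 //.
move=> t d t0 d0.
have [N hN] : exists N, forall i j n, (N < n)%N ->
    forall z, \sum_(p < n.+1) nrm ((x i j z - x i j (node R n p)) * hpart n p z) ^+ 2 <= d.
  pose f i j := sval (cid (oscillation (xC i j) d0)).
  have hf i j := svalP (cid (oscillation (xC i j) d0)).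
  exists (\max_(i < m) \max_(j < m) f i j)%N => i j n hn; apply: hf.
  apply: leq_ltn_trans hn; apply: leq_trans (leq_bigmax i).
  exact: (leq_bigmax (F := f i) j).
have eq_refl_le (p q : R) : p = q -> p <= q by move=> ->.
pose n := N.+1; have n0 : (0 < n)%N by [].
have hC p : C_circle (hpart n p : T -> C) := @C_circle_hpart R n p.
have part w : \sum_(p < n.+1) nrm (rho (hpart n p) w) ^+ 2 = nrm w ^+ 2.
  apply/eqP; rewrite eq_le.
  have E z : \sum_(p < n.+1) nrm (hpart n p z) ^+ 2 = \sum_(i < 1) nrm ((fun=> 1 : C) z) ^+ 2.
    by rewrite sum_hpart // big_ord1 nrm1 expr1n.
  have c1 : 'I_1 -> C_circle (fun _ : T => 1 : C) := fun=> @C_circle_cst R 1.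
  have le1 := @rho_dominated _ _ _ _ hdot hrho n.+1 1 (fun p => hpart n p) (fun=> fun=> 1) w
    (fun p => hC p) c1 (fun z => eq_refl_le _ _ (E z)).
  have le2 := @rho_dominated _ _ _ _ hdot hrho 1 n.+1 (fun=> fun=> 1) (fun p => hpart n p) w
    c1 (fun p => hC p) (fun z => eq_refl_le _ _ (esym (E z))).
  by rewrite !big_ord1 !(rho_1 hdot hrho) in le1 le2; rewrite le1 le2.
pose y p j := rho (hpart n p) (v j).
pose g i j p (z : T) := (x i j z - x i j (node R n p)) * hpart n p z.
have gC i j p : C_circle (g i j p).
  exact (C_circleM (C_circle_sub (xC i j) (@C_circle_cst R (x i j (node R n p)))) (hC p)).
(* The algebra is commutative, so hpart moves past x; splitting off the value at the node leaves the
   oscillation g. *)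
have Y i p : rho (hpart n p) (\sum_(j < m) rho (x i j) (v j)) =
    \sum_(j < m) x i j (node R n p) *: y p j + \sum_(j < m) rho (g i j p) (v j).
  rewrite (rho_vec_sum hrho _ _ (hC p)) -big_split; apply: eq_bigr => j _ /=.
  rewrite -(rhoM hrho _ (hC p) (xC i j)) /y -(rhoZ hrho _ _ (hC p)).
  rewrite -(rhoD hrho _ (C_circleZ (hC p)) (gC i j p)); congr (rho _ (v j)).
  apply/funext => z; rewrite -[RHS]/(x i j (node R n p) * hpart n p z + g i j p z) /g.
  by rewrite mulrBl addrC subrK mulrC.
under eq_bigr do rewrite -part.
rewrite exchange_big /=.
apply: (@le_trans _ _ (\sum_(p < n.+1) ((1 + t) * (c ^+ 2 * \sum_(j < m) nrm (y p j) ^+ 2) +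
   (1 + t^-1) * (m%:R * \sum_(i < m) \sum_(j < m) nrm (rho (g i j p) (v j)) ^+ 2)))).
  apply: ler_sum => p _; under eq_bigr do rewrite Y.
  apply: le_trans (sum_sqrD _ _ t0) _; apply: lerD.
    rewrite ler_wpM2l ?addr_ge0 ?(ltW t0) //.
    exact (scbd_vector hdot (y p) (h (node R n p))).
  rewrite ler_wpM2l ?addr_ge0 ?invr_ge0 ?(ltW t0) // mulr_sumr.
  by apply: ler_sum => i _; exact: nrm_sqr_sumv.
rewrite big_split /= -!mulr_sumr; apply: lerD.
  rewrite ler_wpM2l ?addr_ge0 ?(ltW t0) // ler_wpM2l ?sqr_ge0 //.
  rewrite exchange_big /=; apply: ler_sum => j _; by rewrite part.
rewrite ler_wpM2l ?addr_ge0 ?invr_ge0 ?(ltW t0) //.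
rewrite [leRHS]mulrCA ler_wpM2l // exchange_big /=.
apply: (@le_trans _ _ (\sum_(i < m) d * S)); last first.
  by rewrite sumr_const card_ord -[leLHS]mulr_natl mulrCA.
apply: ler_sum => i _; rewrite exchange_big /= mulr_sumr; apply: ler_sum => j _.
have := @rho_dominated _ _ _ _ hdot hrho n.+1 1 (fun p => g i j p)
  (fun=> fun=> (Num.sqrt d)%:C%C) (v j) (fun p => gC i j p) (fun=> @C_circle_cst R _).
rewrite !big_ord1 (rho_cst hdot hrho) nrmZ nrmC ger0_norm ?sqrtr_ge0 // exprMn.
rewrite sqr_sqrtr ?(ltW d0) //; apply => z.
exact: hN.
Qed.

(** No unitary of H needs to implement the rotation: pointwise, rotating only permutes the scalar
    matrices over which the supremum is taken. *)
Lemma alg_bd_rotate (c : R) m (x : 'I_m -> 'I_m -> T -> C) (w : T) :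
  (forall i j, C_circle (x i j)) -> alg_bd c x ->
  alg_bd c (fun i j z => x i j (circle_mul w z)).
Proof.
move=> xC cx; apply: pointwise_alg_bd; first by case: cx.
- by move=> i j; exact (C_circle_rot (xC i j)).
- by move=> z; have := alg_bd_pointwise xC cx (circle_mul w z).
Qed.

End MatrixNorms.

(** * Multiplier bounds on finitely supported functions *)

Section FiniteMultipliers.
Variables (R : realType) (H : completeNormedModType R[i]).
Variables (dot : {dot H for Num.conj}) (rho : (circle R -> R[i]) -> H -> H) (theta : R).
Hypotheses (hdot : hilbert_dot dot) (hrho : faithful_rep dot rho).
Local Notation T := (circle R).
Local Notation C := R[i].
Local Notation A := (T -> C).
Local Notation op := (@l2op R H).
Local Notation rot := (rotation theta).
Implicit Types (a b : A) (F G : int -> A -> A).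

(* [pi_tilde] of the truncation of f to [-N, N]. *)
Definition pf (N : nat) (f : int -> A) : op :=
  fun xi t => win N (fun s => rho (rot (- t) (f s)) (xi (t - s))).

Definition presC F := forall s a, C_circle a -> C_circle (F s a).

(* The bound is only required on finitely supported functions; [Mbd] below is the
   same bound on l1. *)
Definition mbd (M : R) F := 0 <= M /\ forall m (f : 'M[int -> A]_m) (N : nat) (c : R),
  (forall i j s, C_circle (f i j s)) ->
  opbd c (map_mx (pf N) f) -> opbd (M * c) (map_mx (fun g => pf N (multiply F g)) f).

Lemma rotationD j k a : rot j (rot k a) = rot (j + k) a.
Proof.
apply/funext => z; rewrite /rotation circle_mulA -circle_expD.
by congr (a (circle_mul (circle_exp _) z)); rewrite intrD mulrDl addrC.
Qed.

Lemma rotation0 a : rot 0 a = a.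
Proof. by apply/funext => z; rewrite /rotation mul0r circle_exp0. Qed.

Lemma pf_comb (c : C) N f g : (forall s, C_circle (f s)) -> (forall s, C_circle (g s)) ->
  pf N (c *: f + g) = c *: pf N f + pf N g.
Proof.
move=> fC gC; apply/funext => xi; apply/funext => t.
rewrite -[RHS]/(c *: pf N f xi t + pf N g xi t) /pf -winZ -winD.
apply: eq_win => s _; rewrite -[rot (- t) _]/(c *: rot (- t) (f s) + rot (- t) (g s)).
have f1 : C_circle (rot (- t) (f s)) := C_circle_rotation (fC s).
have g1 : C_circle (rot (- t) (g s)) := C_circle_rotation (gC s).
by rewrite (rhoD hrho _ (C_circleZ f1) g1) (rhoZ hrho _ _ f1).
Qed.

Lemma eq_pf N f g : (forall s, (`|s| <= N)%N -> f s = g s) -> pf N f = pf N g.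
Proof.
by move=> fg; apply/funext => xi; apply/funext => t; apply: eq_win => s /fg ->.
Qed.

Lemma mbd_ext M F G : (forall s a, C_circle a -> F s a = G s a) -> mbd M F -> mbd M G.
Proof.
move=> FG [M0 h]; split=> // m f N c fC fc.
have -> : map_mx (fun g => pf N (multiply G g)) f = map_mx (fun g => pf N (multiply F g)) f.
  apply/matrixP => i j; rewrite !mxE; apply: eq_pf => s _.
  by rewrite /multiply (FG s _ (fC i j s)).
exact: h.
Qed.

Lemma mbd_le (M M' : R) F : M <= M' -> mbd M F -> mbd M' F.
Proof.
move=> MM' [M0 h]; split=> [|m f N c fC fc]; first exact: le_trans MM'.
by apply: opbd_le (h m f N c fC fc); rewrite ler_wpM2r // (opbd_ge0 fc).
Qed.

Lemma mbd_comb (c : C) (M M' : R) F G : presC F -> presC G -> mbd M F -> mbd M' G ->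
  mbd (nrm c * M + M') (fun s a => c *: F s a + G s a).
Proof.
move=> FC GC [M0 hF] [M0' hG]; split=> [|m f N k fC fk].
  by rewrite addr_ge0 ?mulr_ge0 ?nrm_ge0.
rewrite mulrDl -mulrA.
have -> : map_mx (fun g => pf N (multiply (fun s a => c *: F s a + G s a) g)) f =
    map_mx ( *:%R c) (map_mx (fun g => pf N (multiply F g)) f) +
    map_mx (fun g => pf N (multiply G g)) f.
  apply/matrixP => i j; rewrite !mxE -pf_comb //.
  - by move=> s; exact (FC s _ (fC i j s)).
  - by move=> s; exact (GC s _ (fC i j s)).
by apply: opbdD; [apply: opbdZ; exact: hF|exact: hG].
Qed.

Lemma mbd0 : mbd 0 (fun _ _ => 0).
Proof.
split=> // m f N c fC fc; rewrite mul0r.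
have -> : map_mx (fun g => pf N (multiply (fun _ _ => 0) g)) f = 0; last exact: opbd0.
apply/matrixP => i j; rewrite !mxE; apply/funext => xi; apply/funext => t.
rewrite -[RHS]/(0 : H) /pf (@eq_win _ _ _ (fun=> 0)) ?win0 // => s _.
by rewrite (_ : rot _ _ = 0) ?(rho0 hrho).
Qed.

Lemma mbd_sum (I : Type) (r : seq I) (c : I -> C) (M : I -> R) (F : I -> int -> A -> A) :
  (forall i, presC (F i)) -> (forall i, mbd (M i) (F i)) ->
  mbd (\sum_(i <- r) nrm (c i) * M i) (fun s a => \sum_(i <- r) c i *: F i s a).
Proof.
move=> FC FM; elim: r => [|i r IH].
  rewrite big_nil; apply: mbd_ext mbd0 => s a _; by rewrite big_nil.
rewrite big_cons.
have h := mbd_comb (c i) (FC i) _ (FM i) IH.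
apply: mbd_ext (h _) => [s a _|s a aC]; first by rewrite big_cons.
refine (@C_circle_sum R _ _ _ _) => k; exact (C_circleZ (FC k s a aC)).
Qed.

Lemma mbd_comp (M M' : R) F G : presC G -> mbd M F -> mbd M' G ->
  mbd (M * M') (fun s a => F s (G s a)).
Proof.
move=> GC [M0 hF] [M0' hG]; split=> [|m f N c fC fc]; first exact: mulr_ge0.
have := hF m (map_mx (multiply G) f) N (M' * c).
rewrite mulrA (_ : map_mx (fun g => pf N (multiply F g)) _ =
  map_mx (fun g => pf N (multiply (fun s a => F s (G s a)) g)) f); last first.
  by apply/matrixP => i j; rewrite !mxE.
apply; first by move=> i j s; rewrite mxE; exact (GC s _ (fC i j s)).
have := hG m f N c fC fc; rewrite (_ : map_mx (pf N) (map_mx (multiply G) f) =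
  map_mx (fun g => pf N (multiply G g)) f) //.
by apply/matrixP => i j; rewrite !mxE.
Qed.

Lemma l2bd_shift m (xi : 'I_m -> int -> H) K (n : int) : l2bd xi K ->
  l2bd (fun j r => xi j (r + n)) K.
Proof.
move=> xiK N; apply: le_trans (xiK (N + `|n|)%N); apply: ler_sum => j _.
exact: (@ler_win_shift R N (fun s => nrm (xi j s) ^+ 2) n (fun s => sqr_ge0 _)).
Qed.

(* Rotating the coefficients amounts to conjugating by a shift. *)
Lemma mbd_rotation n : mbd 1 (fun _ => rot n).
Proof.
split=> // m f N c fC [c0 h]; rewrite mul1r; split=> // xi K xiK k.
have := h _ K (l2bd_shift n xiK) (k + `|- n|)%N; apply: le_trans.
apply: ler_sum => i _.
apply: le_trans (@ler_win_shift R k (fun t => nrm ((\sum_(j < m) map_mx (pf N) f i j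
  (fun r => xi j (r + n))) t) ^+ 2) (- n) (fun t => sqr_ge0 _)).
rewrite le_eqVlt; apply/orP; left; apply/eqP; apply: eq_win => t _.
rewrite !fct_sumE /=; congr (nrm _ ^+ 2); apply: eq_bigr => j _; rewrite !mxE /pf.
apply: eq_win => s _; rewrite /multiply rotationD.
have -> : t - n - s + n = t - s by lia.
by have -> : - (t - n) = - t + n by lia.
Qed.

Lemma rho_tends (a : nat -> A) (b : A) v : (forall n, C_circle (a n)) -> C_circle b ->
  utends a b -> tends (fun n => rho (a n) v) (rho b v).
Proof.
move=> aC bC ab e e0.
have v1 : 0 < nrm v + 1 by rewrite ltr_wpDl ?nrm_ge0.
have e1 : 0 < e / 2 / (nrm v + 1) by rewrite !divr_gt0.
have [N hN] := ab _ e1; exists N => n /hN h.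
rewrite -(rhoB hrho _ (aC n) bC).
apply: le_lt_trans (nrm_rho_le hdot hrho _ (C_circle_sub (aC n) bC) h) _.
rewrite mulrAC ltr_pdivrMr //; have := nrm_ge0 v; nra.
Qed.

Lemma utends_rotation n (a : nat -> A) (b : A) : utends a b ->
  utends (fun k => rot n (a k)) (rot n b).
Proof. by move=> ab e /ab[N hN]; exists N => k /hN h z; exact: h. Qed.

Lemma tends_win (V : normedModType R[i]) N (u : nat -> int -> V) (l : int -> V) :
  (forall s, tends (fun n => u n s) (l s)) -> tends (fun n => win N (u n)) (win N l).
Proof. by move=> ul; apply: tends_sum => i; exact: ul. Qed.

(** Each [pf] sees finitely many coefficients, so convergence for each s and a is enough, with no
    uniformity in s; [opbd_lim] does the rest. *)
Lemma mbd_lim (M : R) (Fn : nat -> int -> A -> A) F : 0 <= M ->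
  (forall n, presC (Fn n)) -> presC F ->
  (forall s a, C_circle a -> utends (fun n => Fn n s a) (F s a)) ->
  (forall e, 0 < e -> exists N, forall n, (N <= n)%N -> mbd (M + e) (Fn n)) -> mbd M F.
Proof.
move=> M0 FnC FC FnF h; split=> // m f N c fC fc; have c0 := opbd_ge0 fc.
apply: (@opbd_lim R H m _ (fun n => map_mx (fun g => pf N (multiply (Fn n) g)) f)).
- exact: mulr_ge0.
- move=> i j xi _ t; rewrite mxE; under eq_fun do rewrite mxE.
  apply: tends_win => s; apply: rho_tends.
  + by move=> n; exact (C_circle_rotation (FnC n s _ (fC i j s))).
  + exact (C_circle_rotation (FC s _ (fC i j s))).
  + by apply: utends_rotation; exact: FnF.
- move=> e e0; have e1 : 0 < e / (c + 1) by rewrite divr_gt0 // ltr_wpDl.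
  have [K hK] := h _ e1; exists K => n /hK[_ /(_ m f N c fC fc)]; apply: opbd_le.
  rewrite mulrDl lerD2l mulrAC ler_pdivrMr ?ltr_wpDl // ler_wpM2l ?(ltW e0) //; lra.
Qed.

End FiniteMultipliers.

(** * Convolutions and coefficients of finitely supported vectors as multipliers *)

Section BasicMultipliers.
Variables (R : realType) (H : completeNormedModType R[i]).
Variables (dot : {dot H for Num.conj}) (rho : (circle R -> R[i]) -> H -> H) (theta : R).
Hypotheses (hdot : hilbert_dot dot) (hrho : faithful_rep dot rho) (irr : irrational theta).
Local Notation T := (circle R).
Local Notation C := R[i].
Local Notation A := (T -> C).
Local Notation rot := (rotation theta).
Local Notation mbd := (mbd rho theta).
Local Notation pf := (pf rho theta).
Implicit Types (a b : A) (F G : int -> A -> A).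

Lemma presC_rot n : presC (fun _ : int => rot n).
Proof. move=> s a aC; exact (C_circle_rotation aC). Qed.

Lemma presC_convolution (f : A) : L1_circle f -> presC (fun _ : int => convolution f).
Proof. move=> fL s a aC; exact (C_circle_convolution fL aC). Qed.

Lemma presC_wmean p N : presC (fun _ : int => wmean theta p N).
Proof.
move=> s a aC; refine (C_circleZ _); refine (@C_circle_sum R _ _ _ _) => t.
exact (C_circleZ (C_circle_rotation aC)).
Qed.

Lemma mbd_wmean p N :
  mbd (N%:R^-1 * \sum_(t < N) nrm (p (circle_exp (t%:R * theta)))) (fun _ => wmean theta p N).
Proof.
have h := @mbd_sum R H dot rho theta hrho 'I_N (index_enum 'I_N)
  (fun t => p (circle_exp (t%:R * theta))) (fun=> 1) (fun t _ => rot (- t%:Z))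
  (fun t => @presC_rot (- t%:Z)) (fun t => mbd_rotation rho theta (- t%:Z)).
have h0 := mbd0 theta hrho.
have := mbd_comb hrho (N%:R^-1 : C) _ (fun s a _ => @C_circle0 R) h h0.
move=> /(_ _) h2.
have -> : N%:R^-1 * \sum_(t < N) nrm (p (circle_exp (t%:R * theta))) =
   nrm (N%:R^-1 : C) * \sum_(t < N) nrm (p (circle_exp (t%:R * theta))) * 1 + 0.
  by rewrite addr0 nrm_inv_nat; congr (_ * _); apply: eq_bigr => t _; rewrite mulr1.
apply: mbd_ext (h2 _) => [s a _|]; first by rewrite addr0.
move=> s a aC; refine (@C_circle_sum R _ _ _ _) => t.
exact (C_circleZ (C_circle_rotation aC)).
Qed.

Lemma mbd_convolution_trig r : mbd (L1norm (trig r)) (fun _ => convolution (trig r)).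
Proof.
have rC := @C_circle_trig R r.
apply: (mbd_lim hdot hrho (Fn := fun N _ => wmean theta (trig r) N)).
- exact: L1norm_ge0.
- by move=> N; exact: presC_wmean.
- exact (presC_convolution (L1_circle_C rC)).
- by move=> _ a aC; exact: weyl_trig.
- move=> e e0; have [N hN] := mean_nrm_le irr rC e0; exists N => n /hN h.
  exact: mbd_le h (mbd_wmean _ _).
Qed.

Lemma L1_circle_sub (f g : A) : L1_circle f -> L1_circle g -> L1_circle (f - g).
Proof.
move=> fL gL; have -> : f - g = (-1 : C) *: g + f by rewrite scaleN1r addrC.
exact: L1_circle_comb.
Qed.

Lemma L1_circle_trig r : L1_circle (trig r : A).
Proof. exact (L1_circle_C (@C_circle_trig R r)). Qed.

Lemma convolution_subl (f g a : A) : L1_circle f -> L1_circle g -> C_circle a ->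
  convolution (f - g) a = convolution f a - convolution g a.
Proof.
move=> fL gL aC; have -> : f - g = (-1 : C) *: g + f by rewrite scaleN1r addrC.
by rewrite convolution_combl // scaleN1r addrC.
Qed.

Lemma L1norm_le_sub (f g : A) : L1_circle f -> L1_circle g ->
  L1norm g <= L1norm f + L1norm (f - g).
Proof.
move=> fL gL; have h := norm1D (h := fun t => f (circle_exp t))
  (k := fun t => (-1) * (f - g) (circle_exp t) + 0) fL.
have fg := L1_circle_sub fL gL.
have z0 : cintegrable (fun t : R => (0 : A) (circle_exp t)).
  exact (L1_circle_C (@C_circle0 R)).
have := h (cintegrable_comb (-1) fg z0).
have -> : norm1 (fun t => f (circle_exp t) + (-1 * (f - g) (circle_exp t) + 0)) = L1norm g.
  congr norm1; apply/funext => t; rewrite -[(f - g) _]/(f _ - g _); ring.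
congr (_ <= _ + _); rewrite /L1norm /norm1; congr rint; apply/funext => t.
by rewrite addr0 mulN1r !raddfN /= !normrN.
Qed.

Lemma convolution_cvg (f : A) (r : nat -> seq (C * int)) a : L1_circle f -> C_circle a ->
  (forall n, L1norm (f - trig (r n)) <= n.+1%:R^-1) ->
  utends (fun n => convolution (trig (r n)) a) (convolution f a).
Proof.
move=> fL aC hr e e0; have [B [B0 aB]] := C_circle_bounded aC.
exists (Num.trunc (2 * B / e)).+1 => n hn z.
have rL n' := L1_circle_trig (r n').
rewrite nrmB -[X in nrm X]/((convolution f a - convolution (trig (r n)) a) z).
rewrite -convolution_subl //.
apply: le_trans (nrm_convolution z (L1_circle_sub fL (rL n)) aC aB) _.
have p0 : 0 <= 2 * B / e by rewrite divr_ge0 ?mulr_ge0 // ltW.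
have /andP[_] := trunc_itv p0; rewrite ltr_pdivrMr // => h.
apply: le_trans (ler_wpM2l _ (hr n)) _; first by rewrite mulr_ge0.
rewrite ler_pdivrMr ?ltr0n //; apply: le_trans (ltW h) _.
by rewrite mulrC ler_wpM2l ?(ltW e0) // ler_nat (leq_trans hn).
Qed.

Lemma trig_approx (f : A) : L1_circle f ->
  exists r : nat -> seq (C * int), forall n, L1norm (f - trig (r n)) <= n.+1%:R^-1.
Proof.
move=> fL.
have p n : 0 < n.+1%:R^-1 :> R by rewrite invr_gt0 ltr0n.
have h n := L1norm_trig_dense fL (p n).
exists (fun n => sval (cid (h n))) => n; exact (svalP (cid (h n))).
Qed.

(** The orbit of theta is a null set, so Weyl means of f itself would not determine its convolution;
    approximation in L1 by trigonometric polynomials avoids sampling f. *)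
Lemma mbd_convolution (f : A) : L1_circle f -> mbd (L1norm f) (fun _ => convolution f).
Proof.
move=> fL; have [r hr] := trig_approx fL.
apply: (mbd_lim hdot hrho (Fn := fun n _ => convolution (trig (r n)))).
- exact: L1norm_ge0.
- move=> n; exact (presC_convolution (L1_circle_trig (r n))).
- exact (presC_convolution fL).
- by move=> _ a aC; exact: convolution_cvg.
- move=> e e0; exists (Num.trunc (e^-1)).+1 => n hn.
  apply: mbd_le (mbd_convolution_trig (r n)).
  apply: le_trans (L1norm_le_sub fL (L1_circle_trig (r n))) _; rewrite lerD2l.
  apply: le_trans (hr n) _; rewrite invf_ple ?posrE ?ltr0n //.
  have e1 : 0 <= e^-1 by rewrite invr_ge0 ltW.
  have /andP[_ h] := trunc_itv e1; apply: le_trans (ltW h) _.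
  by rewrite ler_nat (leq_trans hn).
Qed.

Lemma nrm_cauchy_schwarz (I : Type) (s : seq I) (c : I -> C) (v : I -> H) :
  nrm (\sum_(k <- s) c k *: v k) ^+ 2 <=
    (\sum_(k <- s) nrm (c k) ^+ 2) * (\sum_(k <- s) nrm (v k) ^+ 2).
Proof.
apply: (@le_trans _ _ ((\sum_(k <- s) nrm (c k) * nrm (v k)) ^+ 2)).
  rewrite ler_sqr ?nnegrE ?nrm_ge0 //; last first.
    by apply: sumr_ge0 => k _; rewrite mulr_ge0 ?nrm_ge0.
  by apply: le_trans (ler_nrm_sum _ _ _) _; apply: ler_sum => k _; rewrite nrmZ.
rewrite expr2 !mulr_suml.
under eq_bigr do rewrite mulr_sumr.
under [leRHS]eq_bigr do rewrite mulr_sumr.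
have E : \sum_(i <- s) \sum_(k <- s) nrm (c i) ^+ 2 * nrm (v k) ^+ 2 =
    \sum_(i <- s) \sum_(k <- s) (nrm (c i) ^+ 2 * nrm (v k) ^+ 2 +
      nrm (c k) ^+ 2 * nrm (v i) ^+ 2) / 2.
  under [RHS]eq_bigr do rewrite -mulr_suml big_split.
  rewrite -mulr_suml big_split /=.
  by rewrite [X in _ = (_ + X) / 2]exchange_big /= -mulr2n -[X in X / 2]mulr_natr mulfK ?pnatr_eq0.
rewrite E; apply: ler_sum => i _; apply: ler_sum => k _.
rewrite ler_pdivlMr //; have := sqr_ge0 (nrm (c i) * nrm (v k) - nrm (c k) * nrm (v i)).
rewrite sqrrB !exprMn; nra.
Qed.

Definition coef (x y : int -> C) (K : nat) (s : int) : C :=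
  win K (fun k => x (k - s) * (y k)^*).

(** With k = l + t the coefficient at s is the sum over l of x (l + t - s) times the conjugate of y
    (l + t). So the multiplied operator is a sum over l of products of a diagonal in y, the operator
    [pf N f], and a diagonal in x. Cauchy-Schwarz over l extracts b, and the vectors fed to [pf N f]
    have total square norm at most a^2 times that of xi. *)
Lemma mbd_coef (x y : int -> C) (K X : nat) (a b : R) : 0 <= a -> 0 <= b ->
  (forall n, win n (fun s => nrm (x s) ^+ 2) <= a ^+ 2) ->
  (forall n, win n (fun s => nrm (y s) ^+ 2) <= b ^+ 2) ->
  (forall s, (X < `|s|)%N -> x s = 0) ->
  mbd (a * b) (fun s g => coef x y K s *: g).
Proof.
move=> a0 b0 xa yb xX; split=> [|m f N c fC [c0 h]]; first exact: mulr_ge0.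
split=> [|xi D xiD n]; first by rewrite !mulr_ge0.
have D0 := l2bd_ge0 xiD.
(* The l-th diagonal in x applied to the input. *)
pose zeta (l : int) (j : 'I_m) (r : int) := x (l + r) *: xi j r.
pose Z (l : int) (i : 'I_m) := \sum_(j < m) map_mx (pf N) f i j (zeta l j).
have Y i t : (\sum_(j < m) map_mx (fun g => pf N (multiply (fun s g => coef x y K s *: g) g)) f i j
    (xi j)) t = win K (fun k => (y k)^* *: Z (k - t) i t).
  rewrite fct_sumE /=.
  under eq_bigr => j _.
    rewrite mxE /pf /multiply.
    rewrite (@eq_win _ _ _ (fun s => win K (fun k => (y k)^* *:
      rho (rot (- t) (f i j s)) (zeta (k - t) j (t - s))))); last first.
      move=> s _.
      have f1 : C_circle (rot (- t) (f i j s)) := C_circle_rotation (fC i j s).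
      rewrite -[rot (- t) _]/(coef x y K s *: rot (- t) (f i j s)) (rhoZ hrho _ _ f1).
      rewrite /coef /win scaler_suml; apply: eq_bigr => k _.
      rewrite /zeta (rho_vecZ hrho _ _ f1) scalerA mulrC.
      by congr (_ * x _ *: _); lia.
    rewrite exchange_win.
    over.
  rewrite /= -win_sum; apply: eq_win => k _.
  under eq_bigr do rewrite winZ.
  rewrite -scaler_sumr; congr (_ *: _).
  rewrite /Z fct_sumE; apply: eq_bigr => j _; by rewrite mxE.
(* Window containing the support of every zeta l in play: |l| <= K + n and |l + r| <= X force |r| <=
   L. *)
pose L := (X + (K + n))%N.
pose Cl (l : int) : R := \sum_(j < m) win L (fun r => nrm (x (l + r)) ^+ 2 * nrm (xi j r) ^+ 2).
have zetaC l : (`|l| <= K + n)%N -> l2bd (zeta l) (Cl l).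
  move=> lK n'; apply: ler_sum => j _.
  have -> : win n' (fun s => nrm (zeta l j s) ^+ 2) =
      win n' (fun r => nrm (x (l + r)) ^+ 2 * nrm (xi j r) ^+ 2).
    by apply: eq_win => s _; rewrite /zeta nrmZ exprMn.
  have g0 r : 0 <= nrm (x (l + r)) ^+ 2 * nrm (xi j r) ^+ 2 by rewrite mulr_ge0 ?sqr_ge0.
  have [nL|nL] := leqP n' L; first exact: ler_win_widen.
  rewrite (win_split _ (ltnW nL)) (@eq_win _ _ (fun s => if _ then _ else _) (fun=> 0)).
    by rewrite win0 addr0.
  move=> r _; case: leqP => // rL; rewrite xX ?nrm0 ?expr0n ?mul0r //.
  by move: lK rL; rewrite /L; lia.
have step i t : (`|t| <= n)%N -> nrm (win K (fun k => (y k)^* *: Z (k - t) i t)) ^+ 2 <=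
    b ^+ 2 * win (K + n) (fun l => nrm (Z l i t) ^+ 2).
  move=> tn; rewrite winE; apply: le_trans (nrm_cauchy_schwarz _ _ _) _.
  rewrite -!winE; apply: ler_pM.
  - by apply: win_ge0 => s; exact: sqr_ge0.
  - by apply: win_ge0 => s; exact: sqr_ge0.
  - apply: le_trans (yb K); apply: ler_win => s _; by rewrite nrm_conj.
  - apply: le_trans (@ler_win_shift R K (fun l => nrm (Z l i t) ^+ 2) (- t) (fun _ => sqr_ge0 _)) _.
    by apply: ler_win_widen => [|s]; [lia|exact: sqr_ge0].
apply: (@le_trans _ _ (\sum_(i < m) win n (fun t => b ^+ 2 * win (K + n) (fun l => nrm (Z l i t) ^+ 2)))).
  apply: ler_sum => i _; apply: ler_win => t tn; rewrite Y; exact: step.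
under eq_bigr do rewrite winM exchange_win.
rewrite -mulr_sumr -win_sum.
apply: (@le_trans _ _ (b ^+ 2 * win (K + n) (fun l => c ^+ 2 * Cl l))).
  rewrite ler_wpM2l ?sqr_ge0 //; apply: ler_win => l lK; exact: h _ _ (zetaC l lK) n.
rewrite winM.
have sumCl : win (K + n) Cl <= a ^+ 2 * D.
  rewrite /Cl win_sum; apply: le_trans (ler_wpM2l (sqr_ge0 a) (xiD L)).
  rewrite mulr_sumr; apply: ler_sum => j _; rewrite exchange_win -winM; apply: ler_win => r _.
  have -> : win (K + n) (fun l => nrm (x (l + r)) ^+ 2 * nrm (xi j r) ^+ 2) =
     nrm (xi j r) ^+ 2 * win (K + n) (fun l => nrm (x (l + r)) ^+ 2).
    by rewrite -winM; apply: eq_win => l _; rewrite mulrC.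
  rewrite mulrC ler_wpM2r ?sqr_ge0 //.
  apply: le_trans (@ler_win_shift R _ (fun l => nrm (x l) ^+ 2) r (fun _ => sqr_ge0 _)) _.
  exact: xa.
have -> : (a * b * c) ^+ 2 * D = b ^+ 2 * (c ^+ 2 * (a ^+ 2 * D)) by ring.
by rewrite !ler_wpM2l ?sqr_ge0.
Qed.

End BasicMultipliers.

(** * The Fourier algebra: limits and truncations of coefficients *)

Section FourierAlgebra.
Variables (R : realType) (H : completeNormedModType R[i]).
Variables (dot : {dot H for Num.conj}) (rho : (circle R -> R[i]) -> H -> H) (theta : R).
Hypotheses (hdot : hilbert_dot dot) (hrho : faithful_rep dot rho).
Local Notation C := R[i].
Local Notation mbd := (mbd rho theta).

Definition sqbd (x : int -> C) (a : R) := forall n, win n (fun s => nrm (x s) ^+ 2) <= a ^+ 2.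

Definition coefI (x y : int -> C) (s : int) : C := zsum (fun k => x (k - s) * (y k)^*).

(** The crude bound from the arithmetic-geometric inequality is enough for convergence; the sharp
    product a b is that of [mbd_coef]. *)
Lemma coef_summable (x y : int -> C) (a b : R) s : sqbd x a -> sqbd y b ->
  forall n, win n (fun k => nrm (x (k - s) * (y k)^*)) <= a ^+ 2 + b ^+ 2.
Proof.
move=> xa yb n.
apply: (@le_trans _ _ (win n (fun k => nrm (x (k - s)) ^+ 2 + nrm (y k) ^+ 2))).
  apply: ler_win => k _; rewrite nrmM nrm_conj.
  have := nrm_ge0 (x (k - s)); have := nrm_ge0 (y k).
  have := sqr_ge0 (nrm (x (k - s)) - nrm (y k)); nra.
rewrite winD lerD //.
apply: le_trans (@ler_win_shift R n (fun k => nrm (x k) ^+ 2) (- s) (fun _ => sqr_ge0 _)) _.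
exact: xa.
Qed.

Lemma coef_tends (x y : int -> C) (a b : R) s : sqbd x a -> sqbd y b ->
  tends (fun n => win n (fun k => x (k - s) * (y k)^*)) (coefI x y s).
Proof. by move=> xa yb; apply: tends_zsum_complex; exact: coef_summable xa yb. Qed.

Definition trunc (V : zmodType) (N : nat) (x : int -> V) (s : int) : V :=
  if (`|s| <= N)%N then x s else 0.

Lemma sqbd_trunc N x a : sqbd x a -> sqbd (trunc N x) a.
Proof.
move=> xa n; apply: le_trans (xa n); apply: ler_win => s _; rewrite /trunc.
by case: ifP => // _; rewrite nrm0 expr0n sqr_ge0.
Qed.

Lemma mbd_fourier (x y : int -> C) (a b : R) : 0 <= a -> 0 <= b -> sqbd x a -> sqbd y b ->
  mbd (a * b) (fun s g => coefI x y s *: g).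
Proof.
move=> a0 b0 xa yb.
(* [mbd_coef] wants x of finite support. Cutting at 2 K changes nothing in the window K as soon as
   |s| <= K. *)
apply: (mbd_lim hdot hrho (Fn := fun K s g => coef (trunc K.*2 x) y K s *: g)).
- exact: mulr_ge0.
- move=> K s g gC; exact (C_circleZ gC).
- move=> s g gC; exact (C_circleZ gC).
- move=> s g gC e e0; have [B [B0 gB]] := C_circle_bounded gC.
  have e1 : 0 < e / (B + 1) by rewrite divr_gt0 // ltr_wpDl.
  have [N hN] := coef_tends s xa yb e1.
  exists (maxn N `|s|) => K; rewrite geq_max => /andP[/hN h sK] z.
  have -> : coef (trunc K.*2 x) y K s = win K (fun k => x (k - s) * (y k)^*).
    apply: eq_win => k kK; rewrite /trunc ifT //; lia.
  rewrite -[X in X - _]/(_ * g z) -[X in _ - X]/(_ * g z) -mulrBl nrmM.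
  move: h; rewrite ltr_pdivlMr ?ltr_wpDl // => h; apply: le_trans (ltW h).
  rewrite ler_wpM2l ?nrm_ge0 //; apply: le_trans (gB z) _; lra.
- move=> e e0; exists 0%N => K _; apply: mbd_le (_ : a * b <= _) _; first by rewrite lerDl ltW.
  apply: (@mbd_coef _ _ dot rho theta hrho (trunc K.*2 x) y K K.*2 a b) => //.
    exact: sqbd_trunc.
  by move=> s; rewrite /trunc ltnNge => /negbTE ->.
Qed.

Lemma coefI_truncl N (x y : int -> C) (a b : R) s : sqbd x a -> sqbd y b ->
  coefI x y s = coefI (trunc N x) y s + coefI (fun k => if (`|k| <= N)%N then 0 else x k) y s.
Proof.
move=> xa yb; apply: tends_unique (coef_tends s xa yb) _.
have xa' : sqbd (fun k => if (`|k| <= N)%N then 0 else x k) a.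
  move=> n; apply: le_trans (xa n); apply: ler_win => k _.
  by case: ifP => // _; rewrite nrm0 expr0n sqr_ge0.
have := tendsD (coef_tends s (sqbd_trunc N xa) yb) (coef_tends s xa' yb).
congr tends; apply/funext => n; rewrite -winD; apply: eq_win => k _.
by rewrite -mulrDl /trunc; case: ifP => _; rewrite ?addr0 ?add0r.
Qed.

Lemma coefI_truncr N (x y : int -> C) (a b : R) s : sqbd x a -> sqbd y b ->
  coefI x y s = coefI x (trunc N y) s + coefI x (fun k => if (`|k| <= N)%N then 0 else y k) s.
Proof.
move=> xa yb; apply: tends_unique (coef_tends s xa yb) _.
have yb' : sqbd (fun k => if (`|k| <= N)%N then 0 else y k) b.
  move=> n; apply: le_trans (yb n); apply: ler_win => k _.
  by case: ifP => // _; rewrite nrm0 expr0n sqr_ge0.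
have := tendsD (coef_tends s xa (sqbd_trunc N yb)) (coef_tends s xa yb').
congr tends; apply/funext => n; rewrite -winD; apply: eq_win => k _.
have c0 : (0 : C)^* = 0 by exact: rmorph0.
by rewrite -mulrDr /trunc; case: ifP => _; rewrite c0 ?addr0 ?add0r.
Qed.

Lemma coefI_support N (x y : int -> C) s : (N.*2 < `|s|)%N ->
  coefI (trunc N x) (trunc N y) s = 0.
Proof.
move=> Ns; rewrite /coefI (_ : (fun k => _) = fun=> 0).
  by rewrite (@zsum_finite _ _ _ 0) // win0.
apply/funext => k; rewrite /trunc; case: (leqP `|k| N) => kN.
  by rewrite ifF ?mul0r //; apply/negbTE; lia.
by rewrite (_ : (0 : C)^* = 0) ?mulr0 //; exact: rmorph0.
Qed.

Lemma isl2_sqbd (x : int -> C) : l2 x -> exists2 a : R, 0 <= a & sqbd x a.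
Proof.
move=> xfin.
have [K K0 hK] : exists2 K : R, 0 <= K & (l2_sq x <= K%:E)%E.
  have x0 : (0 <= l2_sq x)%E by apply: esum_ge0 => s _; rewrite /norm_sq lee_fin sqr_ge0.
  by exists (fine (l2_sq x)); [exact: fine_ge0|rewrite fineK // ge0_fin_numE].
exists (Num.sqrt K); first exact: sqrtr_ge0.
move=> n; rewrite sqr_sqrtr //; move: n.
apply: (esum_winP (g := fun s => nrm (x s) ^+ 2) K (fun s => sqr_ge0 _)).1.
exact: hK.
Qed.

Lemma sqbd_tail (x : int -> C) (a : R) : sqbd x a -> forall e : R, 0 < e ->
  exists N, sqbd (fun k => if (`|k| <= N)%N then 0 else x k) e.
Proof.
move=> xa e e0; have e2 : 0 < e ^+ 2 by rewrite exprn_gt0.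
have [N hN] := win_tail (fun s => sqr_ge0 (nrm (x s))) xa e2; exists N => n.
apply: le_trans (hN n); apply: ler_win => s _.
by case: ifP => // _; rewrite nrm0 expr0n.
Qed.

End FourierAlgebra.

(** * From finitely supported functions to l1 *)

Section IntegratedForm.
Variables (R : realType) (H : completeNormedModType R[i]).
Variables (dot : {dot H for Num.conj}) (rho : (circle R -> R[i]) -> H -> H) (theta : R).
Hypotheses (hdot : hilbert_dot dot) (hrho : faithful_rep dot rho).
Local Notation T := (circle R).
Local Notation C := R[i].
Local Notation A := (T -> C).
Local Notation op := (@l2op R H).
Local Notation rot := (rotation theta).
Local Notation mbd := (mbd rho theta).
Local Notation pf := (pf rho theta).
Local Notation algS := (alg_space (@C_circle R) rho).
Local Notation l1 := (l1 (@C_circle R) rho).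
Local Notation pit := (pi_tilde rho rot).
Implicit Types (a b : A) (F G : int -> A -> A) (f g : int -> A).

Lemma alg_norm_leP m (x : 'M[A]_m) (c : R) : 0 <= c ->
  (@os_norm R algS m x <= c%:E)%E <-> alg_bd rho c (fun i j => x i j).
Proof.
move=> c0; rewrite /= opmx_normP //; last by move=> v; rewrite /norm_sq lee_fin sqr_ge0.
have E (v : 'I_m -> H) : (\sum_(j < m) norm_sq (v j) = (\sum_(j < m) nrm (v j) ^+ 2)%:E)%E.
  by rewrite /norm_sq sumEFin.
have E2 (v : 'I_m -> H) : \sum_(i < m) nrm (\sum_(j < m) map_mx rho x i j (v j)) ^+ 2 =
    \sum_(i < m) nrm (\sum_(j < m) rho (x i j) (v j)) ^+ 2.
  by apply: eq_bigr => i _; congr (nrm _ ^+ 2); apply: eq_bigr => j _; rewrite mxE.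
split=> [h|[_ h] v _].
  split=> // v; have := h v; rewrite !E E2 => /(_ (ltry _)).
  by rewrite -EFinM lee_fin.
by rewrite !E E2 -EFinM lee_fin.
Qed.

Definition anorm a : R := fine (@os_norm1 R algS a).

Lemma os_norm1_ge0 a : (0 <= @os_norm1 R algS a)%E.
Proof. by apply: le_ereal_inf_tmp => _ [c [c0 _] <-]; rewrite lee_fin. Qed.

Lemma os_norm1_leP a (c : R) : 0 <= c ->
  (@os_norm1 R algS a <= c%:E)%E <-> (forall v, nrm (rho a v) <= c * nrm v).
Proof.
move=> c0; rewrite /os_norm1 alg_norm_leP //; split=> [[_ h] v|h].
  have := h (fun=> v); rewrite !big_ord1 mxE -exprMn ler_pXn2r ?nnegrE ?nrm_ge0 //.
  by rewrite mulr_ge0 ?nrm_ge0.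
split=> // v; rewrite !big_ord1 mxE -exprMn ler_pXn2r ?nnegrE ?nrm_ge0 //.
by rewrite mulr_ge0 ?nrm_ge0.
Qed.

Lemma os_norm1E a : C_circle a -> @os_norm1 R algS a = (anorm a)%:E.
Proof.
move=> aC; have [B [B0 aB]] := C_circle_bounded aC.
rewrite /anorm fineK // ge0_fin_numE ?os_norm1_ge0 //.
apply: le_lt_trans (_ : (B%:E < +oo)%E); last exact: ltry.
by apply/(os_norm1_leP a B0) => v; exact: (nrm_rho_le hdot hrho v aC aB).
Qed.

Lemma anorm_ge0 a : 0 <= anorm a.
Proof. by rewrite /anorm fine_ge0 // os_norm1_ge0. Qed.

Lemma anormP a v : C_circle a -> nrm (rho a v) <= anorm a * nrm v.
Proof.
by move=> aC; apply: (os_norm1_leP a (anorm_ge0 a)).1; rewrite (os_norm1E aC).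
Qed.

Lemma anorm_le a (c : R) : C_circle a -> 0 <= c -> (forall v, nrm (rho a v) <= c * nrm v) ->
  anorm a <= c.
Proof. by move=> aC c0 /(os_norm1_leP a c0); rewrite (os_norm1E aC) lee_fin. Qed.

Lemma anorm_sup_le a (B : R) : C_circle a -> (forall z, nrm (a z) <= B) -> anorm a <= B.
Proof.
move=> aC aB; apply: (anorm_le aC); first by apply: le_trans (nrm_ge0 _) (aB (circle_exp 0)).
by move=> v; exact: (nrm_rho_le hdot hrho v aC aB).
Qed.

Lemma nrm_rho_rot n a v : C_circle a -> nrm (rho (rot n a) v) <= anorm a * nrm v.
Proof.
move=> aC; have h : alg_bd rho (anorm a) (fun _ _ : 'I_1 => a).
  split=> [|w]; first exact: anorm_ge0.
  rewrite !big_ord1 -exprMn ler_pXn2r ?nnegrE ?nrm_ge0 ?mulr_ge0 ?nrm_ge0 ?anorm_ge0 //.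
  exact: anormP aC.
have [_ /(_ (fun=> v))] := alg_bd_rotate hdot hrho (circle_exp (n%:~R * theta)) (fun _ _ => aC) h.
rewrite !big_ord1 -exprMn ler_pXn2r ?nnegrE ?nrm_ge0 //.
by rewrite mulr_ge0 ?nrm_ge0 ?anorm_ge0.
Qed.

Lemma anormD a b : C_circle a -> C_circle b -> anorm (a + b) <= anorm a + anorm b.
Proof.
move=> aC bC; apply: (anorm_le (C_circle_add aC bC)); first by rewrite addr_ge0 ?anorm_ge0.
move=> v; rewrite (rhoD hrho _ aC bC) mulrDl; apply: le_trans (ler_nrmD _ _) _.
by apply: lerD; [exact: anormP aC|exact: anormP bC].
Qed.

Lemma anormZ (c : C) a : C_circle a -> anorm (c *: a) <= nrm c * anorm a.
Proof.
move=> aC; apply: (anorm_le (C_circleZ aC)); first by rewrite mulr_ge0 ?anorm_ge0 ?nrm_ge0.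
move=> v; rewrite (rhoZ hrho _ _ aC) nrmZ -mulrA ler_wpM2l ?nrm_ge0 //; exact: anormP aC.
Qed.

Lemma anorm_eq0 a : C_circle a -> anorm a = 0 -> a = 0.
Proof.
move=> aC a0; apply: (rep_injective hrho aC (@C_circle0 R)).
apply/funext => v; rewrite (rho0 hrho); apply/nrm_eq0/eqP.
by rewrite eq_le nrm_ge0 andbT -[0](mul0r (nrm v)) -a0; exact: anormP aC.
Qed.

Definition summable f (S : R) := (forall s, C_circle (f s)) /\
  forall n, win n (fun s => anorm (f s)) <= S.

Lemma l1P f : l1 f <-> exists S, summable f S.
Proof.
split=> [[fC fS]|[S [fC fS]]].
  have E : (\esum_(s in [set: int]) @os_norm1 R algS (f s) =
      \esum_(s in [set: int]) (anorm (f s))%:E)%E.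
    by apply: eq_esum => s _; rewrite (os_norm1E (fC s)).
  rewrite E in fS; set S := (\esum_(s in _) _)%E in fS.
  have S0 : (0 <= S)%E by apply: esum_ge0 => s _; rewrite lee_fin anorm_ge0.
  exists (fine S); split=> // n; move: n.
  apply: (esum_winP (g := fun s => anorm (f s)) _ (fun s => anorm_ge0 _)).1.
  by rewrite fineK // ge0_fin_numE.
split=> //.
have E : (\esum_(s in [set: int]) @os_norm1 R algS (f s) =
    \esum_(s in [set: int]) (anorm (f s))%:E)%E.
  by apply: eq_esum => s _; rewrite (os_norm1E (fC s)).
rewrite E; apply: le_lt_trans (_ : (S%:E < +oo)%E); last exact: ltry.
by apply: (esum_winP (g := fun s => anorm (f s)) _ (fun s => anorm_ge0 _)).2.
Qed.

Lemma isl2_point (xi : int -> H) : isl2 xi -> exists2 B : R, 0 <= B & forall s, nrm (xi s) <= B.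
Proof.
move=> [K xiK]; have K0 : 0 <= K by apply: le_trans (xiK 0%N); apply: win_ge0 => s; exact: sqr_ge0.
exists (Num.sqrt K) => [|s]; first exact: sqrtr_ge0.
rewrite -(@ler_pXn2r _ 2) ?nnegrE ?nrm_ge0 ?sqrtr_ge0 // sqr_sqrtr //.
apply: le_trans (xiK `|s|%N).
exact: (@ler_win_point R _ (fun r => nrm (xi r) ^+ 2) s (leqnn _) (fun r => sqr_ge0 _)).
Qed.

Lemma pf_tends f S xi t : summable f S -> isl2 xi -> tends (fun N => pf N f xi t) (pit f xi t).
Proof.
move=> [fC fS] /isl2_point[B B0 xiB].
apply: (tends_zsum (C := S * B)) => n.
apply: le_trans (_ : win n (fun s => B * anorm (f s)) <= _).
  apply: ler_win => s _; rewrite /pi_rep /regular.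
  apply: le_trans (nrm_rho_rot _ _ (fC s)) _.
  by rewrite mulrC ler_wpM2r ?anorm_ge0.
by rewrite winM mulrC ler_wpM2r.
Qed.

Lemma opbd1_shift a (s : int) : C_circle a ->
  opbd1 (anorm a) ((fun xi t => rho (rot (- t) a) (xi (t - s))) : op).
Proof.
move=> aC; split=> [|xi K xiK n]; first exact: anorm_ge0.
rewrite big_ord1; apply: (@le_trans _ _ (win n (fun t => anorm a ^+ 2 * nrm (xi ord0 (t - s)) ^+ 2))).
  apply: ler_win => t _; rewrite big_ord1 mxE -exprMn ler_pXn2r ?nnegrE ?nrm_ge0 //.
    exact: nrm_rho_rot aC.
  by rewrite mulr_ge0 ?anorm_ge0 ?nrm_ge0.
rewrite winM ler_wpM2l ?sqr_ge0 //.
apply: le_trans (@ler_win_shift R n (fun t => nrm (xi ord0 t) ^+ 2) (- s) (fun _ => sqr_ge0 _)) _.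
by have := xiK (n + `|- s|)%N; rewrite big_ord1.
Qed.

Lemma opbd1_pf N f : (forall s, C_circle (f s)) -> opbd1 (win N (fun s => anorm (f s))) (pf N f).
Proof.
move=> fC.
have := @opbd_sum R H 1 _ (index_enum 'I_N.*2.+1) (fun k : 'I_N.*2.+1 => anorm (f (k%:Z - N%:Z)))
  (fun k => const_mx ((fun xi t => rho (rot (- t) (f (k%:Z - N%:Z))) (xi (t - (k%:Z - N%:Z)))) : op))
  (fun k => opbd1_shift _ (fC _)).
apply: opbd_eq => i j xi _; rewrite !summxE mxE; apply/funext => t.
by rewrite !fct_sumE /pf /win; apply: eq_bigr => k _; rewrite mxE.
Qed.

Lemma opbd1_pi f S : summable f S -> opbd1 S (pit f).
Proof.
move=> fS; have [fC hS] := fS.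
have S0 : 0 <= S by apply: le_trans (hS 0%N); apply: win_ge0 => s; exact: anorm_ge0.
apply: (@opbd_lim R H 1 S (fun N => const_mx (pf N f))) => //.
- move=> i j xi xil t; rewrite mxE; under eq_fun do rewrite mxE; exact: pf_tends fS xil.
- move=> e e0; exists 0%N => N _; apply: opbd_le (opbd1_pf N fC).
  by apply: le_trans (hS N) _; rewrite lerDl ltW.
Qed.

Lemma summable_tail f S N : summable f S ->
  summable (fun s => if (`|s| <= N)%N then 0 else f s) S.
Proof.
move=> [fC hS]; split=> [s|n].
  by case: ifP => _; [exact (@C_circle0 R)|exact (fC s)].
apply: le_trans (hS n); apply: ler_win => s _; case: ifP => // _.
apply: le_trans (anorm_ge0 _); apply: (anorm_sup_le (@C_circle0 R)) => z.
by rewrite -[X in nrm X]/(0 : C) nrm0.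
Qed.

(** On l2 the difference is the integrated form of the tail of f, whose l1 norm bounds the operator
    norm. *)
Lemma pi_truncation f S : summable f S -> forall e : R, 0 < e ->
  exists N0, forall N, (N0 <= N)%N -> opbd1 e (pit f - pf N f).
Proof.
move=> fS e e0; have [fC hS] := fS.
have [N0 hN0] := win_tail (fun s => anorm_ge0 (f s)) hS e0.
exists N0 => N hN; have gS := summable_tail N fS; have [gC _] := gS.
have a0 : anorm 0 = 0.
  apply/eqP; rewrite eq_le anorm_ge0 andbT; apply: (anorm_sup_le (@C_circle0 R)) => z.
  by rewrite -[X in nrm X]/(0 : C) nrm0.
have gS' : summable (fun s => if (`|s| <= N)%N then 0 else f s) e.
  split=> // n; apply: le_trans (hN0 n); apply: ler_win => s _.
  have [sN|sN] := leqP `|s| N.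
    by rewrite a0; case: ifP => // _; exact: anorm_ge0.
  by rewrite ifF //; apply/negbTE; rewrite -ltnNge; exact: leq_ltn_trans hN sN.
have := opbd1_pi gS'; apply: opbd_eq => i j xi xil; rewrite !mxE; apply/funext => t.
apply: tends_unique (pf_tends t gS xil) _.
have h1 := tendsD (pf_tends t fS xil) (tends_cst (- pf N f xi t)).
apply: (@tends_shift _ _ _ _ N).
have := tends_sub (phi := fun n => (n + N)%N) (fun n => leq_addr _ _) h1.
congr tends; apply/funext => n /=.
rewrite /pf (win_split _ (leq_addl n N)) addrC addrA addNr add0r.
apply: eq_win => s _; case: ifP => // _.
have -> : rot (- t) (0 : A) = 0 by [].
by rewrite (rho0 hrho).
Qed.

Definition Mbd (M : R) F := 0 <= M /\ forall m (f : 'M[int -> A]_m) c,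
  (forall i j, l1 (f i j)) -> opbd c (map_mx pit f) ->
  opbd (M * c) (map_mx (fun g => pit (multiply F g)) f).

(** Boundedness coefficient by coefficient, which makes [multiply F] preserve l1. K is a qualitative
    constant, separate from the multiplier bound. *)
Definition dominated (K : R) F := 0 <= K /\ forall s a, C_circle a ->
  C_circle (F s a) /\ anorm (F s a) <= K * anorm a.

Lemma dominated_summable K F f S : dominated K F -> summable f S ->
  summable (multiply F f) (K * S).
Proof.
move=> [K0 FK] [fC hS]; split=> [s|n]; first exact (FK s _ (fC s)).1.
apply: le_trans (_ : win n (fun s => K * anorm (f s)) <= _).
  by apply: ler_win => s _; exact: (FK s _ (fC s)).2.
by rewrite winM ler_wpM2l.
Qed.

Lemma dominated_l1 K F f : dominated K F -> l1 f -> l1 (multiply F f).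
Proof.
by move=> FK /l1P[S fS]; apply/l1P; exists (K * S); exact: dominated_summable.
Qed.

(** For a fixed matrix size the truncations of f converge in norm, so their bounds approach c. The
    truncated images converge coordinatewise by domination, and [opbd_lim] passes the bound on. *)
Lemma mbd_Mbd M K F : dominated K F -> mbd M F -> Mbd M F.
Proof.
move=> FK [M0 h]; split=> // m f c fl fc; have c0 := opbd_ge0 fc.
have hS i j := (l1P (f i j)).1 (fl i j).
pose S i j := sval (cid (hS i j)).
have fS i j : summable (f i j) (S i j) := svalP (cid (hS i j)).
have FS i j := dominated_summable FK (fS i j).
have fC i j s : C_circle (f i j s) := (fS i j).1 s.
apply: (@opbd_lim R H m _ (fun N => map_mx (fun g => pf N (multiply F g)) f)).
- exact: mulr_ge0.
- move=> i j xi xil t; rewrite mxE; under eq_fun do rewrite mxE; exact: pf_tends (FS i j) xil.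
- move=> e e0; have d0 : 0 < e / (M + 1) / (m%:R ^+ 2 + 1).
    by rewrite !divr_gt0 // ltr_wpDl // sqr_ge0.
  set d := e / (M + 1) / _ in d0.
  pose N0 i j := sval (cid (pi_truncation (fS i j) d0)).
  have hN0 i j := svalP (cid (pi_truncation (fS i j) d0)).
  exists (\max_(i < m) \max_(j < m) N0 i j)%N => N hN.
  have : opbd (c + m%:R ^+ 2 * d) (map_mx (pf N) f).
    have D : opbd (m%:R ^+ 2 * d) (map_mx pit f - map_mx (pf N) f).
      apply: opbd_entries; first exact: ltW.
      move=> i j; rewrite !mxE; apply: hN0.
      apply: leq_trans hN; apply: leq_trans (leq_bigmax i).
      exact: (leq_bigmax (F := N0 i) j).
    by have := opbdB fc D; rewrite opprB [X in opbd _ X]addrC subrK.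
  move=> /(h m f N _ fC); apply: opbd_le; rewrite mulrDr lerD2l.
  have h1 : d * (m%:R ^+ 2 + 1) = e / (M + 1) by rewrite /d divfK // gt_eqF // ltr_wpDl // sqr_ge0.
  have h2 : e / (M + 1) * (M + 1) = e by rewrite divfK // gt_eqF // ltr_wpDl.
  have h3 : 0 < e / (M + 1) by rewrite divr_gt0 // ltr_wpDl.
  have : m%:R ^+ 2 * d <= e / (M + 1) by rewrite -h1; lra.
  move=> /(ler_wpM2l M0) /le_trans; apply; rewrite mulrC -[leRHS]h2 ler_wpM2l ?(ltW h3) //; lra.
Qed.

Lemma pi_trunc N f : pit (trunc N f) = pf N f.
Proof.
apply/funext => xi; apply/funext => t; rewrite /pi_tilde (@zsum_finite _ _ _ N).
  by apply: eq_win => s sN; rewrite /pi_rep /regular /trunc sN.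
move=> s Ns; rewrite /pi_rep /trunc ifF; last by apply/negbTE; rewrite -ltnNge.
have -> : rot (- t) (0 : A) = 0 by [].
by rewrite (rho0 hrho).
Qed.

Lemma l1_trunc N f : (forall s, C_circle (f s)) -> l1 (trunc N f).
Proof.
move=> fC; apply/l1P; exists (win N (fun s => anorm (f s))); split=> [s|n].
  by rewrite /trunc; case: ifP => _; [exact (fC s)|exact (@C_circle0 R)].
have a0 : anorm 0 = 0.
  apply/eqP; rewrite eq_le anorm_ge0 andbT; apply: (anorm_sup_le (@C_circle0 R)) => z.
  by rewrite -[X in nrm X]/(0 : C) nrm0.
have g0 s : 0 <= anorm (trunc N f s) by exact: anorm_ge0.
have E : win N (fun s => anorm (trunc N f s)) = win N (fun s => anorm (f s)).
  by apply: eq_win => s sN; rewrite /trunc sN.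
have [nN|Nn] := leqP n N; first by rewrite -E; exact: ler_win_widen.
rewrite (win_split _ (ltnW Nn)) E (@eq_win _ _ (fun s => if _ then _ else _) (fun=> 0)).
  by rewrite win0 addr0.
by move=> s _; case: leqP => // sN; rewrite /trunc ifF ?a0 //; apply/negbTE; rewrite -ltnNge.
Qed.

End IntegratedForm.

(** * The closed graph of a multiplier on the crossed product *)

Section GraphClosure.
Variables (R : realType) (H : completeNormedModType R[i]).
Variables (dot : {dot H for Num.conj}) (rho : (circle R -> R[i]) -> H -> H) (theta : R).
Hypotheses (hdot : hilbert_dot dot) (hrho : faithful_rep dot rho).
Local Notation T := (circle R).
Local Notation C := R[i].
Local Notation A := (T -> C).
Local Notation op := (@l2op R H).
Local Notation rot := (rotation theta).
Local Notation pf := (pf rho theta).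
Local Notation l1 := (l1 (@C_circle R) rho).
Local Notation pit := (pi_tilde rho rot).
Local Notation Mbd := (Mbd rho theta).
Local Notation dominated := (dominated rho).
Implicit Types (a b : A) (F G : int -> A -> A) (f g : int -> A) (X Y Z : op).

Lemma l1_C f s : l1 f -> C_circle (f s).
Proof. by case=> h _; exact (h s). Qed.

Lemma pi_linear f (c : C) (xi eta : int -> H) t : l1 f -> isl2 xi -> isl2 eta ->
  isl2 (c *: xi + eta) -> pit f (c *: xi + eta) t = c *: pit f xi t + pit f eta t.
Proof.
move=> fl; have [S fS] := (l1P hdot hrho f).1 fl; move=> xil etal l.
apply: tends_unique (pf_tends theta hdot hrho t fS l) _.
have := tendsD (tendsZ c (pf_tends theta hdot hrho t fS xil)) (pf_tends theta hdot hrho t fS etal).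
congr tends; apply/funext => n; rewrite /pf -winZ -winD; apply: eq_win => s _.
have f1 : C_circle (rot (- t) (f s)) := C_circle_rotation (l1_C fl).
by rewrite -[(c *: xi + eta) _]/(c *: xi _ + eta _) (rho_vecD hrho _ _ f1) (rho_vecZ hrho _ _ f1).
Qed.

Lemma pi_comb (c : C) f g xi : l1 f -> l1 g -> l1 (c *: f + g) -> isl2 xi ->
  pit (c *: f + g) xi = (c *: pit f + pit g) xi.
Proof.
move=> fl gl hl xil; apply/funext => t.
have [S fS] := (l1P hdot hrho f).1 fl; have [S' gS] := (l1P hdot hrho g).1 gl.
have [S'' hS] := (l1P hdot hrho _).1 hl.
apply: tends_unique (pf_tends theta hdot hrho t hS xil) _.
have := tendsD (tendsZ c (pf_tends theta hdot hrho t fS xil)) (pf_tends theta hdot hrho t gS xil).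
congr tends; apply/funext => n.
by rewrite (pf_comb theta hrho c n (fun s => l1_C fl) (fun s => l1_C gl)).
Qed.

Lemma l1_comb (c : C) f g : l1 f -> l1 g -> l1 (c *: f + g).
Proof.
move=> fl gl; have [S [fC hS]] := (l1P hdot hrho f).1 fl.
have [S' [gC hS']] := (l1P hdot hrho g).1 gl.
apply/(l1P hdot hrho); exists (nrm c * S + S'); split=> [s|n].
  exact (C_circle_comb (fC s) (gC s)).
apply: le_trans (_ : win n (fun s => nrm c * anorm rho (f s) + anorm rho (g s)) <= _).
  apply: ler_win => s _; apply: le_trans (anormD hdot hrho (C_circleZ (fC s)) (gC s)) _.
  by rewrite lerD2r; exact: (anormZ hdot hrho c (fC s)).
by rewrite winD winM lerD // ler_wpM2l ?nrm_ge0.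
Qed.

Lemma l1_sub f g : l1 f -> l1 g -> l1 (f - g).
Proof.
move=> fl gl; have -> : f - g = (-1 : C) *: g + f by rewrite scaleN1r addrC.
exact: l1_comb.
Qed.

Lemma pi_sub f g xi : l1 f -> l1 g -> isl2 xi -> pit (f - g) xi = (pit f - pit g) xi.
Proof.
move=> fl gl xil; have E : f - g = (-1 : C) *: g + f by rewrite scaleN1r addrC.
have hl := l1_sub fl gl; rewrite E in hl *.
rewrite (pi_comb gl fl hl xil) -[LHS]/((-1 : C) *: pit g xi + pit f xi).
by rewrite scaleN1r addrC.
Qed.

Lemma opbd1_comb (c : C) (d e : R) X Y : opbd1 d X -> opbd1 e Y ->
  opbd1 (nrm c * d + e) (c *: X + Y).
Proof.
move=> dX eY; have := opbdD (opbdZ c dX) eY; apply: opbd_eq => i j xi _.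
by rewrite !mxE.
Qed.

Lemma opbd1D (d e : R) X Y : opbd1 d X -> opbd1 e Y -> opbd1 (d + e) (X + Y).
Proof.
move=> dX eY; have := opbdD dX eY; apply: opbd_eq => i j xi _; by rewrite !mxE.
Qed.

Lemma opbd1N (d : R) X : opbd1 d X -> opbd1 d (- X).
Proof. by move=> /opbdN; apply: opbd_eq => i j xi _; rewrite !mxE. Qed.

Lemma opbd1_eq (d : R) X Y : (forall xi, isl2 xi -> X xi = Y xi) -> opbd1 d X -> opbd1 d Y.
Proof. by move=> XY; apply: opbd_eq => i j xi xil; rewrite !mxE; exact: XY. Qed.

Lemma opbd1_0 (d : R) : 0 <= d -> opbd1 d (0 : op).
Proof.
move=> d0; apply: opbd_le d0 _; have := opbd0 H 1; apply: opbd_eq => i j xi _; by rewrite !mxE.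
Qed.

Lemma opbd1_point (c K : R) X xi t : opbd1 c X ->
  (forall n, win n (fun s => nrm (xi s) ^+ 2) <= K) -> nrm (X xi t) <= c * Num.sqrt K.
Proof.
move=> [c0 h] xiK; have K0 : 0 <= K by apply: le_trans (xiK 0%N); apply: win_ge0 => s; exact: sqr_ge0.
have := h (fun=> xi) K (l2bd1 xiK) `|t|%N; rewrite !big_ord1 mxE => h1.
rewrite -(@ler_pXn2r _ 2) ?nnegrE ?nrm_ge0 ?mulr_ge0 ?sqrtr_ge0 // exprMn sqr_sqrtr //.
apply: le_trans h1.
exact: (@ler_win_point R _ (fun r => nrm (X xi r) ^+ 2) t (leqnn _) (fun r => sqr_ge0 _)).
Qed.

Definition mult (M : R) F :=
  [/\ Mbd M F, exists K, dominated K F & forall s, lin_on_C (F s)].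

Lemma mult_l1 M F f : mult M F -> l1 f -> l1 (multiply F f).
Proof. by move=> [_ [K FK] _] fl; exact (dominated_l1 hdot hrho FK fl). Qed.

Lemma multiply_comb M F (c : C) f g : mult M F -> l1 f -> l1 g ->
  multiply F (c *: f + g) = c *: multiply F f + multiply F g.
Proof.
move=> [_ _ linF] fl gl; apply/funext => s.
exact: (linF s c _ _ (l1_C fl) (l1_C gl)).
Qed.

Lemma mult_change M F f g (d : R) : mult M F -> l1 f -> l1 g -> opbd1 d (pit f - pit g) ->
  opbd1 (M * d) (pit (multiply F f) - pit (multiply F g)).
Proof.
move=> FM fl gl hd; have [[M0 h] _ _] := FM.
have hl := l1_sub fl gl.
have d1 : opbd d (map_mx pit (const_mx (f - g) : 'M[int -> A]_1)).
  apply: opbd_eq hd => i j xi xil; rewrite !mxE; exact: esym (pi_sub fl gl xil).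
have hL i j : l1 ((const_mx (f - g) : 'M[int -> A]_1) i j) by rewrite mxE.
have := h 1 (const_mx (f - g)) d hL d1; apply: opbd_eq => i j xi xil.
rewrite !mxE.
have E : multiply F (f - g) = multiply F f - multiply F g.
  have E' : f - g = (-1 : C) *: g + f by rewrite scaleN1r addrC.
  by rewrite E' (multiply_comb (-1) FM gl fl) scaleN1r addrC.
by rewrite E (pi_sub (mult_l1 FM fl) (mult_l1 FM gl) xil).
Qed.

(* The closure of the graph of the map sending [pi_tilde f] to
   [pi_tilde (multiply F f)], from which [S_map F] selects a value. *)
Definition graph F X Y := forall e : R, 0 < e -> exists f,
  [/\ l1 f, opbd1 e (X - pit f) & opbd1 e (Y - pit (multiply F f))].

Lemma graph_pi F f : l1 f -> graph F (pit f) (pit (multiply F f)).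
Proof.
by move=> fl e e0; exists f; rewrite !subrr; split=> //; apply: opbd1_0; exact: ltW.
Qed.

Lemma graph_comb M F (c : C) X Y X' Y' : mult M F -> graph F X Y -> graph F X' Y' ->
  graph F (c *: X + X') (c *: Y + Y').
Proof.
move=> FM XY XY' e e0.
have c1 : 0 < nrm c + 1 by rewrite ltr_wpDl ?nrm_ge0.
have e1 : 0 < e / (nrm c + 1) by rewrite divr_gt0.
have eE : nrm c * (e / (nrm c + 1)) + e / (nrm c + 1) = e.
  by rewrite -[X in _ + X]mul1r -mulrDl mulrC divfK // gt_eqF.
have [f [fl f1 f2]] := XY _ e1; have [g [gl g1 g2]] := XY' _ e1.
have hl := l1_comb c fl gl.
exists (c *: f + g); split=> //.
- have := opbd1_comb c f1 g1; rewrite eE; apply: opbd1_eq => xi xil.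
  rewrite -[RHS]/((c *: X + X') xi - pit (c *: f + g) xi) (pi_comb fl gl hl xil).
  rewrite -[LHS]/(c *: (X xi - pit f xi) + (X' xi - pit g xi)).
  by rewrite -[(c *: pit f + pit g) xi]/(c *: pit f xi + pit g xi) scalerBr opprD addrACA.
- have := opbd1_comb c f2 g2; rewrite eE; apply: opbd1_eq => xi xil.
  rewrite (multiply_comb c FM fl gl).
  have l' := l1_comb c (mult_l1 FM fl) (mult_l1 FM gl).
  rewrite -[RHS]/((c *: Y + Y') xi - pit (c *: multiply F f + multiply F g) xi).
  rewrite (pi_comb (mult_l1 FM fl) (mult_l1 FM gl) l' xil).
  rewrite -[LHS]/(c *: (Y xi - pit (multiply F f) xi) + (Y' xi - pit (multiply F g) xi)).
  rewrite -[(c *: pit _ + pit _) xi]/(c *: pit (multiply F f) xi + pit (multiply F g) xi).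
  by rewrite scalerBr opprD addrACA.
Qed.

Lemma graph_sub M F X Y X' Y' : mult M F -> graph F X Y -> graph F X' Y' ->
  graph F (X - X') (Y - Y').
Proof.
move=> FM XY XY'; have := graph_comb (-1) FM XY' XY.
by rewrite !scaleN1r ![- _ + _]addrC.
Qed.

(** The tolerance d of the graph is chosen after m and absorbs the factor m^2 of entrywise
    estimates. With X = 0 and c = 0 this is uniqueness of the value up to norm 0. *)
Lemma graph_bound m M F (X Y : 'M[op]_m) (c : R) : mult M F ->
  (forall i j, graph F (X i j) (Y i j)) -> opbd c X -> opbd (M * c) Y.
Proof.
move=> FM XY cX; have [[M0 h] _ _] := FM; have c0 := opbd_ge0 cX.
apply: opbd_eps => [|e e0]; first exact: mulr_ge0.
have D0 : 0 < m%:R ^+ 2 * (M + 1) + 1 :> R by rewrite ltr_wpDl // mulr_ge0 ?sqr_ge0 // addr_ge0.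
pose d := e / (m%:R ^+ 2 * (M + 1) + 1).
have d0 : 0 < d by rewrite divr_gt0.
pose f i j := sval (cid (XY i j d d0)).
have hf i j : [/\ l1 (f i j), opbd1 d (X i j - pit (f i j)) &
    opbd1 d (Y i j - pit (multiply F (f i j)))] := svalP (cid (XY i j d d0)).
pose fm : 'M[int -> A]_m := \matrix_(i, j) f i j.
have a1 : opbd (m%:R ^+ 2 * d) (X - map_mx pit fm).
  apply: opbd_entries; first exact: ltW.
  by move=> i j; rewrite !mxE; case: (hf i j).
have a2 : opbd (m%:R ^+ 2 * d) (Y - map_mx (fun g => pit (multiply F g)) fm).
  apply: opbd_entries; first exact: ltW.
  by move=> i j; rewrite !mxE; case: (hf i j).
have a3 : opbd (c + m%:R ^+ 2 * d) (map_mx pit fm).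
  by have := opbdB cX a1; rewrite opprB [X in opbd _ X]addrC subrK.
have fml i j : l1 (fm i j) by rewrite mxE; case: (hf i j).
have := opbdD a2 (h m fm _ fml a3); rewrite subrK; apply: opbd_le.
have : d * (m%:R ^+ 2 * (M + 1) + 1) = e by rewrite /d divfK // gt_eqF.
move: (m%:R ^+ 2 : R) => q hq; nra.
Qed.

Lemma graph_comp M M' F G X Z W : mult M F -> mult M' G ->
  graph F X Z -> graph G Z W -> graph (fun s a => G s (F s a)) X W.
Proof.
move=> FM GM XZ ZW e e0; have [[M0 _] _ _] := GM.
(* The composite error is d for the second graph plus M' times the distance d + d between its
   approximant g and the image of f. *)
have D0 : 0 < 2 * M' + 2 by rewrite ltr_wpDl ?mulr_ge0.
pose d := e / (2 * M' + 2).
have d0 : 0 < d by rewrite divr_gt0.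
have de : d * (2 * M' + 2) = e by rewrite /d divfK // gt_eqF.
have [f [fl f1 f2]] := XZ _ d0; have [g [gl g1 g2]] := ZW _ d0.
have fl' := mult_l1 FM fl.
have fg : opbd1 (d + d) (pit g - pit (multiply F f)).
  have := opbd1D f2 (opbd1N g1); apply: opbd1_eq => xi _.
  rewrite -[LHS]/((Z xi - pit (multiply F f) xi) - (Z xi - pit g xi)).
  rewrite -[RHS]/(pit g xi - pit (multiply F f) xi).
  by rewrite opprB addrC addrA subrK.
have fg' := mult_change GM gl fl' fg.
exists f; split=> //; first by apply: opbd_le f1; nra.
have h := opbd1D g2 fg'; rewrite addrA subrK in h.
by apply: opbd_le h; nra.
Qed.
End GraphClosure.

(** * Existence of graph values in the crossed product *)

Section GraphExistence.
Variables (R : realType) (H : completeNormedModType R[i]).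
Variables (dot : {dot H for Num.conj}) (rho : (circle R -> R[i]) -> H -> H) (theta : R).
Hypotheses (hdot : hilbert_dot dot) (hrho : faithful_rep dot rho).
Local Notation T := (circle R).
Local Notation C := R[i].
Local Notation A := (T -> C).
Local Notation op := (@l2op R H).
Local Notation rot := (rotation theta).
Local Notation l1 := (l1 (@C_circle R) rho).
Local Notation pit := (pi_tilde rho rot).
Local Notation crossed := (crossed_product (@C_circle R) rho rot).
Local Notation S_map := (@S_map R H (circle R -> R[i]) (@C_circle R) rho rot).
Local Notation graph := (graph rho theta).
Local Notation mult := (mult rho theta).
Implicit Types (F G : int -> A -> A) (f g : int -> A) (X Y Z : op).

Lemma isl2_comb (c : C) (xi eta : int -> H) : isl2 xi -> isl2 eta -> isl2 (c *: xi + eta).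
Proof.
move=> [K hK] [L hL]; exists (2 * (nrm c ^+ 2 * K) + 2 * L) => n.
apply: (@le_trans _ _ (win n (fun s => 2 * (nrm c ^+ 2 * nrm (xi s) ^+ 2) + 2 * nrm (eta s) ^+ 2))).
  apply: ler_win => s _; rewrite -exprMn -nrmZ.
  have := @nrm_sqrD R H 1 (c *: xi s) (eta s) ltr01; rewrite invr1.
  by rewrite (_ : 1 + 1 = 2).
rewrite winD !winM lerD // ler_wpM2l // ler_wpM2l ?sqr_ge0 //.
Qed.

Lemma op_norm1_ltP X (e : R) : (l2op_norm1 X < e%:E)%E <-> exists c, c < e /\ opbd1 c X.
Proof. exact: l2op_norm_ltP. Qed.

Definition linear_op X := forall (c : C) xi eta, isl2 xi -> isl2 eta ->
  forall s, X (c *: xi + eta) s = c *: X xi s + X eta s.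

Lemma crossedP X : @os_set R crossed X <->
  linear_op X /\ (forall e : R, 0 < e -> exists2 f, l1 f & opbd1 e (X - pit f)).
Proof.
split=> [[[lX _] aX]|[lX aX]].
  split=> [c xi eta /l2P xil /l2P etal s|e e0]; first exact: lX.
  have [f [fl /op_norm1_ltP[c [ce cX]]]] := aX e e0.
  by exists f => //; apply: opbd_le cX; exact: ltW.
split.
  split=> [c xi eta /l2P xil /l2P etal s|]; first exact: lX.
  have [f fl fX] := aX 1 ltr01.
  have [S fS] := (l1P hdot hrho f).1 fl.
  have h := opbd1D fX (opbd1_pi theta hdot hrho fS); rewrite subrK in h.
  apply: le_lt_trans (_ : ((1 + S)%:E < +oo)%E); last exact: ltry.
  by apply/l2op_normP => //; exact: opbd_ge0 h.
move=> e e0; have e2 : 0 < e / 2 by rewrite divr_gt0.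
have [f fl fX] := aX _ e2; exists f; split=> //; apply/op_norm1_ltP.
by exists (e / 2); split=> //; lra.
Qed.

Lemma pi_linear_op f : l1 f -> linear_op (pit f).
Proof. by move=> fl c xi eta xil etal s; apply: pi_linear => //; exact: isl2_comb. Qed.

Lemma pi_crossed f : l1 f -> @os_set R crossed (pit f).
Proof.
move=> fl; apply/crossedP; split; first exact: pi_linear_op.
by move=> e e0; exists f => //; rewrite subrr; apply: opbd1_0; exact: ltW.
Qed.

(** The images of l1 approximants of X are Cauchy in norm by the multiplier bound. Completeness of H
    gives a coordinatewise limit, and [opbd_lim] recovers the norm estimate for it. *)
Lemma graph_exists M F X : mult M F -> @os_set R crossed X ->
  exists Y, @os_set R crossed Y /\ graph F X Y.
Proof.
move=> FM /crossedP[lX aX]; have [[M0 _] _ _] := FM.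
have p n : 0 < n.+1%:R^-1 :> R by rewrite invr_gt0 ltr0n.
have ex n := aX _ (p n).
pose f n := s2val (cid2 (ex n)).
have fl n : l1 (f n) := s2valP (cid2 (ex n)).
have fX n : opbd1 n.+1%:R^-1 (X - pit (f n)) := s2valP' (cid2 (ex n)).
pose Yn n := pit (multiply F (f n)).
have Ynm (n m : nat) : opbd1 (M * (m.+1%:R^-1 + n.+1%:R^-1)) (Yn n - Yn m).
  apply: (mult_change hdot hrho FM (fl n) (fl m)).
  have := opbd1D (fX m) (opbd1N (fX n)); apply: opbd1_eq => xi _.
  rewrite -[LHS]/((X xi - pit (f m) xi) - (X xi - pit (f n) xi)).
  rewrite -[RHS]/(pit (f n) xi - pit (f m) xi).
  by rewrite opprB addrC addrA subrK.
have inv_small (e : R) : 0 < e -> exists N, forall n, (N <= n)%N -> n.+1%:R^-1 <= e.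
  move=> e0; exists (Num.trunc e^-1) => n hn.
  have e1 : 0 <= e^-1 by rewrite invr_ge0 ltW.
  have /andP[_ h] := trunc_itv e1.
  rewrite invf_ple ?posrE ?ltr0n //; apply: le_trans (ltW h) _.
  by rewrite ler_nat.
(* Off l2 this limit may be a default value; no estimate looks there. *)
pose Y : op := fun xi t => limn (fun n => Yn n xi t).
have YnY xi t : isl2 xi -> tends (fun n => Yn n xi t) (Y xi t).
  move=> [K xiK]; suff /cauchy_tends[l hl] : cauchy (fun n => Yn n xi t).
    by rewrite /Y (tends_lim hl).
  move=> e e0; have q0 := sqrtr_ge0 K.
  have D0 : 0 < 2 * M * Num.sqrt K + 1 by rewrite ltr_wpDl // !mulr_ge0.
  have d0 : 0 < e / (2 * M * Num.sqrt K + 1) / 2 by rewrite !divr_gt0.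
  have [N hN] := inv_small _ d0; exists N => n Nn.
  apply: le_lt_trans (opbd1_point t (Ynm n N) xiK) _.
  have h1 := hN n Nn; have h2 := hN N (leqnn N).
  set d := e / _ in d0 h1 h2.
  have dE : d * (2 * M * Num.sqrt K + 1) = e by rewrite /d divfK // gt_eqF.
  clearbody d; have dp : 0 < d by lra.
  have : M * (N.+1%:R^-1 + n.+1%:R^-1) <= M * d by rewrite ler_wpM2l // [d]splitr lerD.
  move=> /(ler_wpM2r q0) /le_lt_trans; apply; rewrite -dE.
  have : 0 <= d * (M * Num.sqrt K) by rewrite !mulr_ge0 // ltW.
  nra.
have YnY1 (n : nat) : opbd1 (M * (n.+1%:R^-1 + n.+1%:R^-1)) (Y - Yn n).
  apply: (@opbd_lim R H 1 _ (fun m => const_mx (Yn m - Yn n))).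
  - by rewrite mulr_ge0 // addr_ge0 // ltW.
  - move=> i j xi xil t; rewrite mxE; under eq_fun do rewrite mxE.
    exact: tendsD (YnY xi t xil) (tends_cst _).
  - move=> e e0; exists n => m nm; apply: opbd_le (Ynm m n).
    apply: (@le_trans _ _ (M * (n.+1%:R^-1 + n.+1%:R^-1))); last by rewrite lerDl ltW.
    by rewrite ler_wpM2l // lerD2l lef_pV2 ?posrE ?ltr0n // ler_nat.
exists Y; split.
  apply/crossedP; split.
    move=> c xi eta xil etal s; have l := isl2_comb c xil etal.
    apply: tends_unique (YnY _ s l) _.
    have := tendsD (tendsZ c (YnY _ s xil)) (YnY _ s etal); congr tends; apply/funext => n.
    exact (esym (pi_linear_op (mult_l1 hdot hrho FM (fl n)) c xil etal s)).
  move=> e e0.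
  have d0 : 0 < e / (2 * M + 1) by rewrite divr_gt0 // ltr_wpDl ?mulr_ge0.
  have [N /(_ N (leqnn N)) hN] := inv_small _ d0.
  exists (multiply F (f N)); first exact: (mult_l1 hdot hrho FM (fl N)).
  apply: opbd_le (YnY1 N).
  have : e / (2 * M + 1) * (2 * M + 1) = e by rewrite divfK // gt_eqF // ltr_wpDl ?mulr_ge0.
  have := ler_wpM2l M0 hN; rewrite [M * (_ + _)]mulrDr.
  by move: (e / _) (M * N.+1%:R^-1) d0 => d q d0 h1 h2; nra.
move=> e e0.
have d0 : 0 < e / (2 * M + 1) by rewrite divr_gt0 // ltr_wpDl ?mulr_ge0.
have [N /(_ N (leqnn N)) hN] := inv_small _ d0.
have dE : e / (2 * M + 1) * (2 * M + 1) = e by rewrite divfK // gt_eqF // ltr_wpDl ?mulr_ge0.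
have hM := ler_wpM2l M0 hN.
move: (e / _) d0 hN hM dE => d d0 hN hM dE.
exists (f N); split=> //; [apply: opbd_le (fX N)|apply: opbd_le (YnY1 N)].
  by apply: le_trans hN _; nra.
by rewrite mulrDr; move: (M * N.+1%:R^-1) hM => q hM; nra.
Qed.

(** [graph_exists] makes the set searched by [xget] nonempty, so the selected value belongs to it
    and is not a fallback. *)
Lemma S_map_graph M F X : mult M F -> @os_set R crossed X ->
  @os_set R crossed (S_map F X) /\ graph F X (S_map F X).
Proof.
move=> FM Xc; have [Y [Yc XY]] := graph_exists FM Xc.
have ex : exists Y : crossed, os_set Y /\
    forall e : R, 0 < e -> exists f, [/\ l1 f,
      (l2op_norm1 (X - pit f) < e%:E)%E &
      (l2op_norm1 (Y - pit (multiply F f)) < e%:E)%E].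
  exists Y; split=> // e e0; have e2 : 0 < e / 2 by rewrite divr_gt0.
  have [f [fl f1 f2]] := XY _ e2; exists f; split=> //; apply/op_norm1_ltP;
  by exists (e / 2); split=> //; lra.
have := xgetPex 0 ex; rewrite -/(S_map F X) => -[h1 h2]; split=> // e e0.
have [f [fl /op_norm1_ltP[c [ce cX]] /op_norm1_ltP[c' [ce' cX']]]] := h2 e e0.
by exists f; split=> //; [apply: opbd_le cX|apply: opbd_le cX']; exact: ltW.
Qed.

End GraphExistence.

(** * Convergence on finite dimensional spans, uniformly in the matrix size *)

Section FiniteDimension.
Variables (R : realType) (H : completeNormedModType R[i]).
Variables (dot : {dot H for Num.conj}).
Hypothesis hdot : hilbert_dot dot.
Local Notation C := R[i].
Local Notation op := (@l2op R H).
Implicit Types (X Y Z : op).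

(** Separate bounds for the components whose sum stays below K: applying one operator to each
    component then loses no factor m. *)
Lemma l2bd_split m (xi : 'I_m -> int -> H) (K : R) : l2bd xi K -> exists D : 'I_m -> R,
  (forall j n, win n (fun s => nrm (xi j s) ^+ 2) <= D j) /\ \sum_(j < m) D j <= K.
Proof.
move=> xiK; have h := (sum_l2_sqP xi K).2 xiK.
have fin j : l2_sq (xi j) \is a fin_num.
  rewrite ge0_fin_numE; last exact: l2_sq_ge0.
  by apply/l2P; exact: l2bd_isl2 xiK.
exists (fun j => fine (l2_sq (xi j))); split=> [j|].
  apply: (esum_winP (g := fun s => nrm (xi j s) ^+ 2) _ (fun s => sqr_ge0 _)).1.
  by rewrite fineK.
rewrite -lee_fin -sumEFin; apply: le_trans h; rewrite le_eqVlt; apply/orP; left; apply/eqP.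
by apply: eq_bigr => j _; rewrite fineK.
Qed.

(** At each s the scalar matrix c mixes the vectors Z (xi j) s, so [scbd_vector] applies and the
    bound is free of m. *)
Lemma opbd_scalar_tensor m (c : 'I_m -> 'I_m -> C) (k d : R) Z : 0 <= k ->
  scbd k c -> opbd1 d Z -> opbd (k * d) (\matrix_(i, j) (c i j *: Z) : 'M[op]_m).
Proof.
move=> k0 kc [d0 hZ]; split=> [|xi K xiK n]; first exact: mulr_ge0.
have [D [hD DK]] := l2bd_split xiK.
rewrite -win_sum.
apply: (@le_trans _ _ (win n (fun s => k ^+ 2 * \sum_(j < m) nrm (Z (xi j) s) ^+ 2))).
  apply: ler_win => s _; apply: le_trans (scbd_vector hdot (fun j => Z (xi j) s) kc).
  apply: ler_sum => i _; rewrite fct_sumE le_eqVlt; apply/orP; left; apply/eqP.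
  by congr (nrm _ ^+ 2); apply: eq_bigr => j _; rewrite mxE.
rewrite winM exprMn -[leRHS]mulrA ler_wpM2l ?sqr_ge0 // win_sum.
apply: le_trans (ler_wpM2l (sqr_ge0 d) DK); rewrite mulr_sumr; apply: ler_sum => j _.
by have := hZ _ _ (l2bd1 (hD j)) n; rewrite !big_ord1 mxE.
Qed.

(** The dependence on m and c is harmless where d can be taken small after both are known. *)
Lemma opbd_crude_tensor m (c : 'I_m -> 'I_m -> C) (d : R) Z : opbd1 d Z ->
  opbd (m%:R ^+ 2 * (\sum_(i < m) \sum_(j < m) nrm (c i j)) * d)
    (\matrix_(i, j) (c i j *: Z) : 'M[op]_m).
Proof.
move=> dZ; have d0 := opbd_ge0 dZ; rewrite -mulrA; apply: opbd_entries.
  by rewrite mulr_ge0 //; apply: sumr_ge0 => i _; apply: sumr_ge0 => j _; exact: nrm_ge0.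
move=> i j; rewrite mxE; have := opbdZ (c i j) dZ.
have le : nrm (c i j) * d <= (\sum_(i < m) \sum_(j < m) nrm (c i j)) * d.
  rewrite ler_wpM2r // (bigD1 i) //= (bigD1 j) //= -addrA lerDl addr_ge0 //.
    by apply: sumr_ge0 => k _; exact: nrm_ge0.
  by apply: sumr_ge0 => k _; apply: sumr_ge0 => l _; exact: nrm_ge0.
move=> h; apply: opbd_le le _; move: h; apply: opbd_eq => i' j' xi _; by rewrite !mxE.
Qed.

Definition lincomb k (y : 'I_k -> op) m (c : 'I_m -> 'I_m -> 'I_k -> C) : 'M[op]_m :=
  \matrix_(i, j) \sum_(l < k) c i j l *: y l.

(* A suitable combination of the entries of lincomb y c is a multiple of y 0 modulo
   the span of the other y l. *)
Lemma opbd_leading k (y : 'I_k.+1 -> op) m (c : 'I_m -> 'I_m -> 'I_k.+1 -> C) (b d : R) :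
  (forall l, linear_op (y l)) -> 0 < d ->
  (forall (t : 'I_k -> C) r, opbd1 r (y ord0 - \sum_(l < k) t l *: y (lift ord0 l)) -> d <= r) ->
  opbd b (lincomb y c) -> scbd (b / d) (fun i j => c i j ord0).
Proof.
move=> liny d0 hd hb u; have [b0 hb'] := hb.
pose g i := \sum_(j < m) c i j ord0 * u j.
set G := \sum_(i < m) _; set U := \sum_(j < m) _.
have GE : G = \sum_(i < m) nrm (g i) ^+ 2 by [].
have G0 : 0 <= G by apply: sumr_ge0 => i _; exact: sqr_ge0.
have U0 : 0 <= U by apply: sumr_ge0 => i _; exact: sqr_ge0.
have [G1|G1] := eqVneq G 0; first by rewrite G1 mulr_ge0 ?sqr_ge0.
have Gp : 0 < G by rewrite lt_neqAle eq_sym G1.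
(* The scalar matrices of coefficients are compressed between the test vector u and its image g
   under the leading one. The leading coefficient becomes the square norm G of g. *)
pose tau l := \sum_(i < m) (g i)^* * \sum_(j < m) u j * c i j l.
have tau0 : tau ord0 = G%:C%C.
  rewrite GE (rmorph_sum (real_complex R)); apply: eq_bigr => i _.
  transitivity (g i * (g i)^*); last exact: mul_conj.
  by rewrite mulrC; congr (_ * _); apply: eq_bigr => j _; exact: mulrC.
have lin0 l (a : C) xi : isl2 xi -> y l (a *: xi) = a *: y l xi.
  move=> xil; have z0 : isl2 (0 : int -> H).
    by exists 0 => n; rewrite (@eq_win _ _ _ (fun=> 0)) ?win0 // => s _; rewrite nrm0 expr0n.
  have yz : y l 0 = 0.
    apply/funext => s; have := liny l 1 0 0 z0 z0 s; rewrite scaler0 addr0 scale1r.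
    by move=> /(congr1 (fun v => v - y l 0 s)); rewrite addrK subrr.
  by apply/funext => s; have := liny l a xi 0 xil z0 s; rewrite addr0 yz addr0.
pose W : op := \sum_(l < k.+1) tau l *: y l.
have WE xi s : isl2 xi ->
    W xi s = \sum_(i < m) (g i)^* *: (\sum_(j < m) lincomb y c i j (u j *: xi)) s.
  move=> xil; rewrite /W !fct_sumE.
  transitivity (\sum_(l < k.+1) \sum_(i < m) \sum_(j < m)
      ((g i)^* * (u j * c i j l)) *: y l xi s).
    apply: eq_bigr => l _; rewrite -[LHS]/(tau l *: y l xi s) /tau scaler_suml.
    by apply: eq_bigr => i _; rewrite mulr_sumr scaler_suml.
  rewrite exchange_big; apply: eq_bigr => i _ /=; rewrite exchange_big fct_sumE scaler_sumr.
  apply: eq_bigr => j _ /=; rewrite mxE !fct_sumE scaler_sumr; apply: eq_bigr => l _.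
  rewrite -[(c i j l *: y l) _ _]/(c i j l *: y l (u j *: xi) s) (lin0 l _ _ xil).
  by rewrite -[(u j *: y l xi) s]/(u j *: y l xi s) !scalerA; congr (_ *: _); ring.
have Wb : opbd1 (Num.sqrt (G * (b ^+ 2 * U))) W.
  split=> [|xi K xiK n]; first exact: sqrtr_ge0.
  have xi1 n' : win n' (fun s => nrm (xi ord0 s) ^+ 2) <= K.
    by have := xiK n'; rewrite big_ord1.
  have xil : isl2 (xi ord0) by exists K.
  rewrite big_ord1 sqr_sqrtr; last by rewrite !mulr_ge0 ?sqr_ge0.
  apply: (@le_trans _ _ (win n (fun s => G * \sum_(i < m)
      nrm ((\sum_(j < m) lincomb y c i j (u j *: xi ord0)) s) ^+ 2))).
    apply: ler_win => s _; rewrite big_ord1 mxE WE //.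
    apply: le_trans (nrm_cauchy_schwarz _ _ _) _.
    rewrite GE le_eqVlt; apply/orP; left; apply/eqP; congr (_ * _).
    by apply: eq_bigr => i _; rewrite nrm_conj.
  rewrite winM -[leRHS]mulrA ler_wpM2l // win_sum.
  have uxi : l2bd (fun j => u j *: xi ord0) (U * K).
    move=> n'; rewrite /U mulr_suml; apply: ler_sum => j _.
    apply: le_trans (ler_wpM2l (sqr_ge0 (nrm (u j))) (xi1 n')).
    by rewrite -winM; apply: ler_win => s _; rewrite -exprMn -nrmZ.
  by have := hb' _ _ uxi n; rewrite mulrA.
(* W / G is y 0 plus a combination of the other y l, so any norm bound for it is at least d. *)
have := hd (fun l => - (G^-1)%:C%C * tau (lift ord0 l)) (nrm (G^-1)%:C%C * Num.sqrt (G * (b ^+ 2 * U))).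
have Gi : 0 < G^-1 by rewrite invr_gt0.
move=> /(_ _) h1; have {}h1 : d <= nrm (G^-1)%:C%C * Num.sqrt (G * (b ^+ 2 * U)).
  apply: h1; have := opbdZ (G^-1)%:C%C Wb; apply: opbd_eq => i j xi _; rewrite !mxE.
  congr (_ xi); rewrite /W big_ord_recl tau0 scalerDr scalerA.
  rewrite (_ : (G^-1)%:C%C * G%:C%C = 1) ?scale1r; last first.
    by rewrite -(rmorphM (real_complex R)) mulVf ?rmorph1.
  congr (_ + _); rewrite scaler_sumr -sumrN; apply: eq_bigr => l _.
  by rewrite scalerA -scaleNr mulNr opprK.
rewrite nrmC (gtr0_norm Gi) ler_pdivlMl // in h1.
have h2 : (G * d) ^+ 2 <= G * (b ^+ 2 * U).
  rewrite -[leRHS]sqr_sqrtr; last by rewrite !mulr_ge0 ?sqr_ge0.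
  by rewrite ler_pXn2r ?nnegrE ?sqrtr_ge0 ?mulr_ge0 // ltW.
have d2 : 0 < d ^+ 2 by rewrite exprn_gt0.
rewrite expr_div_n mulrAC ler_pdivlMr //.
by rewrite -(ler_pM2l Gp) mulrA -expr2 -exprMn.
Qed.

(* Either y 0 stays away from the span of the other y l, and then its
   coefficient is controlled, or it can be replaced by a combination of the
   others up to an arbitrarily small error. *)
Lemma finite_dim_uniform k (y : 'I_k -> op) (yn : nat -> 'I_k -> op) (K : R) : 0 <= K ->
  (forall l, linear_op (y l)) -> (forall l, exists S, opbd1 S (y l)) ->
  (forall l e, 0 < e -> exists N, forall n, (N <= n)%N -> opbd1 e (yn n l)) ->
  (forall n m (c : 'I_m -> 'I_m -> 'I_k -> C) b,
     opbd b (lincomb y c) -> opbd (K * b) (lincomb (yn n) c)) ->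
  forall e : R, 0 < e -> exists N, forall n, (N <= n)%N ->
    forall m (c : 'I_m -> 'I_m -> 'I_k -> C) b,
      opbd b (lincomb y c) -> opbd (e * b) (lincomb (yn n) c).
Proof.
elim: k y yn => [|k IH] y yn K0 liny Sy yn0 hK e e0.
  exists 0%N => n _ m c b hb; apply: opbd_le (_ : 0 <= e * b) _.
    by rewrite mulr_ge0 ?(ltW e0) // (opbd_ge0 hb).
  by rewrite (_ : lincomb _ _ = 0) ?opbd0 //; [exact: opbd0|apply/matrixP => i j; rewrite !mxE big_ord0].
pose y' l := y (lift ord0 l); pose yn' n l := yn n (lift ord0 l).
have recl (z : 'I_k.+1 -> op) m (c : 'I_m -> 'I_m -> 'I_k.+1 -> C) :
    lincomb z c = \matrix_(i, j) (c i j ord0 *: z ord0) +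
      lincomb (fun l => z (lift ord0 l)) (fun i j l => c i j (lift ord0 l)).
  by apply/matrixP => i j; rewrite !mxE big_ord_recl.
have hK' n m (c : 'I_m -> 'I_m -> 'I_k -> C) b :
    opbd b (lincomb y' c) -> opbd (K * b) (lincomb (yn' n) c).
  pose c1 i j l := if unlift ord0 l is Some l' then c i j l' else 0 : C.
  have E (z : 'I_k.+1 -> op) : lincomb z c1 = lincomb (fun l => z (lift ord0 l)) c.
    apply/matrixP => i j; rewrite !mxE big_ord_recl /c1 unlift_none scale0r add0r.
    by apply: eq_bigr => l _; rewrite liftK.
  by have := hK n m c1 b; rewrite !E.
have IH' := IH y' yn' K0 (fun l => liny _) (fun l => Sy _) (fun l => yn0 _) hK'.
have [S hS] := Sy ord0; have S0 := opbd_ge0 hS.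
have [[d [d0 hd]]|nd] := pselect (exists d, 0 < d /\ forall (t : 'I_k -> C) r,
    opbd1 r (y ord0 - \sum_(l < k) t l *: y' l) -> d <= r).
  (* The leading coefficient matrix has norm at most b/d, so removing the leading term leaves a
     combination of norm at most b (1 + S/d). The induction hypothesis is used with e/2 divided by
     this factor, and the leading term itself gets the other half. *)
  have D0 : 0 < 1 + S / d by rewrite ltr_pwDl // divr_ge0 // ltW.
  have e1 : 0 < e / 2 / (1 + S / d) by rewrite !divr_gt0.
  have e2 : 0 < e / 2 * d by rewrite mulr_gt0 // divr_gt0.
  have [N1 h1] := IH' _ e1; have [N2 h2] := yn0 ord0 _ e2.
  exists (maxn N1 N2) => n; rewrite geq_max => /andP[/h1 i1 /h2 i2] m c b hb.
  have b0 := opbd_ge0 hb.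
  have bd0 : 0 <= b / d by rewrite divr_ge0 // ltW.
  have sc := opbd_leading liny d0 hd hb.
  have t1 := opbd_scalar_tensor bd0 sc hS.
  have t2 := opbd_scalar_tensor bd0 sc i2.
  have := opbdB hb t1; rewrite recl [X in opbd _ X]addrC addrA addNr add0r => /i1 t3.
  rewrite recl; apply: opbd_le (opbdD t2 t3).
  rewrite le_eqVlt; apply/orP; left; apply/eqP; field.
  by rewrite gt_eqF // (_ : d + S = d * (1 + S / d)) ?mulf_neq0 ?gt_eqF //; field; rewrite gt_eqF.
have small (d : R) : 0 < d -> exists t : 'I_k -> C,
    opbd1 d (y ord0 - \sum_(l < k) t l *: y' l).
  move=> d0; apply: contrapT => nt; apply: nd; exists d; split=> // t r hr.
  by rewrite leNgt; apply/negP => rd; apply: nt; exists t; apply: opbd_le hr; exact: ltW.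
(* N is fixed before m and c are given. The quality d of the approximation of y 0 may then depend on
   them, since it enters only through the error q (e + K) d. *)
have [N hN] := IH' _ e0; exists N => n Nn m c b hb; have b0 := opbd_ge0 hb.
apply: opbd_eps => [|r r0]; first by rewrite mulr_ge0 // ltW.
pose q := m%:R ^+ 2 * (\sum_(i < m) \sum_(j < m) nrm (c i j ord0)).
have q0 : 0 <= q.
  rewrite mulr_ge0 ?sqr_ge0 //; apply: sumr_ge0 => i _; apply: sumr_ge0 => j _; exact: nrm_ge0.
have D0 : 0 < q * (e + K) + 1 by rewrite ltr_wpDl // mulr_ge0 // addr_ge0 // ltW.
pose d := r / (q * (e + K) + 1).
have d0 : 0 < d by rewrite divr_gt0.
have [t ht] := small d d0.
pose c' i j l := c i j (lift ord0 l) + c i j ord0 * t l.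
have E (z : 'I_k.+1 -> op) : lincomb z c =
    \matrix_(i, j) (c i j ord0 *: (z ord0 - \sum_(l < k) t l *: z (lift ord0 l))) +
    lincomb (fun l => z (lift ord0 l)) c'.
  apply/matrixP => i j; rewrite !mxE big_ord_recl scalerBr -addrA; congr (_ + _).
  rewrite scaler_sumr addrC -sumrB; apply: eq_bigr => l _.
  by rewrite /c' scalerDl scalerA addrK.
have t1 := opbd_crude_tensor (fun i j => c i j ord0) ht; rewrite -/q in t1.
have t2 : opbd1 (K * d) (yn n ord0 - \sum_(l < k) t l *: yn' n l).
  pose c1 (i j : 'I_1) l := if unlift ord0 l is Some l' then - t l' else 1 : C.
  have E1 (z : 'I_k.+1 -> op) : lincomb z c1 =
      const_mx (z ord0 - \sum_(l < k) t l *: z (lift ord0 l)).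
    apply/matrixP => i j; rewrite !mxE big_ord_recl /c1 unlift_none scale1r -sumrN.
    by congr (_ + _); apply: eq_bigr => l _; rewrite liftK scaleNr.
  by have := hK n 1 c1 d; rewrite !E1; apply.
have t3 := opbd_crude_tensor (fun i j => c i j ord0) t2; rewrite -/q in t3.
have := opbdB hb t1; rewrite (E y) [X in opbd _ X]addrC addrA addNr add0r => /(hN n Nn) t4.
rewrite (E (yn n)); apply: opbd_le (opbdD t3 t4).
have : d * (q * (e + K) + 1) = r by rewrite /d divfK // gt_eqF.
have : 0 <= q * d by rewrite mulr_ge0 // ltW.
nra.
Qed.

End FiniteDimension.

(** * Operations on multipliers and their restriction to C(T) *)

Section MultiplierAlgebra.
Variables (R : realType) (H : completeNormedModType R[i]).
Variables (dot : {dot H for Num.conj}) (rho : (circle R -> R[i]) -> H -> H) (theta : R).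
Hypotheses (hdot : hilbert_dot dot) (hrho : faithful_rep dot rho) (irr : irrational theta).
Local Notation T := (circle R).
Local Notation C := R[i].
Local Notation A := (T -> C).
Local Notation rot := (rotation theta).
Local Notation mbd := (mbd rho theta).
Local Notation pf := (pf rho theta).
Local Notation algS := (alg_space (@C_circle R) rho).
Local Notation l1 := (l1 (@C_circle R) rho).
Local Notation pit := (pi_tilde rho rot).
Local Notation Mbd := (Mbd rho theta).
Local Notation dominated := (dominated rho).
Local Notation mult := (mult rho theta).
Implicit Types (a b : A) (F G : int -> A -> A) (f g : int -> A).

Lemma pf0E f xi t : pf 0 f xi t = rho (rot (- t) (f 0)) (xi t).
Proof. by rewrite /pf /win big_ord1 /= subrr subr0. Qed.

(** A function supported at 0 gives an operator diagonal in t, whose blocks are rotations of x and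
    so have the same bound by [alg_bd_rotate]. *)
Lemma alg_bd_pf0 m (x : 'I_m -> 'I_m -> A) (c : R) : (forall i j, C_circle (x i j)) ->
  alg_bd rho c x -> opbd c (map_mx (pf 0) (\matrix_(i, j) (fun=> x i j) : 'M[int -> A]_m)).
Proof.
move=> xC cx; have [c0 _] := cx; split=> // xi K xiK n; rewrite -win_sum.
apply: (@le_trans _ _ (win n (fun t => c ^+ 2 * \sum_(j < m) nrm (xi j t) ^+ 2))).
  apply: ler_win => t _.
  have [_ h] := alg_bd_rotate hdot hrho (circle_exp ((- t)%:~R * theta)) xC cx.
  apply: le_trans (h (fun j => xi j t)); rewrite le_eqVlt; apply/orP; left; apply/eqP.
  apply: eq_bigr => i _; rewrite fct_sumE; congr (nrm _ ^+ 2); apply: eq_bigr => j _.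
  by rewrite !mxE pf0E.
by rewrite winM win_sum ler_wpM2l ?sqr_ge0.
Qed.

Lemma pf0_alg_bd m (f : 'M[int -> A]_m) (c : R) : (forall i j, C_circle (f i j 0)) ->
  opbd c (map_mx (pf 0) f) -> alg_bd rho c (fun i j => f i j 0).
Proof.
move=> fC [c0 h]; split=> // v.
have vK : l2bd (fun j s => if s == 0 then v j else 0) (\sum_(j < m) nrm (v j) ^+ 2).
  move=> n; apply: ler_sum => j _; rewrite (@win_single _ _ _ 0) ?eqxx // => r /negbTE ->.
  by rewrite nrm0 expr0n.
have := h _ _ vK 0%N; apply: le_trans; apply: ler_sum => i _.
rewrite /win big_ord1 fct_sumE le_eqVlt; apply/orP; left; apply/eqP; congr (nrm _ ^+ 2).
by apply: eq_bigr => j _; rewrite mxE pf0E eqxx rotation0.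
Qed.

(** The multiplier bound restricted to functions supported at 0; the block at t = 0 recovers the
    matrix over C(T) itself. *)
Lemma mbd_alg_bd (L : A -> A) (M : R) m (x : 'I_m -> 'I_m -> A) (c : R) :
  (forall a, C_circle a -> C_circle (L a)) -> mbd M (fun=> L) ->
  (forall i j, C_circle (x i j)) -> alg_bd rho c x -> alg_bd rho (M * c) (fun i j => L (x i j)).
Proof.
move=> LC [M0 h] xC cx.
have fC i j s : C_circle ((\matrix_(i, j) (fun=> x i j) : 'M[int -> A]_m) i j s).
  by rewrite mxE; exact (xC i j).
have := h m _ 0%N c fC (alg_bd_pf0 xC cx); set g := map_mx _ _.
have E : g = map_mx (pf 0) (\matrix_(i, j) (fun=> L (x i j))).
  by apply/matrixP => i j; rewrite !mxE.
rewrite E => h1.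
have LxC i j : C_circle ((\matrix_(i, j) (fun=> L (x i j)) : 'M[int -> A]_m) i j 0).
  by rewrite mxE; exact (LC _ (xC i j)).
have [c0 h2] := pf0_alg_bd LxC h1.
split=> // v; apply: le_trans (h2 v); rewrite le_eqVlt; apply/orP; left; apply/eqP.
by apply: eq_bigr => i _; congr (nrm _ ^+ 2); apply: eq_bigr => j _; rewrite mxE.
Qed.

Lemma alg_bdZ m (x : 'I_m -> 'I_m -> A) (c : R) (u : C) : (forall i j, C_circle (x i j)) ->
  alg_bd rho c x -> alg_bd rho (nrm u * c) (fun i j => u *: x i j).
Proof.
move=> xC [c0 h]; split=> [|v]; first by rewrite mulr_ge0 ?nrm_ge0.
rewrite exprMn -mulrA; apply: le_trans (ler_wpM2l (sqr_ge0 (nrm u)) (h v)).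
rewrite mulr_sumr le_eqVlt; apply/orP; left; apply/eqP; apply: eq_bigr => i _.
rewrite -exprMn -nrmZ scaler_sumr; congr (nrm _ ^+ 2); apply: eq_bigr => j _.
by rewrite (rhoZ hrho _ _ (xC i j)).
Qed.

Lemma cb_norm_alg_le (L : A -> A) (M : R) : 0 <= M ->
  (forall m (x : 'I_m -> 'I_m -> A), (forall i j, C_circle (x i j)) -> alg_bd rho 1 x ->
     alg_bd rho M (fun i j => L (x i j))) ->
  (@cb_norm R algS algS L <= M%:E)%E.
Proof.
move=> M0 h; apply: ge_ereal_sup => _ [m [x [xC x1 ->]]].
apply/(alg_norm_leP rho _ M0).
have := h m _ xC ((alg_norm_leP rho x ler01).1 x1).
rewrite /alg_bd => -[_ h2]; split=> // v; apply: le_trans (h2 v).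
rewrite le_eqVlt; apply/orP; left; apply/eqP.
by apply: eq_bigr => i _; congr (nrm _ ^+ 2); apply: eq_bigr => j _; rewrite mxE.
Qed.

Lemma anorm_mbd (L : A -> A) (M : R) a : (forall a, C_circle a -> C_circle (L a)) ->
  mbd M (fun=> L) -> C_circle a -> anorm rho (L a) <= M * anorm rho a.
Proof.
move=> LC LM aC.
have ca : alg_bd rho (anorm rho a) (fun _ _ : 'I_1 => a).
  split=> [|v]; first exact: anorm_ge0.
  rewrite !big_ord1 -exprMn ler_pXn2r ?nnegrE ?nrm_ge0 ?mulr_ge0 ?nrm_ge0 ?anorm_ge0 //.
  exact: (anormP hdot hrho _ aC).
have [c0 h] := mbd_alg_bd LC LM (fun _ _ => aC) ca.
apply: (anorm_le hdot hrho (LC _ aC) c0) => v.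
have := h (fun=> v); rewrite !big_ord1 -exprMn ler_pXn2r ?nnegrE ?nrm_ge0 //.
by rewrite mulr_ge0 ?nrm_ge0.
Qed.

Lemma nrm_coefI_le (x y : int -> C) (a b : R) s : sqbd x a -> sqbd y b ->
  nrm (coefI x y s) <= a ^+ 2 + b ^+ 2.
Proof.
move=> xa yb; apply: tends_nrm_le (coef_tends s xa yb) _; exists 0%N => n _.
by apply: le_trans (coef_summable s xa yb n); exact: ler_nrm_sum.
Qed.

Lemma Mbd_l2op_norm (M : R) F : Mbd M F -> forall m (f : 'M[int -> A]_m),
  (forall i j, l1 (f i j)) ->
  (l2op_norm (map_mx (fun g => pit (multiply F g)) f)
     <= (M + 1)%:E * l2op_norm (map_mx pit f))%E.
Proof.
(* M may be 0, and 0 times +oo is 0; the factor M + 1 keeps the right-hand side infinite when the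
   norm is. *)
move=> [M0 h] m f fl; have M1 : 0 < M + 1 by rewrite ltr_wpDl.
have [[c fc]|fy] : (exists c : R, l2op_norm (map_mx pit f) = c%:E) \/
    l2op_norm (map_mx pit f) = +oo%E.
  have : (0 <= l2op_norm (map_mx pit f))%E.
    by apply: le_ereal_inf_tmp => _ [c [c0 _] <-]; rewrite lee_fin.
  by case: (l2op_norm _) => [r| |] // _; [left; exists r|right].
  have c0 : 0 <= c.
    rewrite -lee_fin -fc; apply: le_ereal_inf_tmp => _ [d [d0 _] <-]; by rewrite lee_fin.
  have fc' : opbd c (map_mx pit f) by apply/(l2op_normP _ c0); rewrite fc.
  rewrite fc -EFinM; apply/(l2op_normP _ (mulr_ge0 (ltW M1) c0)).
  by apply: opbd_le (h m f c fl fc'); rewrite ler_wpM2r // lerDl.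
by rewrite fy gt0_muley ?lte_fin // leey.
Qed.

Lemma dominated_ext K F G : (forall s a, C_circle a -> F s a = G s a) ->
  dominated K F -> dominated K G.
Proof.
move=> FG [K0 h]; refine (conj K0 _) => s a aC; rewrite -(FG s a aC); exact (h s a aC).
Qed.

Lemma mult_ext M F G : (forall s a, C_circle a -> F s a = G s a) -> mult M F -> mult M G.
Proof.
move=> FG [[M0 h] [K FK] linF]; split.
- split=> // m f c fl fc.
  have -> : map_mx (fun g => pit (multiply G g)) f = map_mx (fun g => pit (multiply F g)) f.
    apply/matrixP => i j; rewrite !mxE; congr pit; apply/funext => s.
    by rewrite /multiply (FG s _ (l1_C (fl i j))).
  exact: h.
- by exists K; exact: dominated_ext FK.
- move=> s c g k gC kC; rewrite -(FG s g gC) -(FG s k kC) -(FG s _ (C_circle_comb gC kC)).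
  exact (linF s c g k gC kC).
Qed.

Lemma mult_le (M M' : R) F : M <= M' -> mult M F -> mult M' F.
Proof.
move=> MM' [[M0 h] FK linF]; refine (And3 _ FK linF); split=> [|m f c fl fc].
  exact: le_trans MM'.
by apply: opbd_le (h m f c fl fc); rewrite ler_wpM2r // (opbd_ge0 fc).
Qed.

Lemma mult_comb (c : C) (M M' : R) F G : mult M F -> mult M' G ->
  mult (nrm c * M + M') (fun s a => c *: F s a + G s a).
Proof.
move=> FM GM; have [[M0 hF] [K [K0 FK]] linF] := FM; have [[M0' hG] [K' [K0' GK]] linG] := GM.
split.
- split=> [|m f k fl fk]; first by rewrite addr_ge0 ?mulr_ge0 ?nrm_ge0.
  have := opbdD (opbdZ c (hF m f k fl fk)) (hG m f k fl fk).
  rewrite mulrDl -mulrA; apply: opbd_eq => i j xi xil; rewrite !mxE.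
  have F1 := mult_l1 hdot hrho FM (fl i j); have G1 := mult_l1 hdot hrho GM (fl i j).
  exact (esym (pi_comb theta hdot hrho F1 G1 (l1_comb hdot hrho c F1 G1) xil)).
- exists (nrm c * K + K'); split=> [|s a aC]; first by rewrite addr_ge0 ?mulr_ge0 ?nrm_ge0.
  have [FC Fa] := FK s a aC; have [GC Ga] := GK s a aC; split; first exact (C_circle_comb FC GC).
  apply: le_trans (anormD hdot hrho (C_circleZ FC) GC) _; rewrite mulrDl lerD //.
  apply: le_trans (anormZ hdot hrho c FC) _; rewrite -mulrA ler_wpM2l ?nrm_ge0 //.
- move=> s d g k gC kC; rewrite (linF s d _ _ gC kC) (linG s d _ _ gC kC).
  by rewrite scalerDr scalerA mulrC -scalerA scalerDr addrACA.
Qed.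

Lemma mult_sub (M M' : R) F G : mult M F -> mult M' G ->
  mult (M' + M) (fun s a => F s a - G s a).
Proof.
move=> FM GM; have := mult_comb (-1) GM FM; rewrite nrmN nrm1 mul1r.
by apply: mult_ext => s a _; rewrite scaleN1r addrC.
Qed.

Lemma mult_comp (M M' : R) F G : mult M F -> mult M' G ->
  mult (M * M') (fun s a => F s (G s a)).
Proof.
move=> FM GM; have [[M0 hF] [K [K0 FK]] linF] := FM; have [[M0' hG] [K' [K0' GK]] linG] := GM.
split.
- split=> [|m f k fl fk]; first exact: mulr_ge0.
  have gl i j : l1 (map_mx (multiply G) f i j).
    by rewrite mxE; exact: (mult_l1 hdot hrho GM (fl i j)).
  have := hF m (map_mx (multiply G) f) (M' * k) gl; rewrite mulrA => h.
  have {h} := h _; rewrite -!map_mx_comp; apply; exact: hG.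
- exists (K * K'); split=> [|s a aC]; first exact: mulr_ge0.
  have [GC Ga] := GK s a aC; have [FC Fa] := FK s _ GC; split; first exact FC.
  by apply: le_trans Fa _; rewrite -mulrA ler_wpM2l.
- move=> s d g k gC kC; rewrite (linG s d _ _ gC kC).
  exact (linF s d _ _ (GK s _ gC).1 (GK s _ kC).1).
Qed.

Lemma anorm_convolution (p : A) a : L1_circle p -> C_circle a ->
  anorm rho (convolution p a) <= L1norm p * anorm rho a.
Proof.
move=> pL aC; refine (anorm_mbd (fun b bC => C_circle_convolution pL bC) _ aC).
exact: (mbd_convolution hdot hrho irr pL).
Qed.

Lemma mult_conv (p : A) (x y : int -> C) (a b : R) : L1_circle p -> 0 <= a -> 0 <= b ->
  sqbd x a -> sqbd y b -> mult (a * b * L1norm p) (conv_multiplier p (coefI x y)).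
Proof.
move=> pL a0 b0 xa yb.
have pres : presC (fun _ : int => convolution p).
  move=> s g gC; exact (C_circle_convolution pL gC).
have dom : dominated ((a ^+ 2 + b ^+ 2) * L1norm p) (conv_multiplier p (coefI x y)).
  split=> [|s g gC]; first by rewrite mulr_ge0 ?L1norm_ge0 // addr_ge0 ?sqr_ge0.
  have C1 := C_circle_convolution pL gC; split; first exact (C_circleZ C1).
  apply: le_trans (anormZ hdot hrho _ C1) _; rewrite -mulrA.
  apply: (ler_pM (nrm_ge0 _) (anorm_ge0 _ _) (nrm_coefI_le s xa yb)).
  exact (anorm_convolution pL gC).
split.
- apply: (mbd_Mbd hdot hrho dom).
  exact: (mbd_comp pres (mbd_fourier theta hdot hrho a0 b0 xa yb) (mbd_convolution hdot hrho irr pL)).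
- by eexists; exact: dom.
- move=> s c g k gC kC; rewrite /conv_multiplier (convolution_combr c pL gC kC).
  by rewrite scalerDr !scalerA mulrC.
Qed.

Lemma l1_0 : l1 (0 : int -> A).
Proof.
apply/(l1P hdot hrho); exists 0; split=> [s|n]; first exact (@C_circle0 R).
rewrite (@eq_win _ _ _ (fun=> 0)) ?win0 // => s _.
apply/eqP; rewrite eq_le anorm_ge0 andbT; apply: (anorm_sup_le hdot hrho (@C_circle0 R)) => z.
by rewrite -[X in nrm X]/(0 : C) nrm0.
Qed.

Lemma pi_0 : pit (0 : int -> A) = 0.
Proof.
apply/funext => xi; apply/funext => t; rewrite /pi_tilde (@zsum_finite _ _ _ 0%N).
  rewrite (@eq_win _ _ _ (fun=> 0)) ?win0 // => s _; exact: (rho0 hrho).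
by move=> s _; exact: (rho0 hrho).
Qed.

Lemma l1_sum (I : Type) (r : seq I) (c : I -> C) (g : I -> int -> A) :
  (forall i, l1 (g i)) -> l1 (\sum_(i <- r) c i *: g i).
Proof.
move=> gl; elim: r => [|i r IH]; first by rewrite big_nil; exact: l1_0.
by rewrite big_cons; exact: l1_comb.
Qed.

Lemma pi_sum (I : Type) (r : seq I) (c : I -> C) (g : I -> int -> A) xi :
  (forall i, l1 (g i)) -> isl2 xi ->
  pit (\sum_(i <- r) c i *: g i) xi = (\sum_(i <- r) c i *: pit (g i)) xi.
Proof.
move=> gl xil; elim: r => [|i r IH]; first by rewrite !big_nil pi_0.
have sl := l1_sum r c gl.
rewrite !big_cons (pi_comb theta hdot hrho (gl i) sl (l1_comb hdot hrho _ (gl i) sl) xil).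
by rewrite -[LHS]/(c i *: pit (g i) xi + pit (\sum_(i <- r) c i *: g i) xi) IH.
Qed.

End MultiplierAlgebra.

(** * The multipliers F_{T_f,u} are completely compact *)

Section ConvolutionMultipliers.
Variables (R : realType) (H : completeNormedModType R[i]).
Variables (dot : {dot H for Num.conj}) (rho : (circle R -> R[i]) -> H -> H) (theta : R).
Hypotheses (hdot : hilbert_dot dot) (hrho : faithful_rep dot rho) (irr : irrational theta).
Local Notation T := (circle R).
Local Notation C := R[i].
Local Notation A := (T -> C).
Local Notation rot := (rotation theta).
Local Notation l1 := (l1 (@C_circle R) rho).
Local Notation pit := (pi_tilde rho rot).
Local Notation mult := (mult rho theta).
Local Notation S_map := (@S_map R H (circle R -> R[i]) (@C_circle R) rho rot).
Implicit Types (a b : A) (F G : int -> A -> A) (f g : int -> A).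

(** The span of the operators [pit (y l)] is fixed before the matrix size. Replacing the entries of
    x by l1 functions happens after m is known, so its cost m^2 d can be made small. *)
Lemma completely_compact_approx (M : R) F : mult M F ->
  (forall e : R, 0 < e -> exists F' k (y : 'I_k -> int -> A),
    [/\ forall l, l1 (y l), mult e (fun s a => F s a - F' s a) &
      forall f, l1 f -> exists c : 'I_k -> C, multiply F' f = \sum_(l < k) c l *: y l]) ->
  completely_compact (S_map F).
Proof.
move=> FM approx e e0; have e4 : 0 < e / 4 by rewrite divr_gt0.
have [F' [k [y [yl DM hF']]]] := approx _ e4.
exists k, (fun l => pit (y l)); split=> [l|m x xc x1]; first exact: pi_crossed.
have {x1} hx : opbd 1 x by apply/(l2op_normP _ (ler01 : (0 : R) <= 1)).
set q := e / 4 in e4 DM.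
have D0 : 0 < m%:R ^+ 2 * (1 + q) + 1 by rewrite ltr_wpDl // mulr_ge0 ?sqr_ge0 // addr_ge0 // ltW.
(* This makes m^2 d (1 + q) less than q, so the total error m^2 d + q (1 + m^2 d) stays below 2
   q. *)
pose d := q / (m%:R ^+ 2 * (1 + q) + 1).
have d0 : 0 < d by rewrite divr_gt0.
have XY i j := (S_map_graph hdot hrho FM (xc i j)).2.
pose f i j := sval (cid (XY i j d d0)).
have hf i j : [/\ l1 (f i j), opbd1 d (x i j - pit (f i j)) &
    opbd1 d (S_map F (x i j) - pit (multiply F (f i j)))] := svalP (cid (XY i j d d0)).
pose fm : 'M[int -> A]_m := \matrix_(i, j) f i j.
have fl i j : l1 (f i j) by case: (hf i j).
have fml i j : l1 (fm i j) by rewrite mxE.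
have hc i j := hF' (f i j) (fl i j).
pose c i j := sval (cid (hc i j)).
have cE i j : multiply F' (f i j) = \sum_(l < k) c i j l *: y l := svalP (cid (hc i j)).
have a1 : opbd (m%:R ^+ 2 * d) (x - map_mx pit fm).
  apply: opbd_entries; first exact: ltW.
  by move=> i j; rewrite !mxE; case: (hf i j).
have a2 : opbd (m%:R ^+ 2 * d) (map_mx (S_map F) x - map_mx (fun g => pit (multiply F g)) fm).
  apply: opbd_entries; first exact: ltW.
  by move=> i j; rewrite !mxE; case: (hf i j).
have a3 : opbd (1 + m%:R ^+ 2 * d) (map_mx pit fm).
  by have := opbdB hx a1; rewrite opprB [X in opbd _ X]addrC subrK.
have [[_ hD] _ _] := DM; have a4 := opbdD a2 (hD m fm _ fml a3).
exists (\matrix_(i, j) \sum_(l < k) c i j l *: pit (y l)); split=> [i j|].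
  by rewrite mxE; exists (c i j).
apply/l2op_norm_ltP; exists (m%:R ^+ 2 * d + q * (1 + m%:R ^+ 2 * d)); split.
  have dE : d * (m%:R ^+ 2 * (1 + q) + 1) = q by rewrite /d divfK // gt_eqF.
  have -> : e = 4 * q by rewrite /q; field.
  have dp := d0; move: dE dp e4; move: (d) (m%:R ^+ 2 : R) => d' r; nra.
apply: opbd_eq a4 => i j xi xil; rewrite !mxE.
rewrite -[LHS]/((S_map F (x i j) xi - pit (multiply F (f i j)) xi) +
  pit (multiply (fun s a => F s a - F' s a) (f i j)) xi).
rewrite -[multiply (fun s a => F s a - F' s a) (f i j)]/(multiply F (f i j) - multiply F' (f i j)).
have l1F := mult_l1 hdot hrho FM (fl i j).
have l1F' : l1 (multiply F' (f i j)) by rewrite cE; exact: (l1_sum hdot hrho).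
rewrite (pi_sub theta hdot hrho l1F l1F' xil).
rewrite -[(pit _ - pit _) xi]/(pit (multiply F (f i j)) xi - pit (multiply F' (f i j)) xi).
by rewrite addrA subrK cE (pi_sum theta hdot hrho _ _ yl xil).
Qed.

Definition single (s : int) a : int -> A := fun t => if t == s then a else 0.

Lemma l1_single s a : C_circle a -> l1 (single s a).
Proof.
move=> aC; have h := l1_trunc hdot hrho `|s|%N (f := single s a) _.
have -> : single s a = trunc `|s|%N (single s a).
  apply/funext => t; rewrite /trunc /single; case: eqP => [->|_]; first by rewrite leqnn.
  by case: ifP.
apply: h => t; rewrite /single; case: ifP => _; [exact aC|exact (@C_circle0 R)].
Qed.

(** Convolution by a character has rank one, so finitely many characters on finitely many s give a
    finite dimensional range, with coefficients depending on f. *)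
Lemma trig_multiplier_finite (r : seq (C * int)) (u : int -> C) (N : nat) f :
  (forall s, (N < `|s|)%N -> u s = 0) -> (forall s, C_circle (f s)) ->
  multiply (conv_multiplier (trig r) u) f =
    \sum_(z <- [seq (s, x) | s <- win_idx N, x <- r])
      (u z.1 * z.2.1 * convolution (chi z.2.2) (f z.1) (circle_exp 0)) *:
        single z.1 (chi z.2.2).
Proof.
move=> uN fC; apply/funext => t; rewrite /multiply /conv_multiplier (convolution_trig _ (fC t)).
have E s : (\sum_(x <- r) (u s * x.1 * convolution (chi x.2) (f s) (circle_exp 0)) *:
    single s (chi x.2)) t =
  if t == s then u s *: \sum_(x <- r) x.1 *: convolution (chi x.2) (f s) else 0 :> A.
  transitivity (\sum_(x <- r) (u s * x.1 * convolution (chi x.2) (f s) (circle_exp 0)) *: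
      (if t == s then chi x.2 else 0 : A)); first by rewrite fct_sumE.
  case: eqP => [ts|_]; last by apply: big1 => x _; rewrite scaler0.
  rewrite scaler_sumr; apply: eq_bigr => x _.
  by rewrite [in RHS](convolution_chi_rank1 x.2 (fC s)) !scalerA.
transitivity (\sum_(s <- win_idx N) if t == s then
    u s *: \sum_(x <- r) x.1 *: convolution (chi x.2) (f s) else 0 : A); last first.
  rewrite big_allpairs_dep /= [X in _ = X t]fct_sumE; apply: eq_bigr => s _; exact: esym (E s).
have [tN|Nt] := leqP `|t| N.
  by rewrite -winE (win_single (s := t)) ?eqxx // => s; rewrite eq_sym => /negbTE ->.
rewrite (uN t Nt) scale0r big1_seq // => s /andP[_]; rewrite mem_win_idx => sN.
by case: eqP => // ts; move: Nt; rewrite ts ltnNge sN.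
Qed.

Lemma conv_multiplier_approx (p : A) (x y : int -> C) (a b : R) : L1_circle p ->
  0 <= a -> 0 <= b -> sqbd x a -> sqbd y b ->
  forall e : R, 0 < e -> exists F' k (z : 'I_k -> int -> A),
    [/\ forall l, l1 (z l),
      mult e (fun s c => conv_multiplier p (coefI x y) s c - F' s c) &
      forall f, l1 f -> exists c : 'I_k -> C, multiply F' f = \sum_(l < k) c l *: z l].
Proof.
(* K collects three errors: replacing p by a trigonometric polynomial, dropping the tail of x,
   dropping the tail of y. The last 1 keeps K positive. *)
move=> pL a0 b0 xa yb e e0; have L0 := L1norm_ge0 p.
pose K := a * b + (L1norm p + 1) * b + (L1norm p + 1) * a + 1.
have K0 : 0 < K by rewrite ltr_wpDl // !addr_ge0 ?mulr_ge0 // addr_ge0.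
pose d := Num.min 1 (e / K).
have d0 : 0 < d by rewrite lt_min ltr01 divr_gt0.
have d1 : d <= 1 by rewrite ge_min lexx.
have dK : d * K <= e by rewrite -ler_pdivlMr // ge_min lexx orbT.
have [r hr] := L1norm_trig_dense pL d0.
have rL := L1_circle_trig r.
have pr : L1norm (trig r) <= L1norm p + 1.
  apply: le_trans (L1norm_le_sub pL rL) _; rewrite lerD2l; exact: le_trans hr d1.
have [N1 hN1] := sqbd_tail xa d0; have [N2 hN2] := sqbd_tail yb d0.
pose N := maxn N1 N2.
have tail (v : int -> C) n : (n <= N)%N ->
    sqbd (fun k => if (`|k| <= n)%N then 0 else v k) d ->
    sqbd (fun k => if (`|k| <= N)%N then 0 else v k) d.
  move=> nN h k; apply: le_trans (h k); apply: ler_win => s _.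
  case: ifP => sN; first by rewrite nrm0 expr0n sqr_ge0.
  by rewrite ifF //; apply/negbTE; rewrite -ltnNge (leq_ltn_trans nN) // ltnNge sN.
have xt := tail x N1 (leq_maxl _ _) hN1; have yt := tail y N2 (leq_maxr _ _) hN2.
set x' := fun k => if _ then 0 else x k in xt; set y' := fun k => if _ then 0 else y k in yt.
have xN := sqbd_trunc N xa; have yN := sqbd_trunc N yb; have dl := ltW d0.
have pqL := L1_circle_sub pL rL.
have m1 := mult_conv hdot hrho irr pqL a0 b0 xa yb.
have m2 := mult_conv hdot hrho irr rL dl b0 xt yb.
have m3 := mult_conv hdot hrho irr rL a0 dl xN yt.
have m := mult_comb hdot hrho 1 m1 (mult_comb hdot hrho 1 m2 m3).
rewrite !nrm1 !mul1r in m.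
pose u := coefI (trunc N x) (trunc N y).
pose s0 := [seq (s, z) | s <- win_idx N.*2, z <- r].
exists (conv_multiplier (trig r) u), (size s0).
exists (fun l => let w := nth (0, (0, 0)) s0 l in single w.1 (chi w.2.2)); split.
- by move=> l; apply: l1_single; exact (@C_circle_chi R _).
- apply: mult_le (_ : _ <= e) (mult_ext _ m).
    apply: le_trans dK; rewrite /K.
    have t1 : a * b * L1norm (p - trig r) <= a * b * d by rewrite ler_wpM2l // mulr_ge0.
    have t2 : d * b * L1norm (trig r) <= d * b * (L1norm p + 1) by rewrite ler_wpM2l // mulr_ge0.
    have t3 : a * d * L1norm (trig r) <= a * d * (L1norm p + 1) by rewrite ler_wpM2l // mulr_ge0.
    apply: le_trans (lerD t1 (lerD t2 t3)) _; rewrite le_eqVlt; apply/orP; right; nra.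
  move=> s g gC; rewrite /conv_multiplier !scale1r (convolution_subl pL rL gC).
  rewrite (coefI_truncl N s xa yb) (coefI_truncr N s xN yb) -/x' -/y' -/u.
  rewrite !scalerBr !scalerDl; move: (convolution p g) (convolution (trig r) g) => P Q.
  apply/funext => z.
  rewrite -[LHS]/(((u s * P z + coefI (trunc N x) y' s * P z) + coefI x' y s * P z) -
    ((u s * Q z + coefI (trunc N x) y' s * Q z) + coefI x' y s * Q z) +
    (coefI x' y s * Q z + coefI (trunc N x) y' s * Q z)).
  rewrite -[RHS]/(((u s * P z + coefI (trunc N x) y' s * P z) + coefI x' y s * P z) - u s * Q z).
  ring.
- move=> f fl; rewrite (trig_multiplier_finite r (N := N.*2)).
  + rewrite (big_nth (0, (0, 0))) big_mkord.
    by eexists; apply: eq_bigr => l _.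
  + by move=> s; exact: coefI_support.
  + by move=> s; exact (l1_C fl).
Qed.

Lemma conv_multiplier_hs (p : A) (u : int -> C) : L1_circle p -> fourier_algebra u ->
  hs_inv_cc (@C_circle R) rho rot (conv_multiplier p u).
Proof.
move=> pL [x [y [/isl2_sqbd[a a0 xa] /isl2_sqbd[b b0 yb] uE]]].
have -> : u = coefI x y by apply/funext => n; exact: uE.
have FM := mult_conv hdot hrho irr pL a0 b0 xa yb.
have L0 := L1norm_ge0 p.
have cb n : (@cb_norm R (alg_space (@C_circle R) rho) (alg_space (@C_circle R) rho)
    (conv_multiplier p (coefI x y) n) <= ((a ^+ 2 + b ^+ 2) * L1norm p)%:E)%E.
  apply: cb_norm_alg_le => [|m z zC z1].
    by rewrite mulr_ge0 // addr_ge0 ?sqr_ge0.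
  have h := mbd_alg_bd hdot hrho (fun b bC => C_circle_convolution pL bC)
    (mbd_convolution hdot hrho irr pL) zC z1.
  have [c0 h2] := alg_bdZ hrho (coefI x y n) (fun i j => C_circle_convolution pL (zC i j)) h.
  split=> [|v]; first by rewrite mulr_ge0 // addr_ge0 ?sqr_ge0.
  apply: le_trans (h2 v) _; rewrite ler_wpM2r ?sumr_ge0 // => [i _|]; first exact: sqr_ge0.
  rewrite mulr1 ler_pXn2r ?nnegrE ?mulr_ge0 ?nrm_ge0 ?addr_ge0 ?sqr_ge0 //.
  by rewrite ler_wpM2r // nrm_coefI_le.
split.
- split.
  + move=> n; split.
    * move=> g gC; exact (C_circleZ (C_circle_convolution pL gC)).
    * have [_ _ lin] := FM; move=> c g k gC kC; exact (lin n c g k gC kC).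
    * by apply: le_lt_trans (cb n) _; exact: ltry.
  + by exists ((a ^+ 2 + b ^+ 2) * L1norm p).
  + have [FMb _ _] := FM; eexists => m f fl; exact: (Mbd_l2op_norm FMb fl).
- by apply: (completely_compact_approx FM); exact: conv_multiplier_approx xa yb.
- move=> s t g gC; rewrite /conv_multiplier -convolution_rotation.
  by apply/funext => z.
Qed.

End ConvolutionMultipliers.

(** * Fejer multipliers as an approximate identity *)

Section FejerMultipliers.
Variables (R : realType) (H : completeNormedModType R[i]).
Variables (dot : {dot H for Num.conj}) (rho : (circle R -> R[i]) -> H -> H) (theta : R).
Hypotheses (hdot : hilbert_dot dot) (hrho : faithful_rep dot rho) (irr : irrational theta).
Local Notation T := (circle R).
Local Notation C := R[i].
Local Notation A := (T -> C).
Local Notation op := (@l2op R H).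
Local Notation rot := (rotation theta).
Local Notation pf := (pf rho theta).
Local Notation l1 := (l1 (@C_circle R) rho).
Local Notation pit := (pi_tilde rho rot).
Local Notation mult := (mult rho theta).
Implicit Types (a b : A) (F G : int -> A -> A) (f g : int -> A).

Lemma win_nneg (V : zmodType) n (u : int -> V) : (forall k, k < 0 -> u k = 0) ->
  win n u = \sum_(b < n.+1) u b%:Z.
Proof.
move=> u0; rewrite /win -(big_mkord xpredT (fun k => u (k%:Z - n%:Z))).
rewrite (@big_cat_nat _ _ _ n) //=; last by lia.
rewrite big_nat_cond big1 ?add0r => [|k /andP[kn _]]; last by apply: u0; lia.
rewrite -{1}[n]add0n big_addn (_ : (n.*2.+1 - n)%N = n.+1); last by lia.
by rewrite big_mkord; apply: eq_bigr => b _; congr u; lia.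
Qed.

Lemma fej_support n k : (n <= `|k|)%N -> fej R n k = 0.
Proof.
move=> nk; rewrite /fej big1 ?mulr0 // => a _; rewrite big1 // => b _.
apply/eqP; rewrite pnatr_eq0 eqb0; have := ltn_ord a; have := ltn_ord b; lia.
Qed.

(* A unit vector whose autocorrelation is the Fejer weight. *)
Definition box n (k : int) : C :=
  if (0 <= k) && (k <= n%:Z) then (Num.sqrt n.+1%:R^-1)%:C%C else 0.

Lemma sqbd_box n : sqbd (box n) 1.
Proof.
move=> m; rewrite expr1n.
have q0 : 0 <= n.+1%:R^-1 :> R by rewrite invr_ge0.
have sq0 : 0 <= Num.sqrt n.+1%:R^-1 :> R by rewrite sqrtr_ge0.
apply: (@le_trans _ _ (win (maxn m n) (fun s => nrm (box n s) ^+ 2))).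
  by apply: ler_win_widen; rewrite ?leq_maxl // => s; exact: sqr_ge0.
rewrite (win_split _ (leq_maxr m n)) [X in _ + X](@eq_win _ _ _ (fun=> 0)) => [|s _]; last first.
  by case: ifP => // ns; rewrite /box ifF ?nrm0 ?expr0n //; lia.
rewrite win0 addr0 win_nneg => [|k k0]; last by rewrite /box leNgt k0 nrm0 expr0n.
rewrite (eq_bigr (fun=> n.+1%:R^-1)) => [|b _]; last first.
  by rewrite /box ifT ?nrmC ?ger0_norm ?sqr_sqrtr //; have := ltn_ord b; lia.
by rewrite sumr_const card_ord -[leLHS]mulr_natr mulVf ?pnatr_eq0.
Qed.

Lemma coefI_box n s : coefI (box n) (box n) s = (fej R n.+1 s)%:C%C.
Proof.
have c0 : (0 : C)^* = 0 by exact: rmorph0.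
rewrite /coefI (@zsum_finite _ _ _ n) => [|k nk]; last first.
  by rewrite [X in _ * X^*]/box ifF ?c0 ?mulr0 //; lia.
rewrite win_nneg => [|k k0]; last by rewrite [X in _ * X^*]/box leNgt k0 c0 mulr0.
rewrite /fej (rmorphM (real_complex R)) (rmorph_sum (real_complex R)) mulr_sumr.
apply: eq_bigr => b _; rewrite [X in _ * X^*]/box ifT; last by have := ltn_ord b; lia.
rewrite conj_real /box.
have q0 : 0 <= n.+1%:R^-1 :> R by rewrite invr_ge0.
have sq : (Num.sqrt n.+1%:R^-1)%:C%C * (Num.sqrt n.+1%:R^-1)%:C%C = (n.+1%:R^-1)%:C%C :> C.
  by rewrite -(rmorphM (real_complex R)) -expr2 sqr_sqrtr.
case: ifP => bs.
  rewrite sq; have lt : (`|b%:Z - s| < n.+1)%N by lia.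
  rewrite (bigD1 (Ordinal lt)) //= big1 => [|k kb].
    by rewrite (_ : _ == s) ?addr0 ?rmorph1 ?mulr1 //; lia.
  apply/eqP; rewrite pnatr_eq0 eqb0; apply: contraNneq kb => h.
  by apply/eqP/val_inj => /=; lia.
rewrite mul0r big1 ?rmorph0 ?mulr0 // => k _.
apply/eqP; rewrite pnatr_eq0 eqb0; have := ltn_ord k; lia.
Qed.

(** Fejer kernel on the circle and Fejer weight on the integers at once; the index n + 1 excludes
    the degenerate kernel of order 0. *)
Definition fejer_mult n : int -> A -> A :=
  conv_multiplier (fejer n.+1) (fun s => (fej R n.+1 s)%:C%C).

Lemma mult_fejer n : mult 1 (fejer_mult n).
Proof.
have L := L1_circle_C (@C_circle_fejer R n.+1).
have := mult_conv hdot hrho irr L ler01 ler01 (sqbd_box n) (sqbd_box n).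
rewrite L1norm_fejer // !mulr1; congr mult.
by rewrite /fejer_mult (_ : coefI _ _ = fun s => (fej R n.+1 s)%:C%C) //;
  apply/funext => s; exact: coefI_box.
Qed.

Lemma mult_id : mult 1 (fun=> id).
Proof.
split.
- split=> // m f c fl fc; rewrite mul1r; exact: fc.
- by exists 1; split=> // s a aC; split; [exact aC|rewrite mul1r].
- by [].
Qed.

Lemma mult_compl_fejer n : mult (1 + 1) (fun s a => a - fejer_mult n s a).
Proof. exact: (mult_sub hdot hrho mult_id (mult_fejer n)). Qed.

Lemma fejer_mult_cvg s a : C_circle a -> forall e : R, 0 < e ->
  exists N, forall n, (N <= n)%N -> anorm rho (a - fejer_mult n s a) <= e.
Proof.
move=> aC e e0; have [B [B0 aB]] := C_circle_bounded aC.
have e2 : 0 < e / 2 by rewrite divr_gt0.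
have D0 : 0 < B + e by rewrite ltr_wpDl.
have e3 : 0 < e / 2 / (B + e) by rewrite divr_gt0.
have [N1 h1] := fejer_cvg aC e2; have [N2 h2] := fej_tends s e3.
exists (maxn N1 N2) => n; rewrite geq_max => /andP[/h1 {}h1 /leqW/h2 {}h2].
have fL := L1_circle_C (@C_circle_fejer R n.+1).
have GC := C_circle_sub aC (C_circleZ (c := (fej R n.+1 s)%:C%C) (C_circle_convolution fL aC)).
apply: (anorm_sup_le hdot hrho GC) => z.
rewrite -[(a - _) z]/(a z - (fej R n.+1 s)%:C%C * convolution (fejer n.+1) a z).
have := h1 z; set w := convolution _ _ z => hz.
have -> : a z - (fej R n.+1 s)%:C%C * w = (a z - w) + (1 - (fej R n.+1 s)%:C%C) * w by ring.
apply: le_trans (ler_nrmD _ _) _; rewrite [e]splitr lerD //; first by rewrite nrmB.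
have wB : nrm w <= B + e.
  rewrite -[w](subrK (a z)) [B + e]addrC; apply: le_trans (ler_nrmD _ _) _.
  apply: lerD (aB z); apply: le_trans hz _; lra.
rewrite nrmM -(rmorph1 (real_complex R)) -(rmorphB (real_complex R)) nrmC ger0_norm ?subr_ge0 ?fej_le1 //.
have h3 : 1 - fej R n.+1 s <= e / 2 / (B + e) by lra.
apply: le_trans (ler_pM _ (nrm_ge0 _) h3 wB) _; first by rewrite subr_ge0 fej_le1.
by rewrite divfK // gt_eqF.
Qed.

Lemma eventually_win (u : nat -> int -> R) m :
  (forall s e, 0 < e -> exists N, forall n, (N <= n)%N -> u n s <= e) ->
  forall e, 0 < e -> exists N, forall n, (N <= n)%N -> win m (u n) <= e.
Proof.
move=> h e e0; have e1 : 0 < e / m.*2.+1%:R by rewrite divr_gt0 ?ltr0n.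
pose N s := sval (cid (h s _ e1)); have hN s n : (N s <= n)%N -> u n s <= e / m.*2.+1%:R := svalP (cid (h s _ e1)) n.
exists (\max_(k < m.*2.+1) N (k%:Z - m%:Z)%R)%N => n /bigmax_leqP hn.
apply: (@le_trans _ _ (\sum_(k < m.*2.+1) (e / m.*2.+1%:R))).
  by apply: ler_sum => k _; apply: (hN _ n); exact: hn.
by rewrite sumr_const card_ord -[leLHS]mulr_natr divfK // pnatr_eq0.
Qed.

(** Only finitely many coefficients survive, so convergence of each in norm is enough. *)
Lemma compl_fejer_trunc f N : (forall s, C_circle (f s)) -> forall e : R, 0 < e ->
  exists n0, forall n, (n0 <= n)%N ->
    opbd1 e (pit (multiply (fun s a => a - fejer_mult n s a) (trunc N f))).
Proof.
move=> fC e e0.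
have [n0 h] := @eventually_win (fun n s => anorm rho (f s - fejer_mult n s (f s))) N
  (fun s => fejer_mult_cvg s (fC s)) e e0.
exists n0 => n /h hn.
have fL := L1_circle_C (@C_circle_fejer R n.+1).
have gC s : C_circle (multiply (fun s a => a - fejer_mult n s a) f s).
  exact (C_circle_sub (fC s) (C_circleZ (C_circle_convolution fL (fC s)))).
have := opbd_le hn (opbd1_pf theta hdot hrho N gC); rewrite -(pi_trunc theta hrho).
congr (opbd1 _ (pit _)); apply/funext => s; rewrite /multiply /trunc; case: ifP => // _.
have [_ _ lin] := mult_compl_fejer n; exact: esym (lin_on_C0 (lin s)).
Qed.

(** The uniform bound 1 + 1 extends convergence from truncated functions to the crossed product. X
    is approximated within e/3, which costs 2 e/3, and e/6 remains for the truncated function. *)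
Lemma compl_fejer_graph X (Y : nat -> op) : @os_set R (crossed_product (@C_circle R) rho rot) X ->
  (forall n, graph rho theta (fun s a => a - fejer_mult n s a) X (Y n)) ->
  forall e : R, 0 < e -> exists n0, forall n, (n0 <= n)%N -> opbd1 e (Y n).
Proof.
move=> /(crossedP theta hdot hrho)[_ aX] XY e e0; have e6 : 0 < e / 6 by rewrite divr_gt0.
have [f fl fX] := aX _ e6; have [S fS] := (l1P hdot hrho f).1 fl.
have [N /(_ N (leqnn N)) hN] := pi_truncation theta hdot hrho fS e6.
have [n0 hn0] := @compl_fejer_trunc f N (fun s => l1_C fl) _ e6.
exists n0 => n /hn0 hn.
have tl : l1 (trunc N f) := l1_trunc hdot hrho N (f := f) (fun s => l1_C fl).
have Fn := mult_compl_fejer n.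
have g := graph_sub hdot hrho Fn (XY n) (graph_pi theta _ tl).
have hX : opbd1 (e / 6 + e / 6) (X - pit (trunc N f)).
  rewrite (pi_trunc theta hrho); have := opbd1D fX hN; apply: opbd1_eq => xi _.
  rewrite -[LHS]/((X xi - pit f xi) + (pit f xi - pf N f xi)) -[RHS]/(X xi - pf N f xi).
  by rewrite addrA subrK.
have := graph_bound (X := const_mx _) (Y := const_mx _) Fn _ hX.
move=> /(_ (Y n - pit (multiply (fun s a => a - fejer_mult n s a) (trunc N f)))) h.
have {}h : opbd1 ((1 + 1) * (e / 6 + e / 6))
    (Y n - pit (multiply (fun s a => a - fejer_mult n s a) (trunc N f))).
  by apply: h => i j; rewrite !mxE.
have := opbd1D h hn; rewrite subrK; apply: opbd_le; lra.
Qed.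

End FejerMultipliers.

(** * Invariant multipliers are diagonal in the characters *)

Section InvariantMultipliers.
Variables (R : realType) (H : completeNormedModType R[i]).
Variables (dot : {dot H for Num.conj}) (rho : (circle R -> R[i]) -> H -> H) (theta : R).
Hypotheses (hdot : hilbert_dot dot) (hrho : faithful_rep dot rho) (irr : irrational theta).
Local Notation T := (circle R).
Local Notation C := R[i].
Local Notation A := (T -> C).
Local Notation op := (@l2op R H).
Local Notation rot := (rotation theta).
Local Notation algS := (alg_space (@C_circle R) rho).
Local Notation pit := (pi_tilde rho rot).
Local Notation mult := (mult rho theta).
Local Notation graph := (graph rho theta).
Local Notation dominated := (dominated rho).
Local Notation crossed := (crossed_product (@C_circle R) rho rot).
Implicit Types (a b : A) (F G : int -> A -> A) (f g : int -> A).

Lemma anorm_0 : anorm rho 0 = 0.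
Proof.
apply/eqP; rewrite eq_le anorm_ge0 andbT; apply: (anorm_sup_le hdot hrho (@C_circle0 R)) => z.
by rewrite -[X in nrm X]/(0 : C) nrm0.
Qed.

(** [cb_norm] only tests the unit ball, so a is scaled to norm 1; a of norm 0 is the zero function,
    where linearity is used. *)
Lemma cb_norm_anorm (L : A -> A) (M : R) a : (forall a, C_circle a -> C_circle (L a)) ->
  lin_on_C L -> (@cb_norm R algS algS L <= M%:E)%E -> C_circle a ->
  anorm rho (L a) <= M * anorm rho a.
Proof.
move=> LC linL LM aC; have [a0|a0] := eqVneq (anorm rho a) 0.
  have -> : a = 0 := anorm_eq0 hdot hrho aC a0.
  by rewrite (lin_on_C0 linL) anorm_0 mulr0.
have ap : 0 < anorm rho a by rewrite lt_neqAle eq_sym a0 anorm_ge0.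
set t := anorm rho a in a0 ap *; set b := (t^-1)%:C%C *: a.
have bC : C_circle b := C_circleZ aC.
have b1 : (@os_norm1 R algS b <= 1%:E)%E.
  rewrite (os_norm1E hdot hrho bC) lee_fin; apply: le_trans (anormZ hdot hrho _ aC) _.
  by rewrite nrmC ger0_norm ?invr_ge0 ?(ltW ap) // mulVf.
have Lb : anorm rho (L b) <= M.
  rewrite -lee_fin -(os_norm1E hdot hrho (LC _ bC)); apply: le_trans LM.
  apply: ereal_sup_ubound; exists 1%N, (const_mx b); split.
  - move=> i j; rewrite mxE; exact bC.
  - exact: b1.
  - by rewrite map_const_mx.
have -> : L a = t%:C%C *: L b.
  have ab : a = t%:C%C *: b.
    by rewrite /b scalerA -(rmorphM (real_complex R)) mulfV // rmorph1 scale1r.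
  have := linL t%:C%C b 0 bC (@C_circle0 R).
  by rewrite (lin_on_C0 linL) !addr0 -ab.
apply: le_trans (anormZ hdot hrho _ (LC _ bC)) _.
by rewrite nrmC ger0_norm ?(ltW ap) // mulrC ler_wpM2r // ltW.
Qed.

Lemma herz_schur_mult F : herz_schur (@C_circle R) rho rot F -> exists M, mult M F.
Proof.
move=> [cb [M2 hM2] [M hM]].
have lin s : lin_on_C (F s) by have [_ l _] := cb s => c g h gC hC; exact (l c g h gC hC).
have pres s a (aC : C_circle a) : C_circle (F s a) by have [p _ _] := cb s; exact (p a aC).
(* The constant in [herz_schur] carries no sign, whereas multiplier bounds are nonnegative. *)
exists `|M|; refine (And3 _ _ lin).
- split=> // m f c fl fc; have c0 := opbd_ge0 fc.
  apply/(l2op_normP _ (mulr_ge0 (normr_ge0 M) c0)); apply: le_trans (hM m f fl) _.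
  have n0 : (0 <= l2op_norm (map_mx pit f))%E.
    by apply: le_ereal_inf_tmp => _ [d [d0 _] <-]; rewrite lee_fin.
  apply: (@le_trans _ _ (`|M|%:E * l2op_norm (map_mx pit f))%E).
    by rewrite lee_wpmul2r // lee_fin ler_norm.
  by rewrite EFinM lee_wpmul2l ?lee_fin //; apply/(l2op_normP _ c0).
- exists `|M2|; refine (conj (normr_ge0 M2) _) => s a aC; split; first exact (pres s a aC).
  apply: le_trans (cb_norm_anorm (pres s) (lin s) (hM2 s) aC) _.
  by rewrite ler_wpM2r ?anorm_ge0 // ler_norm.
Qed.

Lemma lin_on_C_sum (L : A -> A) (I : Type) (r : seq I) (c : I -> C) (g : I -> A) :
  lin_on_C L -> (forall i, C_circle (g i)) ->
  L (\sum_(i <- r) c i *: g i) = \sum_(i <- r) c i *: L (g i).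
Proof.
move=> linL gC; elim: r => [|i r IH]; first by rewrite !big_nil (lin_on_C0 linL).
rewrite !big_cons -IH; apply: (linL (c i) _ _ (gC i)).
refine (@C_circle_sum R _ _ _ _) => j; exact (C_circleZ (gC j)).
Qed.

Lemma lin_on_C_scale (L : A -> A) (c : C) a : lin_on_C L -> C_circle a -> L (c *: a) = c *: L a.
Proof.
move=> linL aC; have := linL c a 0 aC (@C_circle0 R).
by rewrite (lin_on_C0 linL) !addr0.
Qed.

(* By Weyl equidistribution the convolution operators by characters are
   limits of averages of rotations. *)
Lemma invariant_convolution_chi K F s k a : dominated K F -> lin_on_C (F s) ->
  (forall t a, C_circle a -> rot t (F s a) = F s (rot t a)) -> C_circle a ->
  F s (convolution (chi k) a) = convolution (chi k) (F s a).
Proof.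
move=> [K0 FK] linF inv aC; have [FaC _] := FK s a aC.
have kL := L1_circle_chi R k.
have waC N : C_circle (wmean theta (chi k) N a).
  refine (C_circleZ _); refine (@C_circle_sum R _ _ _ _) => t.
  exact (C_circleZ (C_circle_rotation aC)).
have w N : F s (wmean theta (chi k) N a) = wmean theta (chi k) N (F s a).
  rewrite /wmean (lin_on_C_scale _ linF); last first.
    refine (@C_circle_sum R _ _ _ _) => t; exact (C_circleZ (C_circle_rotation aC)).
  rewrite (lin_on_C_sum _ _ linF) => [|t]; last exact (C_circle_rotation aC).
  by congr (_ *: _); apply: eq_bigr => t _; rewrite (inv _ _ aC).
have C1 := C_circle_convolution kL aC; have C2 := C_circle_convolution kL FaC.
have [FC1 _] := FK s _ C1.
apply/eqP; rewrite -subr_eq0; apply/eqP.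
apply: (anorm_eq0 hdot hrho (C_circle_sub FC1 C2)).
apply/eqP; rewrite eq_le anorm_ge0 andbT; apply/ler_addgt0Pr => e e0; rewrite add0r.
have D0 : 0 < K + 1 by rewrite ltr_wpDl.
have d0 : 0 < e / (K + 1) by rewrite divr_gt0.
have [N1 h1] := weyl_chi irr k aC d0; have [N2 h2] := weyl_chi irr k FaC d0.
have {}h1 := h1 _ (leq_maxl N1 N2); have {}h2 := h2 _ (leq_maxr N1 N2).
move: (maxn N1 N2) h1 h2 => N h1 h2.
have wC := waC N; have [FwC _] := FK s _ wC.
have -> : F s (convolution (chi k) a) - convolution (chi k) (F s a) =
    F s (convolution (chi k) a - wmean theta (chi k) N a) +
    (wmean theta (chi k) N (F s a) - convolution (chi k) (F s a)).
  by rewrite (lin_on_C_sub linF C1 wC) w addrA subrK.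
have D1 := C_circle_sub C1 wC; have [FD1 hD1] := FK s _ D1.
have D2 : C_circle (wmean theta (chi k) N (F s a) - convolution (chi k) (F s a)).
  by rewrite -w; exact (C_circle_sub FwC C2).
apply: le_trans (anormD hdot hrho FD1 D2) _.
have n1 : anorm rho (convolution (chi k) a - wmean theta (chi k) N a) <= e / (K + 1).
  apply: (anorm_sup_le hdot hrho D1) => z; rewrite -[X in nrm X]/(convolution _ a z - _ a z).
  by rewrite nrmB.
have n2 : anorm rho (wmean theta (chi k) N (F s a) - convolution (chi k) (F s a)) <= e / (K + 1).
  by apply: (anorm_sup_le hdot hrho D2) => z; exact: h2.
apply: le_trans (lerD (le_trans hD1 (ler_wpM2l K0 n1)) n2) _.
by rewrite -[X in _ + X <= _]mul1r -mulrDl mulrC divfK // gt_eqF.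
Qed.

Lemma invariant_eigen K F s k a : dominated K F -> lin_on_C (F s) ->
  (forall t a, C_circle a -> rot t (F s a) = F s (rot t a)) -> C_circle a ->
  convolution (chi k) (F s a) = F s (chi k) (circle_exp 0) *: convolution (chi k) a.
Proof.
move=> FK linF inv aC; have kC := @C_circle_chi R k.
have [FkC _] := FK.2 s _ kC.
have Fk : F s (chi k) = convolution (chi k) (F s (chi k)).
  by rewrite -(invariant_convolution_chi k FK linF inv kC) convolution_chi eqxx scale1r.
have E : F s (chi k) = F s (chi k) (circle_exp 0) *: chi k.
  rewrite {1}Fk (convolution_chi_rank1 k FkC); congr (_ *: _); by rewrite -Fk.
rewrite -(invariant_convolution_chi k FK linF inv aC) (convolution_chi_rank1 k aC).
by rewrite (lin_on_C_scale _ linF kC) {1}E !scalerA mulrC.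
Qed.

Lemma fourier_delta (s : int) : fourier_algebra (fun t => (t == s)%:R : C).
Proof.
pose ind r : int -> C := fun t => (t == r)%:R.
have indE r t : t != r -> ind r t = 0 by rewrite /ind => /negbTE ->.
have ind_l2 r : l2 (ind r).
  apply: le_lt_trans (_ : (1%:E < +oo)%E); last exact: ltry.
  apply: (esum_winP (g := fun s => nrm (ind r s) ^+ 2) _ (fun s => sqr_ge0 _)).2 => n.
  have [rn|nr] := leqP `|r| n.
    rewrite (win_single (s := r)) // => [|t /indE ->]; last by rewrite nrm0 expr0n.
    by rewrite /ind eqxx nrm1 expr1n.
  rewrite (@eq_win _ _ _ (fun=> 0)) ?win0 // => t tn; rewrite indE ?nrm0 ?expr0n //.
  by apply: contraTneq tn => ->; rewrite -ltnNge.
(* Only k = s contributes to the coefficient at n, and [ind 0] at s - n is 1 exactly when n = s. *)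
exists (ind 0), (ind s); split=> // n.
have c0 : (0 : C)^* = 0 by exact: rmorph0.
rewrite (@zsum_finite _ _ _ `|s|%N) => [|k sk]; last first.
  rewrite (indE s) ?c0 ?mulr0 //; apply: contraTneq sk => ->; by rewrite -leqNgt.
rewrite (win_single (s := s)) // => [|k /indE ->]; last by rewrite c0 mulr0.
by rewrite /ind eqxx rmorph1 mulr1 subr_eq0 eq_sym.
Qed.

Lemma graph_lincomb M F k (y z : 'I_k -> op) (c : 'I_k -> C) : mult M F ->
  (forall l, graph F (y l) (z l)) ->
  graph F (\sum_(l < k) c l *: y l) (\sum_(l < k) c l *: z l).
Proof.
move=> FM yz; elim: (index_enum _) => [|l r IH].
  have := graph_pi theta F (l1_0 hdot hrho); have -> : multiply F 0 = 0.
    by have [_ _ lin] := FM; apply/funext => s; exact (lin_on_C0 (lin s)).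
  by rewrite !big_nil (pi_0 theta hrho).
by rewrite !big_cons; exact: (graph_comb hdot hrho _ FM (yz l) IH).
Qed.

Lemma crossed_bounded X : @os_set R crossed X -> exists S, opbd1 S X.
Proof.
move=> [[_ Xfin] _]; have X0 : (0 <= l2op_norm1 X)%E.
  by apply: le_ereal_inf_tmp => _ [d [d0 _] <-]; rewrite lee_fin.
exists (fine (l2op_norm1 X)); apply/l2op_normP; first exact: fine_ge0.
by rewrite fineK // ge0_fin_numE.
Qed.

End InvariantMultipliers.

(** * Density of the span in the invariant completely compact multipliers *)

Section Density.
Variables (R : realType) (H : completeNormedModType R[i]).
Variables (dot : {dot H for Num.conj}) (rho : (circle R -> R[i]) -> H -> H) (theta : R).
Hypotheses (hdot : hilbert_dot dot) (hrho : faithful_rep dot rho) (irr : irrational theta).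
Local Notation T := (circle R).
Local Notation C := R[i].
Local Notation A := (T -> C).
Local Notation op := (@l2op R H).
Local Notation rot := (rotation theta).
Local Notation mult := (mult rho theta).
Local Notation dominated := (dominated rho).
Local Notation crossed := (crossed_product (@C_circle R) rho rot).
Local Notation S_map := (@S_map R H (circle R -> R[i]) (@C_circle R) rho rot).
Implicit Types (a b : A) (F G : int -> A -> A) (f g : int -> A).

Lemma sum_multE (I : Type) (r : seq I) (c : I -> C) (G : I -> int -> A -> A) s a :
  (\sum_(i <- r) c i *: G i) s a = \sum_(i <- r) c i *: G i s a.
Proof. by elim: r => [|i r IH]; rewrite ?big_nil // !big_cons -IH. Qed.

(** The Fejer weight leaves finitely many s and the Fejer kernel finitely many characters; on each
    such pair F acts by a scalar. *)
Lemma fejer_mult_comp K F n : dominated K F -> (forall s, lin_on_C (F s)) ->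
  (forall s t a, C_circle a -> rot t (F s a) = F s (rot t a)) ->
  exists k (c : 'I_k -> C) (p : 'I_k -> A) (u : 'I_k -> int -> C),
    [/\ forall l, L1_circle (p l), forall l, fourier_algebra (u l) &
      forall s a, C_circle a ->
        (\sum_(l < k) c l *: conv_multiplier (p l) (u l)) s a = fejer_mult n s (F s a)].
Proof.
move=> FK linF inv.
set r := [seq ((n.+1%:R^-1)%:C%C, x.1%:Z - x.2%:Z) |
  x <- [seq (i, j) | i <- iota 0 n.+1, j <- iota 0 n.+1]] : seq (C * int).
pose L := [seq (s, x) | s <- win_idx n, x <- r].
(* Fejer weight at s, times the coefficient of the kernel, times the eigenvalue of F s at the
   character. *)
pose cf (z : int * (C * int)) : C :=
  (fej R n.+1 z.1)%:C%C * z.2.1 * F z.1 (chi z.2.2) (circle_exp 0).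
pose w (l : 'I_(size L)) := nth (0, (0, 0)) L l.
exists (size L), (fun l => cf (w l)), (fun l => chi (w l).2.2), (fun l t => (t == (w l).1)%:R).
split=> [l|l|s a aC]; [exact: L1_circle_chi|exact: fourier_delta|].
have [FaC _] := FK.2 s a aC.
pose G (z : int * (C * int)) := cf z *: conv_multiplier (chi z.2.2) (fun t => (t == z.1)%:R).
have -> : \sum_(l < size L) cf (w l) *: conv_multiplier (chi (w l).2.2) (fun t => (t == (w l).1)%:R)
    = \sum_(z <- L) G z by rewrite (big_nth (0, (0, 0))) big_mkord.
rewrite sum_multE big_allpairs_dep /=.
transitivity (\sum_(s' <- win_idx n) if s == s' then fejer_mult n s (F s a) else 0); last first.
  have [sn|ns] := leqP `|s| n.
    by rewrite -winE (win_single (s := s)) ?eqxx // => t; rewrite eq_sym => /negbTE ->.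
  rewrite big1_seq => [|t /andP[_]]; last first.
    by rewrite mem_win_idx; case: eqP => // <-; rewrite leqNgt ns.
  by rewrite /fejer_mult /conv_multiplier fej_support // rmorph0 scale0r.
apply: eq_bigr => t _; rewrite /conv_multiplier; case: eqP => [<-|st]; last first.
  by apply: big1 => x _; rewrite scale0r scaler0.
rewrite /fejer_mult /conv_multiplier fejerE (convolution_trig _ FaC) -/r scaler_sumr.
apply: eq_bigr => x _; rewrite scale1r (invariant_eigen hdot hrho irr x.2 FK (linF s) (inv s) aC).
by rewrite !scalerA.
Qed.

Lemma compl_fejer_uniform k (y : 'I_k -> op) (e : R) : (forall l, @os_set R crossed (y l)) ->
  0 < e -> exists n, forall m (c : 'I_m -> 'I_m -> 'I_k -> C) d, opbd d (lincomb y c) ->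
    opbd (e * d) (lincomb (fun l => S_map (fun s a => a - fejer_mult n s a) (y l)) c).
Proof.
move=> yc e0; have cm n := mult_compl_fejer hdot hrho irr n.
have g n l := (S_map_graph hdot hrho (cm n) (yc l)).2.
have [|||||N hN] := @finite_dim_uniform R H dot hdot k y
    (fun n l => S_map (fun s a => a - fejer_mult n s a) (y l)) (1 + 1) _ _ _ _ _ e e0.
- by rewrite addr_ge0.
- by move=> l; exact: ((crossedP theta hdot hrho _).1 (yc l)).1.
- by move=> l; exact: crossed_bounded (yc l).
- move=> l d d0; exact: (compl_fejer_graph hdot hrho irr (yc l) (fun n => g n l) d0).
- move=> n m c b; apply: (graph_bound (cm n)) => i j; rewrite !mxE.
  exact: (graph_lincomb hdot hrho _ (cm n) (g n)).
- by exists N => m c b; exact: hN.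
Qed.

(** The Fejer index n depends only on the finite dimensional space furnished by complete
    compactness, hence neither on the matrix size nor on x. S_F x is within e/8 of a matrix w over
    that space; the complement D of the Fejer multiplier has bound 2 on the difference and is small
    on w. *)
Lemma hs_inv_cc_dense F : hs_inv_cc (@C_circle R) rho rot F -> forall e : R, 0 < e ->
  exists k (c : 'I_k -> C) (p : 'I_k -> A) (u : 'I_k -> int -> C),
    [/\ forall l, L1_circle (p l), forall l, fourier_algebra (u l) &
      (hs_norm (@C_circle R) rho rot
        (F - \sum_(l < k) c l *: conv_multiplier (p l) (u l))%R < e%:E)%E].
Proof.
move=> [Fhs Fcc Finv] e e0; have [M FM] := herz_schur_mult hdot hrho Fhs.
have [[M0 _] [K FK] linF] := FM; have e8 : 0 < e / 8 by rewrite divr_gt0.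
have [k [y [yc hy]]] := Fcc _ e8.
have D0 : 0 < M + e / 8 by rewrite ltr_wpDl.
(* The norm of w will be at most M + e/8, so D moves it to norm at most e/8. *)
have d0 : 0 < e / 8 / (M + e / 8) by rewrite divr_gt0.
have [n hn] := compl_fejer_uniform yc d0.
have [k' [c' [p [u [pL uA sumE]]]]] := fejer_mult_comp n FK linF
  (fun s t a aC => Finv s t a aC).
exists k', c', p, u; split=> //.
pose D := (fun s a => a - fejer_mult n s a) : int -> A -> A.
have DM : mult (1 + 1) D := mult_compl_fejer hdot hrho irr n.
set E := (F - _)%R.
have DE s a : C_circle a -> D s (F s a) = E s a.
  by move=> aC; rewrite /D -(sumE s a aC).
have EM : mult ((1 + 1) * M) E := mult_ext DE (mult_comp hdot hrho DM FM).
apply: (@le_lt_trans _ _ (e / 2)%:E); last by rewrite lte_fin; lra.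
have e2 : 0 <= e / 2 by rewrite divr_ge0 // ltW.
apply: ge_ereal_sup => _ [m [x [xc x1 ->]]]; apply/(l2op_normP _ e2).
have [w [wy /l2op_norm_ltP[d [de hd]]]] := hy m x xc x1.
pose c i j := sval (cid (wy i j)).
have cE i j : w i j = \sum_(l < k) c i j l *: y l := svalP (cid (wy i j)).
have wE : w = lincomb y c by apply/matrixP => i j; rewrite mxE.
have hx : opbd 1 x by apply/(l2op_normP _ (ler01 : (0 : R) <= 1)).
have gF i j := S_map_graph hdot hrho FM (xc i j).
have Sx : opbd (M * 1) (map_mx (S_map F) x).
  by apply: (graph_bound FM _ hx) => i j; rewrite mxE; exact: (gF i j).2.
have gD i j := S_map_graph hdot hrho DM (gF i j).1.
have gy l := S_map_graph hdot hrho DM (yc l).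
have hw : opbd (M * 1 + e / 8) (lincomb y c).
  have := opbdB Sx (opbd_le (ltW de) hd); rewrite opprB [X in opbd _ X]addrC subrK wE.
  exact.
have h1 := hn m c _ hw.
have h2 : opbd ((1 + 1) * (e / 8))
    (map_mx (fun X => S_map D (S_map F X)) x - lincomb (fun l => S_map D (y l)) c).
  apply: (graph_bound DM _ (opbd_le (ltW de) hd)) => i j; rewrite wE !mxE.
  apply: (graph_sub hdot hrho DM (gD i j).2).
  by apply: (graph_lincomb hdot hrho _ DM) => l; exact: (gy l).2.
(* [S_map] selects values for E and for D after F independently. Both lie in the graph of E over the
   same operator, so their difference lies over 0 and has norm 0. *)
have h3 : opbd ((1 + 1) * M * 0)
    (map_mx (S_map E) x - map_mx (fun X => S_map D (S_map F X)) x).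
  apply: (graph_bound (X := 0) EM _ (opbd0 H m)) => i j; rewrite !mxE -(subrr (x i j)).
  apply: (graph_sub hdot hrho EM (S_map_graph hdot hrho EM (xc i j)).2).
  have g1 := graph_comp hdot hrho FM DM (gF i j).2 (gD i j).2.
  move=> r /g1[f [fl f1 f2]]; exists f; split=> //.
  have -> : multiply E f = multiply (fun s a => D s (F s a)) f.
    by apply/funext => s; rewrite /multiply (DE s _ (l1_C fl)).
  exact: f2.
(* The total is 0 + 2 e/8 + e/8, below e/2. *)
have := opbdD h3 (opbdD h2 h1); rewrite subrK subrK; apply: opbd_le.
by rewrite mulr1 divfK ?gt_eqF // mulr0 add0r; lra.
Qed.

End Density.

Theorem theorem4p2 (R : realType) (H : completeNormedModType R[i])
    (dot : {dot H for Num.conj}) (hdot : hilbert_dot dot)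
    (rho : (circle R -> R[i]) -> H -> H) (hrho : faithful_rep dot rho)
    (theta : R) (htheta : irrational theta) :
  (forall f u, L1_circle f -> fourier_algebra u ->
     hs_inv_cc (@C_circle R) rho (rotation theta) (conv_multiplier f u)) /\
  (forall F, hs_inv_cc (@C_circle R) rho (rotation theta) F ->
     forall e : R, 0 < e ->
       exists k (c : 'I_k -> R[i]) (f : 'I_k -> circle R -> R[i])
           (u : 'I_k -> int -> R[i]),
         [/\ forall l, L1_circle (f l), forall l, fourier_algebra (u l) &
           (hs_norm (@C_circle R) rho (rotation theta)
              (F - \sum_(l < k) c l *: conv_multiplier (f l) (u l))%R
              < e%:E)%E]).
Proof.
split=> [f u fL uA|F hF].
  exact: (conv_multiplier_hs hdot hrho htheta fL uA).
exact: (hs_inv_cc_dense hdot hrho htheta hF).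
Qed.
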